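(* Let $1\le m\le n$ and let $X$ be a compact set in $\mathbb{C}^n$. Then the following conditions are equivalent: (1) $X$ is an $O^m$-regular set, i.e. $O_X^m$ is a closed subset of $X$; (2) for every $f\in\mathcal{C}(O_X^m)$ there exists a function $u\in\mathcal{SH}_m(X)\cap\mathcal{C}(X)$ such that $u=f$ on $O_X^m$; (3) for every $f\in\mathcal{C}(B_X^m)$ there exists a function $u\in\mathcal{SH}_m(X)\cap\mathcal{C}(X)$ such that $u=f$ on $B_X^m$.
   Context: $m$-subharmonic functions on open sets: a $C^2$ function on an open set $U\subseteq\mathbb{C}^n$ is $m$-subharmonic if at each point the elementary symmetric polynomials $\sigma_1,\dots,\sigma_m$ of the eigenvalues of its complex Hessian are nonnegative; in general a subharmonic function $u$ on $U$ is $m$-subharmonic if $dd^cu\wedge dd^cv_1\wedge\dots\wedge dd^cv_{m-1}\wedge(dd^c\|z\|^2)^{n-m}\ge 0$ in the sense of currents for all $C^2$ $m$-subharmonic functions $v_1,\dots,v_{m-1}$ on open subsets of $U$. Thus $m=1$ gives subharmonic functions and $m=n$ gives plurisubharmonic functions. Let $X\subseteq\mathbb{C}^n$ be compact. $\mathcal{SH}_m^o(X)$ is the set of restrictions to $X$ of functions that are $m$-subharmonic and continuous on some neighborhood of $X$. For $z\in X$, $\mathcal{J}_z^m=\mathcal{J}_z^m(X)$ is the set of non-negative regular Borel measures $\mu$ on $X$ with $\mu(X)=1$ and $u(z)\le\int_X u\,d\mu$ for all $u\in\mathcal{SH}_m^o(X)$. $\mathcal{SH}_m(X)$ is the set of upper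 semicontinuous functions $u$ on $X$ with $u(z)\le\int_X u\,d\mu$ for all $z\in X$ and all $\mu\in\mathcal{J}_z^m(X)$. $\mathcal{C}(E)$ denotes the continuous real-valued functions on $E$. The Choquet boundary is $O_X^m=\{z\in X:\mathcal{J}_z^m=\{\delta_z\}\}$, and the Šilov boundary $B_X^m$ is the topological closure of $O_X^m$. *)

(* Defs.v *)
From HB Require Import structures.
From mathcomp Require Import all_boot all_order all_algebra.
From mathcomp Require Import perm complex.
From mathcomp Require Import all_classical all_reals all_analysis.
From mathcomp Require Import measurable_realfun.

Set Implicit Arguments.
Unset Strict Implicit.
Unset Printing Implicit Defensive.

Import Order.TTheory GRing.Theory Num.Theory.
Import numFieldNormedType.Exports.

Local Open Scope classical_set_scope.
Local Open Scope ring_scope.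

Section pushforward_measure.
Context d1 d2 (T1 : measurableType d1) (T2 : measurableType d2) (R : realType).
Context (mu : {measure set T1 -> \bar R}) (f : T1 -> T2).
Hypothesis mf : measurable_fun [set: T1] f.

Lemma pushforward_semi_sigma_additive : semi_sigma_additive (pushforward mu f).
Proof.
move=> F mF tF mUF; rewrite /pushforward preimage_bigcup.
have mpre A : measurable A -> measurable (f @^-1` A).
  by move=> mA; rewrite -[X in measurable X]setTI; exact: mf.
apply: measure_semi_sigma_additive.
- by move=> k; exact: mpre.
- apply/trivIsetP => /= i j _ _ ij; rewrite -preimage_setI.
  by move/trivIsetP : tF => /(_ _ _ _ _ ij) ->//; rewrite preimage_set0.
- by rewrite -preimage_bigcup; exact: mpre.
Qed.

End pushforward_measure.

Section lebesgue_tuple.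
Context (R : realType).
Local Notation T := (measurableTypeR R).

Definition cons_pair d (p : T * d.-tuple T) : d.+1.-tuple T :=
  [tuple of p.1 :: p.2].

Definition uncons_pair d (t : d.+1.-tuple T) : T * d.-tuple T :=
  (thead t, [tuple of behead t]).

Lemma measurable_cons_pair d : measurable_fun setT (@cons_pair d).
Proof. exact: measurable_cons. Qed.

Lemma measurable_uncons_pair d : measurable_fun setT (@uncons_pair d).
Proof.
by apply/measurable_fun_pair; [exact: measurable_tnth|exact: measurable_behead].
Qed.

Lemma cons_pairK d : cancel (@cons_pair d) (@uncons_pair d).
Proof. by move=> [x t]; congr pair; apply/val_inj. Qed.

Section cons.
Context (d : nat) (m1 : {sigma_finite_measure set T -> \bar R}).
Context (mu : {sigma_finite_measure set (d.-tuple T) -> \bar R}).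

Definition cons_measure : set (d.+1.-tuple T) -> \bar R :=
  pushforward (m1 \x mu)%E (@cons_pair d).

Let cons_measure0 : cons_measure set0 = 0%E.
Proof. by rewrite /cons_measure /pushforward preimage_set0 measure0. Qed.

Let cons_measure_ge0 A : (0 <= cons_measure A)%E.
Proof. by rewrite /cons_measure /pushforward measure_ge0. Qed.

Let cons_measure_sigma_additive : semi_sigma_additive cons_measure.
Proof.
exact: (pushforward_semi_sigma_additive (measurable_cons_pair (d := d))).
Qed.

HB.instance Definition _ := isMeasure.Build _ _ _ cons_measure
  cons_measure0 cons_measure_ge0 cons_measure_sigma_additive.

Let cons_measure_sigma_finite : sigma_finite setT cons_measure.
Proof.
have /sigma_finiteP[F [TF ndF Foo]] := sigma_finiteT m1.
have /sigma_finiteP[G [TG ndG Goo]] := sigma_finiteT mu.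
exists (fun k => @uncons_pair d @^-1` (F k `*` G k)).
  apply/esym/seteqP; split => // t _.
  have [i _ Fi] : (\bigcup_k F k) (uncons_pair t).1 by rewrite -TF.
  have [j _ Gj] : (\bigcup_k G k) (uncons_pair t).2 by rewrite -TG.
  exists (maxn i j) => //; split.
    by move: Fi; exact/subsetPset/ndF/leq_maxl.
  by move: Gj; exact/subsetPset/ndG/leq_maxr.
move=> k; have [mFk Fkoo] := Foo k; have [mGk Gkoo] := Goo k; split.
  rewrite -[X in measurable X]setTI.
  by apply: measurable_uncons_pair => //; exact: measurableX.
rewrite /cons_measure /pushforward -comp_preimage.
rewrite (_ : _ \o _ = id); last by apply/funext; exact: cons_pairK.
rewrite preimage_id.
by rewrite product_measure1E// lte_mul_pinfty// ge0_fin_numE.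
Qed.

HB.instance Definition _ := Measure_isSigmaFinite.Build _ _ _ cons_measure
  cons_measure_sigma_finite.
End cons.

Fixpoint lebesgue_tuple d : {sigma_finite_measure set (d.-tuple T) -> \bar R} :=
  if d is d'.+1 then cons_measure (@lebesgue_measure R) (lebesgue_tuple d')
  else \d_[tuple of [::]].

End lebesgue_tuple.

Notation borel_rV R N := (g_sigma_algebraType (@open 'rV[R]_N)).

Definition row_of_tuple (R : realType) N (t : N.-tuple (measurableTypeR R)) :
  borel_rV R N := \row_i tnth t i.

Lemma measurable_row_of_tuple (R : realType) N :
  measurable_fun setT (@row_of_tuple R N).
Proof.
apply: (@measurability _ _ _ _ setT (@row_of_tuple R N) (@open 'rV[R]_N)) => //.
move=> _ [U oU <-]; rewrite setTI.
pose box (p : N.-tuple rat * nat) : set (N.-tuple (measurableTypeR R)) :=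
  \big[setI/setT]_(i < N)
    ((@tnth _ _)^~ i @^-1` ball (ratr (tnth p.1 i) : R) (p.2.+1%:R^-1 : R)).
have boxP p t : box p t <->
    forall i, ball (ratr (tnth p.1 i) : R) (p.2.+1%:R^-1 : R) (tnth t i).
  rewrite /box -bigcap_seq; split=> [h i|h i _]; last exact: h.
  by apply: h => /=; exact: mem_index_enum.
have mbox p : measurable (box p).
  apply: bigsetI_measurable => i _.
  rewrite -[X in measurable X]setTI; apply: measurable_tnth => //.
  by apply: open_measurable; exact: ball_open.
pose F p := if `[< box p `<=` @row_of_tuple R N @^-1` U >] then box p else set0.
have -> : @row_of_tuple R N @^-1` U = \bigcup_p F p.
  apply/seteqP; split => [t Ut|t [p _]]; last first.
    by rewrite /F; case: asboolP => // h /h.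
  have /nbhs_ballP[e /= e0 eU] : nbhs (row_of_tuple t : 'rV[R]_N) U.
    exact: open_nbhs_nbhs.
  have [k ke] : exists k : nat, k.+1%:R^-1 < e / 2.
    have e20 : 0 < e / 2 by rewrite divr_gt0.
    by have [k _ /(_ k (leqnn k))] := near_infty_natSinv_lt (PosNum e20); exists k.
  have k0 : 0 < k.+1%:R^-1 :> R by [].
  have qP (i : 'I_N) : exists q : rat, ball (tnth t i : R) (k.+1%:R^-1 : R) (ratr q).
    have b0 : ball (tnth t i : R) (k.+1%:R^-1 : R) !=set0.
      by exists (tnth t i); exact: ballxx.
    have [x [bx [q _ qx]]] := dense_rat b0 (ball_open (tnth t i : R) _).
    by exists q; rewrite qx.
  have [q qb] := choice qP.
  exists ([tuple q i | i < N], k) => //; rewrite /F; case: asboolP.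
    by move=> _; apply/boxP => i /=; rewrite tnth_mktuple; exact/ball_sym.
  case=> s /boxP sb; apply: eU; split => // i j; rewrite !mxE.
  have := sb j; rewrite /= tnth_mktuple => sqj.
  have := ball_triangle (qb j) sqj.
  by apply: le_ball; rewrite [leRHS]splitr lerD// ltW//.
apply: countable_bigcupT_measurable.
  exact: countableP.
by move=> p; rewrite /F; case: asboolP => _.
Qed.

Section lebesgue_rV.
Context (R : realType) (N : nat).

Definition lebesgue_rV : set (borel_rV R N) -> \bar R :=
  pushforward (lebesgue_tuple R N) (@row_of_tuple R N).

Let lebesgue_rV0 : lebesgue_rV set0 = 0%E.
Proof. by rewrite /lebesgue_rV /pushforward preimage_set0 measure0. Qed.

Let lebesgue_rV_ge0 A : (0 <= lebesgue_rV A)%E.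
Proof. by rewrite /lebesgue_rV /pushforward measure_ge0. Qed.

Let lebesgue_rV_sigma_additive : semi_sigma_additive lebesgue_rV.
Proof.
exact: (pushforward_semi_sigma_additive (measurable_row_of_tuple (N := N))).
Qed.

HB.instance Definition _ := isMeasure.Build _ _ _ lebesgue_rV
  lebesgue_rV0 lebesgue_rV_ge0 lebesgue_rV_sigma_additive.

End lebesgue_rV.

Section smooth.
Context (R : realType) (N : nat).
Implicit Types (U : set 'rV[R]_N) (f : 'rV[R]_N -> R).

Definition partial (i : 'I_N) f : 'rV[R]_N -> R :=
  fun z => 'D_(delta_mx 0 i : 'rV[R]_N) f z.

(* Only meaningful for [U] open: the derivatives are two-sided. *)
Fixpoint class_C (k : nat) U f : Prop :=
  (forall z, U z -> {for z, continuous f}) /\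
  if k is k'.+1 then
    forall i, (forall z, U z -> derivable f z (delta_mx 0 i : 'rV[R]_N)) /\
              class_C k' U (partial i f)
  else True.

Definition nonneg_test_function U f :=
  [/\ forall k, class_C k setT f, forall z, 0 <= f z &
      exists K, [/\ compact K, K `<=` U & forall z, ~ K z -> f z = 0]].

Definition normsq (z : 'rV[R]_N) : R := \sum_i z 0 i ^+ 2.

(* The norm of the library on ['rV[R]_N] is the supremum norm. *)
Definition euclidean_ball (a : 'rV[R]_N) (r : R) : set 'rV[R]_N :=
  [set z | normsq (z - a) <= r ^+ 2].

Definition upper_semicontinuous_on (A : set 'rV[R]_N) (u : 'rV[R]_N -> \bar R) :=
  lower_semicontinuous (fun z : subspace A => - u z)%E.

Definition subharmonic U (u : 'rV[R]_N -> \bar R) :=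
  [/\ forall z, U z -> (u z < +oo)%E,
      upper_semicontinuous_on U u,
      forall z, U z -> exists2 y, connected_component U z y & u y <> -oo%E &
      forall a r, 0 < r -> euclidean_ball a r `<=` U ->
        (@lebesgue_rV R N (euclidean_ball a r) * u a <=
         \int[@lebesgue_rV R N]_(z in euclidean_ball a r) u z)%E].

End smooth.

(* C^n is ['rV[R]_(n + n)], with real coordinates x_1, ..., x_n, y_1, ..., y_n
   where z_j = x_j + i y_j. *)

Section msubharmonic.
Context (R : realType) (n : nat).
Local Notation Cn := 'rV[R]_(n + n).
Implicit Types (U V : set Cn) (f : Cn -> R).

Definition dx (j : 'I_n) f : Cn -> R := partial (lshift n j) f.
Definition dy (j : 'I_n) f : Cn -> R := partial (rshift n j) f.

(* d^2 f / dz_j dzbar_k, where d/dz_j = (d/dx_j - i d/dy_j) / 2 and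
   d/dzbar_k = (d/dx_k + i d/dy_k) / 2 *)
Definition complex_hessian f (z : Cn) : 'M[R[i]]_n :=
  \matrix_(j, k) Complex
    ((dx j (dx k f) z + dy j (dy k f) z) / 4)
    ((dx j (dy k f) z - dy j (dx k f) z) / 4).

Definition esym (k : nat) (l : 'I_n -> R) : R :=
  \sum_(A : {set 'I_n} | #|A| == k) \prod_(i in A) l i.

(* [l] lists the eigenvalues of [A] with multiplicity. *)
Definition eigenvalues (A : 'M[R[i]]_n) (l : 'I_n -> R) :=
  char_poly A = \prod_(i < n) ('X - (Complex (l i) 0)%:P).

Definition C2_msubharmonic (m : nat) V f :=
  class_C 2 V f /\
  forall z, V z -> exists2 l, eigenvalues (complex_hessian f z) l &
    forall k, (1 <= k <= m)%N -> 0 <= esym k l.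

(* The density of dd^c f_1 /\ ... /\ dd^c f_n with respect to Lebesgue measure,
   where dd^c f = 2i \sum_(j, k) (d^2 f / dz_j dzbar_k) dz_j /\ dzbar_k. For
   permutations s and t, the product of the i dz_(s k) /\ dzbar_(t k) over k is
   sgn(s) sgn(t) times that of the i dz_j /\ dzbar_j = 2 dx_j /\ dy_j. *)
Definition ddc_wedge (f : 'I_n -> Cn -> R) (z : Cn) : R :=
  4 ^+ n * complex.Re
    (\sum_(s : {perm 'I_n}) \sum_(t : {perm 'I_n}) (-1) ^+ s * (-1) ^+ t *
       \prod_(k < n) complex_hessian (f k) z (s k) (t k)).

(* The n functions phi, v_1, ..., v_(m-1), |z|^2, ..., |z|^2; only the values of
   [v] at 1, ..., m - 1 matter. *)
Definition wedge_factors (m : nat) (phi : Cn -> R) (v : nat -> Cn -> R)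
    (k : 'I_n) : Cn -> R :=
  if k == 0 :> nat then phi else if (k < m)%N then v k else @normsq R (n + n).

(* Positivity on V of the current dd^c u /\ T, T = dd^c v_1 /\ ... /\
   dd^c v_(m-1) /\ (dd^c |z|^2)^(n-m). As T is closed with continuous
   coefficients, dd^c u /\ T is dd^c (u T), whose value on a test function phi
   is the integral of u dd^c phi /\ T. *)
Definition ddc_wedge_nonneg (m : nat) V (u : Cn -> \bar R)
    (v : nat -> Cn -> R) :=
  forall phi, nonneg_test_function V phi ->
    (0 <= \int[@lebesgue_rV R (n + n)]_(z in V)
            (u z * (ddc_wedge (wedge_factors m phi v) z)%:E))%E.

Definition msubharmonic (m : nat) U (u : Cn -> \bar R) :=
  subharmonic U u /\
  forall V v, open V -> V `<=` U ->
    (forall j, (1 <= j < m)%N -> C2_msubharmonic m V (v j)) ->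
    ddc_wedge_nonneg m V u v.

(* Functions and measures on a subset of C^n are represented by functions and
   measures on C^n: only the values of a function on the subset matter, and the
   measures are those carried by the subset. *)

Definition SHo (m : nat) (X : set Cn) : set (Cn -> R) :=
  [set u : Cn -> R | exists U w, [/\ open U, X `<=` U, msubharmonic m U (EFin \o w),
    (forall z, U z -> {for z, continuous w}) & {in X, u =1 w}]].

Definition regular_measure
    (mu : {measure set (borel_rV R (n + n)) -> \bar R}) :=
  forall A : set (borel_rV R (n + n)), measurable A ->
    mu A = ereal_inf [set mu V | V in [set V : set Cn | open V /\ A `<=` V]] /\
    mu A = ereal_sup [set mu K | K in [set K : set Cn | compact K /\ K `<=` A]].

Definition Jensen (m : nat) (X : set Cn) (z : Cn)
    (mu : {measure set (borel_rV R (n + n)) -> \bar R}) :=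
  [/\ regular_measure mu, mu X = 1%E, mu (~` X) = 0%E &
      forall u, SHo m X u -> ((u z)%:E <= \int[mu]_(x in X) (u x)%:E)%E].

Definition SH (m : nat) (X : set Cn) (u : Cn -> \bar R) :=
  [/\ forall z, X z -> (u z < +oo)%E,
      upper_semicontinuous_on X u &
      forall z mu, X z -> Jensen m X z mu ->
        (u z <= \int[mu]_(x in X) u x)%E].

(* Measures are compared on Borel sets only: the values of a
   [{measure set _ -> \bar R}] outside the sigma-algebra are irrelevant. *)
Definition Choquet_boundary (m : nat) (X : set Cn) : set Cn :=
  [set z | X z /\ forall mu, Jensen m X z mu <->
    forall A : set (borel_rV R (n + n)), measurable A -> mu A = \d_(z : borel_rV R (n + n)) A].

Definition Silov_boundary (m : nat) (X : set Cn) : set Cn :=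
  closure (Choquet_boundary m X).

Definition O_regular (m : nat) (X : set Cn) :=
  closed (Choquet_boundary m X).

End msubharmonic.

(* Main.v *)
(** Let S be the cone of continuous functions u on X with u(z) <= int u dmu for
    all z in X and mu in J_z. For z in O and g continuous, the sup of v(z) over
    the v in S below g is g(z): otherwise Hahn-Banach and Riesz would give a
    measure of J_z other than the Dirac mass. If O is compact and v in S
    satisfies v <= f <= v + e on O, then a finite maximum w of elements of S
    satisfies w <= f <= w + e/2 on O and v <= w <= v + e on X; iterating this
    gives (2). (3) follows from (2) by density. Under (3),
    extend - |w - z|^2 from B to some u in S, for z in B: the maximum principle
    gives u <= - |w - z|^2 on X, so a measure of J_z has zero variance about z
    and z is in O.

    The variance argument needs the real coordinates and their opposites to be
    m-subharmonic. The mean value property holds by symmetry of the ball; the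
    wedge positivity is the identity int z_a dd^c phi /\ T = 0, an instance of
    the vanishing of the integral of a Jacobian determinant with one compactly
    supported factor of class C^1. As the other factors are only C^1, the
    Jacobian is obtained as the limit of its finite difference analogue, whose
    integral vanishes exactly by translation invariance. *)

Require Import Defs.
From HB Require Import structures.
From mathcomp Require Import all_boot all_order all_algebra.
From mathcomp Require Import perm complex.
From mathcomp Require Import all_classical all_reals all_analysis.
From mathcomp Require Import measurable_realfun ring lra.

Set Implicit Arguments.
Unset Strict Implicit.
Unset Printing Implicit Defensive.

Import Order.TTheory GRing.Theory Num.Theory.
Import numFieldNormedType.Exports.

Local Open Scope classical_set_scope.
Local Open Scope ring_scope.

(** Membership in S is tested by Jensen measures only. Hence S is stable under maxima, positive
    combinations and uniform limits by monotonicity of the integral, with no gluing or smoothing of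
    m-subharmonic functions. Even |x - p|^2 enters S in this way: as c x_i lies in [SHo m X] for
    both signs of c, every mu in J_z has barycenter z, so int |x - p|^2 dmu = |z - p|^2 + int |x -
    z|^2 dmu. The coordinates are thus the only functions whose m-subharmonicity is checked from the
    definition.

    The obstacle lies in that check. The v_j are only C^2, and moving both derivatives off phi would
    differentiate their Hessians. Instead each dd^c F_k is read as the d/dz derivatives of the C^1
    functions given by the first derivatives of F_k, so the wedge density is a combination of
    Jacobian determinants of C^1 functions. Since d(zbar_a)/dz_j = 0, the factor zbar_a can be
    absorbed into the compactly supported function without creating new terms. The density being
    real, the real and imaginary parts of zbar_a times the density give x_a and y_a separately. *)

(** If [P K] fails, the sets whose complement in [K] satisfies [P] form a proper filter containing
    [K]; at a cluster point in [K], the neighbourhood given by the last hypothesis is a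
    contradiction. *)
Lemma compact_induction (T : topologicalType) (K : set T) (P : set T -> Prop) :
  compact K -> P set0 -> (forall A B, A `<=` B -> P B -> P A) ->
  (forall A B, P A -> P B -> P (A `|` B)) ->
  (forall x, K x -> exists2 V, nbhs x V & P (V `&` K)) -> P K.
Proof.
move=> cK P0 PS PU Ploc; apply: contrapT => nPK.
pose F : set (set T) := [set A | P (K `\` A)].
have FF : ProperFilter F.
  split; first by rewrite /F /= setD0.
  split; rewrite /F /=.
  - by rewrite setDT.
  - by move=> A B PA PB; rewrite /= setDIr; exact: PU.
  - by move=> A B AB; apply: PS => x [Kx nBx]; split => // /AB.
have [|x [Kx clx]] := cK F FF; first by rewrite /F /= setDv.
have [V Vx PV] := Ploc x Kx.
have FV : F (~` V) by rewrite /F /= setDE setCK setIC.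
by have [y []] := clx _ _ FV Vx.
Qed.

(** * Lebesgue measure on R^N *)

Section lebesgue_reflection.
Context (R : realType).
Local Notation T := (measurableTypeR R).

(** Reflections serve two purposes: two of them compose to a translation, which is used for the
    finite differences, and the reflection through the center of a ball gives the mean value
    property of the coordinates. *)
Lemma lebesgue_measure_reflect (c : R) (A : set T) : measurable A ->
  lebesgue_measure ((fun x : T => c - x : T) @^-1` A) = lebesgue_measure A.
Proof.
move=> mA; apply/esym.
have mf : measurable_fun setT (fun x : T => c - x : T).
  by apply: measurable_funB.
apply: (@lebesgue_measure_unique _ (pushforward lebesgue_measure (fun x : T => c - x : T)) ) => // _ [[a b]] _ <-.
rewrite /= /pushforward.
have -> : (fun x : T => c - x) @^-1` `]a, b]%classic = `[c - b, c - a[%classic.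
  apply/seteqP; split => x /=; rewrite !in_itv /= => /andP[? ?]; apply/andP; split; lra.
rewrite !lebesgue_measure_itv/= !lte_fin.
have -> : (c - b < c - a) = (a < b) by apply/idP/idP; lra.
by case: ifP => // _; rewrite -!EFinD; congr EFin; lra.
Qed.

Definition reflect_tuple d (c t : d.-tuple T) : d.-tuple T :=
  [tuple (tnth c i - tnth t i : T) | i < d].

Lemma measurable_reflect_tuple d (c : d.-tuple T) :
  measurable_fun setT (reflect_tuple c).
Proof.
apply/measurable_fun_tnthP => i.
apply: (@eq_measurable_fun _ _ _ _ setT (fun t : d.-tuple T => tnth c i - tnth t i : T)).
  by move=> t _; rewrite /= tnth_mktuple.
by apply: measurable_funB => //; exact: measurable_tnth.
Qed.

Lemma lebesgue_tuple_reflect d (c : d.-tuple T) (A : set (d.-tuple T)) :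
  measurable A -> lebesgue_tuple R d (reflect_tuple c @^-1` A) = lebesgue_tuple R d A.
Proof.
elim: d c A => [|d ih] c A mA.
  suff -> : reflect_tuple c @^-1` A = A by [].
  by apply/seteqP; split => t; rewrite /preimage /= (tuple0 (reflect_tuple c t)) (tuple0 t).
case/tupleP: c => c0 c.
rewrite /= /cons_measure.
have mcA : measurable (@cons_pair R d @^-1` A).
  by rewrite -[X in measurable X]setTI; exact: measurable_cons_pair.
pose r (p : T * d.-tuple T) : T * d.-tuple T := (c0 - p.1 : T, reflect_tuple c p.2).
have mr : measurable_fun setT r.
  apply/measurable_fun_pair.
    exact: measurable_funB.
  apply: measurableT_comp => //; exact: measurable_reflect_tuple.
rewrite /pushforward.
have -> : @cons_pair R d @^-1` (reflect_tuple [tuple of c0 :: c] @^-1` A) =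
    r @^-1` (@cons_pair R d @^-1` A).
  apply/seteqP; split => -[x t] /=; congr A; apply/eq_from_tnth => i;
    rewrite ?tnth_mktuple; case: (unliftP ord0 i) => [j|] -> //=;
    by rewrite ?tnthS ?tnth0 ?tnth_mktuple.
(* The reflected product measure has the right values on rectangles, where the two factors separate,
   and these values determine it. *)
rewrite [RHS](@product_measure_unique _ _ _ _ _ _ _
  (pushforward (lebesgue_measure \x lebesgue_tuple R d)%E r)) //.
move=> /= B C mB mC; rewrite /pushforward.
have -> : r @^-1` (B `*` C) =
    ((fun x : T => c0 - x : T) @^-1` B) `*` (reflect_tuple c @^-1` C) by [].
rewrite product_measure1E; first last.
- by rewrite -[X in measurable X]setTI; exact: measurable_reflect_tuple.
- by rewrite -[X in measurable X]setTI; exact: measurable_funB.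
by congr (_ * _)%E; [exact: lebesgue_measure_reflect|exact: ih].
Qed.

Context (N : nat).
Local Notation mu := (@lebesgue_rV R N).

Lemma measurable_continuous_rV (f : borel_rV R N -> borel_rV R N) :
  continuous (f : 'rV[R]_N -> 'rV[R]_N) -> measurable_fun setT f.
Proof.
move=> /continuousP cf.
apply: (@measurability _ _ _ _ setT f (@open 'rV[R]_N)) => //.
move=> _ [U oU <-]; rewrite setTI.
by apply: sub_sigma_algebra; exact: cf.
Qed.

Lemma lebesgue_rV_reflect (c : 'rV[R]_N) (A : set (borel_rV R N)) :
  measurable A -> mu ((fun z : 'rV[R]_N => c - z) @^-1` A) = mu A.
Proof.
move=> mA; rewrite /lebesgue_rV /pushforward.
have mrA : measurable (@row_of_tuple R N @^-1` A).
  by rewrite -[X in measurable X]setTI; exact: measurable_row_of_tuple.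
rewrite -[RHS](lebesgue_tuple_reflect [tuple c 0 i | i < N])//; congr (lebesgue_tuple R N _).
apply/seteqP; split => t /=; congr A; apply/rowP => i;
  by rewrite !mxE !tnth_mktuple.
Qed.

Lemma lebesgue_rV_shift (c : 'rV[R]_N) (A : set (borel_rV R N)) :
  measurable A -> mu ((fun z : 'rV[R]_N => c + z) @^-1` A) = mu A.
Proof.
move=> mA; rewrite -[RHS](lebesgue_rV_reflect c)//.
rewrite -[RHS](lebesgue_rV_reflect 0)//.
  by congr (mu _); apply/seteqP; split => z /=; congr A; rewrite sub0r opprK.
rewrite -[X in measurable X]setTI; apply: measurable_continuous_rV => //.
by move=> z; apply: continuousB; [exact: cst_continuous|exact: cvg_id].
Qed.

Definition tuple_box d (M : R) : set (d.-tuple T) :=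
  [set t | forall i, `|tnth t i : R| <= M].
Arguments tuple_box : clear implicits.

Lemma measurable_tuple_box d (M : R) : measurable (tuple_box d M).
Proof.
have -> : tuple_box d M =
   \big[setI/setT]_(i < d) ((@tnth _ _)^~ i @^-1` `[-M, M]%classic).
  rewrite -bigcap_seq; apply/seteqP; split => t h i.
    by move=> _ /=; rewrite in_itv/= -ler_norml.
  by rewrite ler_norml; have := h i; rewrite /= in_itv; apply; exact: mem_index_enum.
apply: bigsetI_measurable => i _.
by rewrite -[X in measurable X]setTI; apply: measurable_tnth.
Qed.

Lemma lebesgue_tuple_box d (M : R) :
  (lebesgue_tuple R d (tuple_box d M) < +oo)%E.
Proof.
elim: d => [|d ih] /=.
  by rewrite diracE; case: (_ \in _); rewrite ltry.
rewrite /cons_measure /pushforward.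
have -> : @cons_pair R d @^-1` tuple_box d.+1 M =
   (`[-M, M]%classic : set T) `*` tuple_box d M.
  apply/seteqP; split => -[x t] /=.
    move=> h; split => [|i]; last by have := h (lift ord0 i); rewrite tnthS.
    by have := h ord0; rewrite tnth0 /= in_itv/= ler_norml.
  move=> [hx ht] i; case: (unliftP ord0 i) => [j|] ->; rewrite ?tnthS ?tnth0//.
  by move: hx; rewrite in_itv/= -ler_norml.
rewrite product_measure1E//; last exact: measurable_tuple_box.
apply: lte_mul_pinfty => //.
have h := lebesgue_measure_itv `[-M, M].
rewrite ge0_fin_numE//= [ltLHS]h/=.
by case: ifP => // _; rewrite -EFinB ltry.
Qed.

Lemma norm_coord_le (z : 'rV[R]_N) i : `|z 0 i| <= `|z|.
Proof.
rewrite [leRHS]mx_normrE (le_trans _ (le_bigmax _ _ (ord0, i)))//=.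
Qed.

Lemma norm_le_rV (z : 'rV[R]_N) M : 0 <= M -> (forall i, `|z 0 i| <= M) -> `|z| <= M.
Proof.
move=> M0 h; rewrite [leLHS]mx_normrE; apply: bigmax_le => // -[i j] _ /=.
by rewrite ord1.
Qed.

Lemma lebesgue_rV_bounded (A : set (borel_rV R N)) (M : R) : measurable A ->
  (forall z : 'rV[R]_N, A z -> `|z| <= M) -> (mu A < +oo)%E.
Proof.
move=> mA AM; apply: le_lt_trans (lebesgue_tuple_box N M).
rewrite /lebesgue_rV /pushforward le_measure ?inE//.
- by rewrite -[X in measurable X]setTI; exact: measurable_row_of_tuple.
- exact: measurable_tuple_box.
- move=> t /= /AM h i; apply: le_trans h.
  by have := norm_coord_le (row_of_tuple t) i; rewrite mxE.
Qed.

End lebesgue_reflection.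

(** * The Hahn-Banach theorem *)

Section hahn_banach.
Context (R : realType) (V : lmodType R) (C : set V).
Hypothesis C0 : C 0.
Hypothesis CZD : forall a x y, C x -> C y -> C (a *: x + y).
Implicit Types p : V -> R.

Let CD x y : C x -> C y -> C (x + y).
Proof. by move=> Cx Cy; rewrite -[x]scale1r; exact: CZD. Qed.

Let CZ a x : C x -> C (a *: x).
Proof. by move=> Cx; rewrite -[_ *: _]addr0; exact: CZD. Qed.

Let CN x : C x -> C (- x).
Proof. by move=> Cx; rewrite -scaleN1r; exact: CZ. Qed.

Definition sublinear_on p :=
  (forall x y, C x -> C y -> p (x + y) <= p x + p y) /\
  (forall a x, 0 <= a -> C x -> p (a *: x) <= a * p x).

Let sublinear0 p : sublinear_on p -> p 0 = 0.
Proof.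
move=> [pD pZ]; have := pD _ _ C0 C0; have := pZ 0 _ (lexx _) C0.
by rewrite scale0r addr0; lra.
Qed.

Let sublinearZ p a x : sublinear_on p -> 0 <= a -> C x -> p (a *: x) = a * p x.
Proof.
move=> sp a0 Cx; apply/eqP; rewrite eq_le (sp.2 a x)//=.
move: a0; rewrite [0 <= a]le_eqVlt => /orP[/eqP<-|a0].
  by rewrite mul0r scale0r sublinear0.
have := sp.2 a^-1 (a *: x); rewrite invr_ge0 ltW// scalerA mulVf ?gt_eqF// scale1r.
by move=> /(_ isT (CZ _ Cx)); rewrite ler_pdivlMl.
Qed.

Let sublinearN p x : sublinear_on p -> C x -> - p (- x) <= p x.
Proof.
move=> sp Cx; have := sp.1 x (- x) Cx (CN Cx).
by rewrite subrr sublinear0//; lra.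
Qed.

(** For [p] sublinear this is the largest sublinear functional below [p] whose value at [- y] is at
    most [- p y]. *)
Let tilt p y x := inf [set p (x + t *: y) - t * p y | t in [set t | 0 <= t]].

Let tilt_le p y x t : sublinear_on p -> C x -> C y -> 0 <= t ->
  tilt p y x <= p (x + t *: y) - t * p y.
Proof.
move=> sp Cx Cy t0; apply: ge_inf; last by exists t.
exists (- p (- x)) => _ [s s0 <-].
have := sp.1 (x + s *: y) (- x) (CD Cx (CZ _ Cy)) (CN Cx).
by rewrite addrAC subrr add0r sublinearZ//; lra.
Qed.

Let le_tilt p y x c :
  (forall t, 0 <= t -> c <= p (x + t *: y) - t * p y) -> c <= tilt p y x.
Proof.
move=> h; apply: lb_le_inf; first by exists (p (x + 0 *: y) - 0 * p y); exists 0 => /=.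
by move=> _ [t t0 <-]; exact: h.
Qed.

Let tilt_sublinear p y : sublinear_on p -> C y -> sublinear_on (tilt p y).
Proof.
move=> sp Cy; split => [x x' Cx Cx'|a x].
  rewrite -lerBlDr; apply: le_tilt => t t0; rewrite lerBlDr -lerBlDl.
  apply: le_tilt => s s0; rewrite lerBlDl.
  apply: le_trans (tilt_le sp (CD Cx Cx') Cy (addr_ge0 t0 s0)) _.
  have := sp.1 (x + t *: y) (x' + s *: y) (CD Cx (CZ _ Cy)) (CD Cx' (CZ _ Cy)).
  by rewrite addrACA -scalerDl; lra.
rewrite [0 <= a]le_eqVlt => /orP[/eqP<-|a0] Cx.
  rewrite scale0r mul0r; apply: le_trans (tilt_le sp C0 Cy (lexx _)) _.
  by rewrite scale0r addr0 sublinear0// mul0r subrr.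
rewrite mulrC -ler_pdivrMr//; apply: le_tilt => t t0; rewrite ler_pdivrMr//.
have := tilt_le sp (CZ a Cx) Cy (mulr_ge0 (ltW a0) t0).
rewrite -scalerA -scalerDr (sublinearZ sp (ltW a0) (CD Cx (CZ _ Cy))).
by move=> h; rewrite [leRHS]mulrC mulrBr mulrA.
Qed.

(** A minimal sublinear functional is linear: [tilt L y <= L] forces [L <= tilt L y], and [t = 1] in
    the infimum gives [L x + L y <= L (x + y)]. Zorn's lemma thus replaces the extension of a
    functional one dimension at a time. *)
Lemma hahn_banach p x0 : sublinear_on p -> C x0 -> exists L,
  [/\ forall a x y, C x -> C y -> L (a *: x + y) = a * L x + L y,
      forall x, C x -> L x <= p x & L x0 = p x0].
Proof.
move=> sp Cx0.
(* Searching below [tilt p x0] rather than below [p] ensures [L (- x0) <= - p x0], hence equality at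
   [x0]. The order [r] is reversed, so that maximal elements are minimal functionals. *)
pose P q := sublinear_on q /\ forall x, C x -> q x <= tilt p x0 x.
have Pt : P (tilt p x0) by split=> //; exact: tilt_sublinear.
pose T := {q : V -> R | P q}.
pose r (q q' : T) := `[< forall x, C x -> sval q' x <= sval q x >].
have [||A Atot|[L [sL Lle]] Lmin] := @ZL_preorder T (exist _ _ Pt) r.
- by move=> q; apply/asboolP.
- move=> q q' q'' /asboolP h /asboolP h'; apply/asboolP => x Cx.
  exact: le_trans (h' _ Cx) (h _ Cx).
- have [A0|/set0P[q0 Aq0]] := eqVneq A set0.
    by exists (exist _ _ Pt) => q; rewrite A0.
  (* The infimum is finite because [q x >= - q (- x)], and [q (- x)] is bounded by the tilted
     functional. Its subadditivity uses that [A] is a chain: of two members, the smaller one serves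
     for both arguments. *)
  pose m x := inf [set sval q x | q in A].
  have mle (q : T) x : A q -> C x -> m x <= sval q x.
    move=> Aq Cx; apply: ge_inf; last by exists q.
    exists (- tilt p x0 (- x)) => _ [[q' [sq' hq']] _ <-] /=.
    by apply: le_trans (sublinearN sq' Cx); rewrite lerN2; exact: hq' (CN Cx).
  have lem c x : (forall q, A q -> c <= sval q x) -> c <= m x.
    move=> h; apply: lb_le_inf; first by exists (sval q0 x); exists q0.
    by move=> _ [q Aq <-]; exact: h.
  have Pm : P m.
    split; last by move=> x Cx; apply: le_trans (mle _ _ Aq0 Cx) _; exact: (svalP q0).2.
    split => [x y Cx Cy|a x].
      rewrite -lerBlDr; apply: (lem) => q Aq; rewrite lerBlDr -lerBlDl.
      apply: (lem) => q' Aq'; rewrite lerBlDl.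
      have [/asboolP h|/asboolP h] := Atot _ _ Aq Aq'.
        apply: le_trans (mle _ _ Aq' (CD Cx Cy)) _.
        apply: le_trans ((svalP q').1.1 _ _ Cx Cy) _.
        by rewrite lerD2r; exact: h.
      apply: le_trans (mle _ _ Aq (CD Cx Cy)) _.
      apply: le_trans ((svalP q).1.1 _ _ Cx Cy) _.
      by rewrite lerD2l; exact: h.
    rewrite [0 <= a]le_eqVlt => /orP[/eqP<-|a0] Cx.
      rewrite scale0r mul0r; apply: le_trans (mle _ _ Aq0 C0) _.
      by rewrite sublinear0//; exact: (svalP q0).1.
    rewrite mulrC -ler_pdivrMr//; apply: (lem) => q Aq; rewrite ler_pdivrMr// mulrC.
    apply: le_trans (mle _ _ Aq (CZ _ Cx)) _.
    by apply: (svalP q).1.2 => //; exact: ltW.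
  by exists (exist _ _ Pm) => q Aq; apply/asboolP => x Cx /=; exact: mle.
have LD x y : C x -> C y -> L (x + y) = L x + L y.
  move=> Cx Cy; apply/eqP; rewrite eq_le sL.1//=.
  have tle z : C z -> tilt L y z <= L z.
    by move=> Cz; have := tilt_le sL Cz Cy (lexx 0); rewrite scale0r addr0 mul0r subr0.
  have PL : P (tilt L y).
    split; first exact: tilt_sublinear.
    by move=> z Cz; apply: le_trans (tle _ Cz) (Lle _ Cz).
  have /asboolP/(_ x Cx)/= h := Lmin (exist _ _ PL) (asboolT tle).
  have := le_trans h (tilt_le sL Cx Cy ler01).
  by rewrite scale1r mul1r; lra.
have LN x : C x -> L (- x) = - L x.
  by move=> Cx; have := LD x (- x) Cx (CN Cx); rewrite subrr sublinear0//; lra.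
exists L; split.
- move=> a x y Cx Cy; rewrite LD//; last exact: CZ.
  congr (_ + _); have [a0|a0] := leP 0 a; first exact: sublinearZ.
  rewrite -[a]opprK scaleNr LN ?sublinearZ ?mulNr//; last exact: CZ.
  by rewrite oppr_ge0 ltW.
- move=> x Cx; apply: le_trans (Lle _ Cx) _.
  by have := tilt_le sp Cx Cx0 (lexx 0); rewrite scale0r addr0 mul0r subr0.
- apply/eqP; rewrite eq_le; apply/andP; split.
    apply: le_trans (Lle _ Cx0) _.
    by have := tilt_le sp Cx0 Cx0 (lexx 0); rewrite scale0r addr0 mul0r subr0.
  have := le_trans (Lle _ (CN Cx0)) (tilt_le sp (CN Cx0) Cx0 ler01).
  by rewrite LN// scale1r addNr mul1r sublinear0//; lra.
Qed.

End hahn_banach.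

(** * The Riesz representation theorem *)

Section within_continuous.
Context (R : realType) (T : topologicalType) (A : set T).
Implicit Types f g : T -> R.

Lemma within_continuous_cst (c : R) : {within A, continuous (fun=> c : R)}.
Proof. by move=> x; exact: cst_continuous. Qed.

Lemma within_continuousZD (a : R) f g :
  {within A, continuous f} -> {within A, continuous g} ->
  {within A, continuous (fun x => a * f x + g x)}.
Proof.
move=> cf cg x; apply: cvgD; last exact: cg.
by apply: cvgM; [exact: cst_continuous|exact: cf].
Qed.

Lemma within_continuousD f g :
  {within A, continuous f} -> {within A, continuous g} ->
  {within A, continuous (fun x => f x + g x)}.
Proof. by move=> cf cg x; apply: cvgD; [exact: cf|exact: cg]. Qed.

Lemma within_continuousB f g :
  {within A, continuous f} -> {within A, continuous g} ->
  {within A, continuous (fun x => f x - g x)}.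
Proof. by move=> cf cg x; apply: cvgB; [exact: cf|exact: cg]. Qed.

Lemma within_continuous_max f g :
  {within A, continuous f} -> {within A, continuous g} ->
  {within A, continuous (fun x => Num.max (f x) (g x))}.
Proof. by move=> cf cg x; apply: continuous_max; [exact: cf|exact: cg]. Qed.

Lemma within_continuous_min f g :
  {within A, continuous f} -> {within A, continuous g} ->
  {within A, continuous (fun x => Num.min (f x) (g x))}.
Proof. by move=> cf cg x; apply: continuous_min; [exact: cf|exact: cg]. Qed.

Lemma within_continuous_lt f (c : R) : {within A, continuous f} ->
  exists2 U, open U & forall x, A x -> U x <-> f x < c.
Proof.
move=> /continuousP cf.
have [U oU UE] := (open_subspaceP _ _).1 (cf _ (@open_lt R c)).
exists U => // x Ax; split => [Ux|fx].
  by have [] : ((f @^-1` [set y | y < c]) `&` A) x by rewrite -UE; split.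
by have [] : (U `&` A) x by rewrite UE; split.
Qed.

Lemma within_continuous_gt f (c : R) : {within A, continuous f} ->
  exists2 U, open U & forall x, A x -> U x <-> c < f x.
Proof.
move=> /continuousP cf.
have [U oU UE] := (open_subspaceP _ _).1 (cf _ (@open_gt R c)).
exists U => // x Ax; split => [Ux|fx].
  by have [] : ((f @^-1` [set y | c < y]) `&` A) x by rewrite -UE; split.
by have [] : (U `&` A) x by rewrite UE; split.
Qed.

Lemma within_compact_bounded f : compact A -> {within A, continuous f} ->
  exists2 M : R, 0 < M & forall x, A x -> `|f x| <= M.
Proof.
move=> cA cf.
have /ex_strict_bound_gt0[M M0 /= hM] : bounded_set (f @` A).
  exact/compact_bounded/continuous_compact.
by exists M => // x Ax; apply/ltW/hM; exists x.
Qed.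

End within_continuous.

Section borel_rV.
Context (R : realType) (N : nat).
Implicit Types (V X : set 'rV[R]_N) (mu : {measure set (borel_rV R N) -> \bar R}).

Lemma measurable_open_rV V : open V -> measurable (V : set (borel_rV R N)).
Proof. exact: sub_sigma_algebra. Qed.

Lemma measurable_closed_rV V : closed V -> measurable (V : set (borel_rV R N)).
Proof.
move=> cV; rewrite -[V]setCK; apply: measurableC.
by apply: measurable_open_rV; exact: closed_openC.
Qed.

Lemma measurable_fun_within X (f : borel_rV R N -> R) :
  measurable (X : set (borel_rV R N)) ->
  {within X, continuous (f : 'rV[R]_N -> R)} ->
  measurable_fun (X : set (borel_rV R N)) f.
Proof.
move=> mX cf; apply: (measurability _ (RGenOInfty.measurableE R)) => //.
move=> _ [_ [c ->] <-]; have [U oU UE] := within_continuous_gt c cf.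
have -> : X `&` f @^-1` `]c, +oo[ = X `&` U; last first.
  by apply: measurableI => //; exact: measurable_open_rV.
by apply/seteqP; split => x [Xx h]; split => //; move: h; rewrite /= in_itv/= andbT => /UE; apply.
Qed.

Context (X : set 'rV[R]_N) (mu : {measure set (borel_rV R N) -> \bar R}).
Hypothesis cX : compact X.
Hypothesis muX : (mu X < +oo)%E.

Let mX : measurable (X : set (borel_rV R N)).
Proof. by apply: measurable_closed_rV; exact: compact_closed cX. Qed.

Lemma integrable_within (f : borel_rV R N -> R) :
  {within X, continuous (f : 'rV[R]_N -> R)} -> mu.-integrable X (EFin \o f).
Proof.
move=> cf; apply: measurable_bounded_integrable => //.
  exact: measurable_fun_within.
have [M _ hM] := within_compact_bounded cX cf.
by exists M; split; [exact: num_real|] => M' MM' x Xx; apply: le_trans (hM x Xx) (ltW MM').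
Qed.

Lemma EFin_Rintegral_within (f : borel_rV R N -> R) :
  {within X, continuous (f : 'rV[R]_N -> R)} ->
  (\int[mu]_(x in X) f x)%:E = (\int[mu]_(x in X) (f x)%:E)%E.
Proof. by move=> /integrable_within cf; rewrite fineK//; exact: integrable_fin_num. Qed.

End borel_rV.

Section riesz.
Context (R : realType) (N : nat) (X : set 'rV[R]_N) (L : ('rV[R]_N -> R) -> R).
Hypothesis cX : compact X.
Implicit Types f g : 'rV[R]_N -> R.
Let C (f : 'rV[R]_N -> R) := {within X, continuous f}.
Hypothesis LZD : forall a f g, C f -> C g ->
  L (fun x => a * f x + g x) = a * L f + L g.
Hypothesis L_ge0 : forall f, C f -> (forall x, X x -> 0 <= f x) -> 0 <= L f.
Hypothesis L1 : L (fun=> 1) = 1.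

Let closedX : closed X. Proof. exact: compact_closed cX. Qed.

Let Cc c : C (fun=> c : R). Proof. exact: within_continuous_cst. Qed.

Let LD f g : C f -> C g -> L (fun x => f x + g x) = L f + L g.
Proof.
move=> cf cg; rewrite -[L f]mul1r -LZD//; congr L; apply/funext => x.
by rewrite mul1r.
Qed.

Let LB f g : C f -> C g -> L (fun x => f x - g x) = L f - L g.
Proof.
move=> cf cg; rewrite -mulN1r addrC -LZD//; congr L; apply/funext => x.
by rewrite mulN1r addrC.
Qed.

Let le_L f g : C f -> C g -> (forall x, X x -> f x <= g x) -> L f <= L g.
Proof.
move=> cf cg fg; rewrite -subr_ge0 -LB//; apply: L_ge0.
  exact: within_continuousB.
by move=> x Xx; rewrite subr_ge0; exact: fg.
Qed.

Let L0 : L (fun=> 0) = 0.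
Proof.
rewrite -[RHS](subrr (L (fun=> 0))) -LB//; congr L.
by apply/funext => x; rewrite subrr.
Qed.

Let Lc c : L (fun=> c) = c.
Proof.
have h := LZD c (@Cc 1) (@Cc 0); rewrite L1 L0 addr0 mulr1 in h.
rewrite -[RHS]h; by congr L; apply/funext => x; rewrite mulr1 addr0.
Qed.

Let CZ a f : C f -> C (fun x => a * f x).
Proof.
by move=> cf x; apply: cvgM; [exact: cst_continuous|exact: cf].
Qed.

Let LZ a f : C f -> L (fun x => a * f x) = a * L f.
Proof.
move=> cf; rewrite -[RHS]addr0 -L0 -LZD//; congr L; apply/funext => x.
by rewrite addr0.
Qed.

Let Csum n (f : nat -> 'rV[R]_N -> R) : (forall i, C (f i)) ->
  C (fun x => \sum_(i < n) f i x) /\ L (fun x => \sum_(i < n) f i x) = \sum_(i < n) L (f i).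
Proof.
move=> cf; elim: n => [|n [ihC ihL]].
  have -> : (fun x => \sum_(i < 0) f i x) = (fun=> 0).
    by apply/funext => x; rewrite big_ord0.
  by rewrite big_ord0 L0; split => //; exact: Cc.
have -> : (fun x => \sum_(i < n.+1) f i x) = (fun x => \sum_(i < n) f i x + f n x).
  by apply/funext => x; rewrite big_ord_recr.
split; first exact: within_continuousD ihC (cf n).
by rewrite LD// ihL big_ord_recr.
Qed.

(* [below V f]: [f] is one of the functions whose supremum of [L f] is the
   measure of the open set [V]. *)
Let below (V : set 'rV[R]_N) f :=
  C f /\ forall x, X x -> 0 <= f x <= 1 /\ (~ V x -> f x = 0).

Let lam (V : set 'rV[R]_N) := sup [set L f | f in below V].

Let below0 V : below V (fun=> 0).
Proof. by split; [exact: Cc|move=> x _; rewrite lexx ler01]. Qed.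

Let L_le_lam V f : below V f -> L f <= lam V.
Proof.
move=> Vf; apply: ub_le_sup; last by exists f.
exists 1 => _ [g [cg hg] <-]; rewrite -(Lc 1); apply: le_L => // x Xx.
by have [/andP[]] := hg x Xx.
Qed.

Let lam_le V c : (forall f, below V f -> L f <= c) -> lam V <= c.
Proof.
move=> h; apply: ge_sup; first by exists (L (fun=> 0)); exists (fun=> 0); [exact: below0|].
by move=> _ [f Vf <-]; exact: h.
Qed.

Let lam_adherent V e : 0 < e -> exists2 f, below V f & lam V - e < L f.
Proof.
move=> e0; have [|_ [f Vf <-] ?] := @sup_adherent _ [set L f | f in below V] e e0.
- split; first by exists (L (fun=> 0)); exists (fun=> 0); [exact: below0|].
  exists 1 => _ [g [cg hg] <-]; rewrite -(Lc 1); apply: le_L => // x Xx.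
  by have [/andP[]] := hg x Xx.
- by exists f.
Qed.

Let lam_ge0 V : 0 <= lam V.
Proof. by rewrite -L0; apply: L_le_lam; exact: below0. Qed.

Let le_lam V W : (forall x, X x -> V x -> W x) -> lam V <= lam W.
Proof.
move=> VW; apply: lam_le => f [cf hf]; apply: L_le_lam; split => // x Xx.
by have [? h] := hf x Xx; split => // nWx; apply: h => /VW-/(_ Xx).
Qed.

(** For [r > 0] this is 1 at distance at most [r / 2] from [x] and 0 at distance at least [r]. *)
Let bump (x : 'rV[R]_N) (r : R) (y : 'rV[R]_N) : R :=
  Num.min 1 (Num.max 0 (2 - 2 * r^-1 * `|y - x|)).

Let Cbump x r : C (bump x r).
Proof.
apply: (within_continuous_min (@Cc 1)); apply: (within_continuous_max (@Cc 0)).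
apply: (within_continuousB (@Cc 2)); apply: CZ.
apply: continuous_subspaceT => y.
apply: (@continuous_comp _ _ _ (fun z : 'rV[R]_N => z - x) Num.norm).
  by apply: continuousB; [exact: cvg_id|exact: cst_continuous].
exact: norm_continuous.
Qed.

Let below_max V f g : below V f -> below V g -> below V (fun x => Num.max (f x) (g x)).
Proof.
move=> [cf hf] [cg hg]; split; first exact: within_continuous_max.
move=> x Xx; have [/andP[f0 f1] fV] := hf x Xx.
have [/andP[g0 g1] gV] := hg x Xx.
by rewrite le_max f0 ge_max f1 g1; split => // nVx; rewrite fV// gV// maxxx.
Qed.

(** Take [f] nearly optimal for the union. The part of [X] where [f >= e / 2] is compact, so
    finitely many functions [g i] below [V i] have sum at least 1 there; then [f - e / 2] is at most
    their sum on [X]. No partition of unity is required. *)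
Let lam_sigma_subadditive (V : nat -> set 'rV[R]_N) : (forall k, open (V k)) ->
  ((lam (\bigcup_k V k))%:E <= \sum_(k <oo) (lam (V k))%:E)%E.
Proof.
move=> oV.
suff h e : 0 < e -> exists n, lam (\bigcup_k V k) - e <= \sum_(i < n) lam (V i).
  apply/lee_addgt0Pr => e e0; have [n] := h e e0.
  rewrite lerBlDr -lee_fin EFinD => /le_trans; apply; rewrite leeD2r//.
  apply: (@le_trans _ _ (\sum_(0 <= i < n) (lam (V i))%:E)%E).
    by rewrite big_mkord sumEFin.
  by apply: nneseries_lim_ge => k _ _; rewrite lee_fin.
move=> e0.
have e20 : 0 < e / 2 by rewrite divr_gt0.
have [f [cf hf] fV] := @lam_adherent (\bigcup_k V k) _ e20.
have [U oU UE] := within_continuous_lt (e / 2) cf.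
have cK : compact (X `&` ~` U).
  by apply: (subclosed_compact _ cX) => [|x []//]; apply: closedI => //; exact: open_closedC.
pose P (A : set 'rV[R]_N) := exists n (g : nat -> 'rV[R]_N -> R),
  (forall i, below (V i) (g i)) /\
  forall x, X x -> A x -> 1 <= \sum_(i < n) g i x.
have [] : P (X `&` ~` U).
  apply: (compact_induction cK).
  - by exists 0, (fun _ _ => 0); split => // i; exact: below0.
  - move=> A B AB [n [g [Vg hg]]]; exists n, g; split => // x Xx /AB.
    exact: hg.
  - move=> A B [n [g [Vg hg]]] [n' [g' [Vg' hg']]].
    (* The maximum, unlike the sum, stays at most 1 and so remains below [V i]. *)
    pose G i x := Num.max (g i x) (g' i x).
    have VG i : below (V i) (G i) by exact: below_max.
    have G0 i x : X x -> 0 <= G i x.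
      by move=> Xx; have [_ /(_ x Xx)[/andP[]]] := VG i.
    exists (maxn n n'), G; split => // x Xx [Ax|Bx].
      apply: le_trans (hg x Xx Ax) _.
      rewrite (big_ord_widen _ (fun i => g i x) (leq_maxl n n')) big_mkcond /=.
      by apply: ler_sum => i _; case: ifP => _; [rewrite le_max lexx|exact: G0].
    apply: le_trans (hg' x Xx Bx) _.
    rewrite (big_ord_widen _ (fun i => g' i x) (leq_maxr n n')) big_mkcond /=.
    by apply: ler_sum => i _; case: ifP => _; [rewrite le_max lexx orbT|exact: G0].
  - move=> x [Xx nUx].
    have fx : e / 2 <= f x by rewrite leNgt; apply/negP => /(UE x Xx).
    have [k _ Vkx] : (\bigcup_k V k) x.
      by apply: contrapT => /(hf x Xx).2 fx0; move: fx; rewrite fx0 leNgt e20.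
    have /nbhs_ballP[r /= r0 rV] : nbhs x (V k) by exact: open_nbhs_nbhs.
    exists (ball x (r / 2)); first by apply: nbhsx_ballx; rewrite divr_gt0.
    exists k.+1, (fun i => if i == k then bump x r else (fun=> 0)); split.
      move=> i; case: eqP => [->|_]; last exact: below0.
      split; first exact: Cbump.
      move=> y Xy; rewrite /bump le_min ler01 le_max lexx ge_min lexx /=.
      split => // nVy; rewrite max_l ?min_r// subr_le0 -mulrA ler_peMr// ler_pdivlMl// mulr1.
      rewrite leNgt; apply/negP => yxr; apply: nVy; apply: rV.
      by rewrite -ball_normE/= distrC.
    move=> y Xy [xy _]; rewrite big_ord_recr /= eqxx big1 ?add0r; last first.
      by move=> i _; rewrite ltn_eqF.
    rewrite /bump le_min lexx /= le_max; apply/orP; right.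
    rewrite lerBrDl -lerBrDr -mulrA.
    have : r^-1 * `|y - x| <= 2^-1.
      rewrite ler_pdivrMl//; move: xy; rewrite -ball_normE/= distrC => /ltW.
      by [].
    lra.
move=> n [g [Vg hg]]; exists n.
have cg i : C (g i) by have [] := Vg i.
have [cS LS] := Csum n cg.
have h : L f - e / 2 <= \sum_(i < n) L (g i).
  rewrite -LS -(Lc (e / 2)) -LB//; apply: le_L => //.
    exact: within_continuousB cf (@Cc _).
  move=> x Xx; have [fx|fx] := ltP (f x) (e / 2).
    apply: (@le_trans _ _ 0); first by rewrite subr_le0 ltW.
    by apply: sumr_ge0 => i _; have [_ /(_ x Xx)[/andP[]]] := Vg i.
  apply: (@le_trans _ _ 1).
    have [/andP[_ f1] _] := hf x Xx.
    by rewrite lerBlDr (le_trans f1)// lerDl ltW.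
  by apply: hg => //; split => // /(UE x Xx); rewrite ltNge fx.
have : \sum_(i < n) L (g i) <= \sum_(i < n) lam (V i).
  by apply: ler_sum => i _; exact: L_le_lam.
move: h fV; lra.
Qed.

(** Lowering a nearly optimal [f] for the intersection by [e] frees the open set where [f < e],
    which contains the part of [W] outside [V]. On [X] a function below [W'] vanishes wherever
    [f >= e], so it can be added to [max 0 (f - e)] while staying below [W]. The three losses of [e]
    come from the choices of [f] and [g] and from the truncation. *)
Let lam_split V W e : open V -> open W -> 0 < e -> exists W',
  [/\ open W', W `&` ~` V `<=` W' & lam (W `&` V) + lam W' <= lam W + 3 * e].
Proof.
move=> oV oW e0; have [f [cf hf] Lf] := @lam_adherent (W `&` V) _ e0.
have [U oU UE] := within_continuous_lt e cf.
(* The complement of [X] is added because [f] is controlled on [X] only. *)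
pose W' := W `&` (U `|` ~` X).
exists W'; split.
- by apply: openI => //; apply: openU => //; exact: closed_openC.
- move=> x [Wx nVx]; split => //; have [Xx|] := pselect (X x); last by right.
  by left; apply/(UE x Xx); rewrite (hf x Xx).2// => -[].
have [g [cg hg] Lg] := @lam_adherent W' _ e0.
pose h x := Num.max 0 (f x - e) + g x.
have cfe : C (fun x => f x - e) by exact: within_continuousB cf (@Cc _).
have cfm : C (fun x => Num.max 0 (f x - e)) by exact: within_continuous_max (@Cc _) cfe.
have : L h <= lam W.
  apply: L_le_lam; split; first exact: within_continuousD cfm cg.
  move=> x Xx; have [/andP[f0 f1] fV] := hf x Xx.
  have [/andP[g0 g1] gV] := hg x Xx; split; last first.
    move=> nWx; rewrite /h fV; last by case.
    by rewrite gV ?addr0 ?max_l//; [lra|case].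
  rewrite /h addr_ge0//=; last by rewrite le_max lexx.
  have [fx|fx] := ltP (f x) e; first by rewrite max_l ?add0r// subr_le0 ltW.
  rewrite gV ?addr0; first by rewrite ge_max ler01/= lerBlDr (le_trans f1)// lerDl ltW.
  by move=> [_ [/(UE x Xx)|]//]; rewrite ltNge fx.
have : L (fun x => f x - e) <= L (fun x => Num.max 0 (f x - e)).
  by apply: le_L => // x _; rewrite le_max lexx orbT.
rewrite LB// Lc LD//; lra.
Qed.

Definition riesz_measure (A : set (borel_rV R N)) : \bar R :=
  ereal_inf [set (lam V)%:E | V in [set V : set 'rV[R]_N | open V /\ A `<=` V]].
Local Notation mu := riesz_measure.

Let mu_le V A : open V -> A `<=` V -> (mu A <= (lam V)%:E)%E.
Proof. by move=> oV AV; apply: ereal_inf_lbound; exists V. Qed.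

Let le_mu A c : (forall V, open V -> A `<=` V -> (c <= (lam V)%:E)%E) -> (c <= mu A)%E.
Proof. by move=> h; apply: le_ereal_inf_tmp => _ [V [oV AV] <-]; exact: h. Qed.

Let mu_open V : open V -> mu V = (lam V)%:E.
Proof.
move=> oV; apply/eqP; rewrite eq_le mu_le//=; apply: le_mu => W _ VW.
by rewrite lee_fin le_lam// => x _ /VW.
Qed.

Let mu_ge0 A : (0 <= mu A)%E.
Proof. by apply: le_mu => V _ _; rewrite lee_fin. Qed.

Let mu_fin A : mu A \is a fin_num.
Proof. by rewrite ge0_fin_numE// (le_lt_trans (@mu_le setT _ _ _)) ?ltry//; exact: openT. Qed.

Let mu0 : mu set0 = 0%E.
Proof.
rewrite mu_open; last exact: open0.
congr EFin; apply/eqP; rewrite eq_le lam_ge0 andbT; apply: lam_le => f [cf hf].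
by rewrite -L0; apply: le_L => // x Xx; rewrite (hf x Xx).2.
Qed.

Let mu_mono : {homo mu : A B / A `<=` B >-> (A <= B)%E}.
Proof. by move=> A B AB; apply: le_mu => V oV BV; apply: mu_le => // x /AB/BV. Qed.

Let mu_adherent A e : 0 < e ->
  exists V, [/\ open V, A `<=` V & ((lam V)%:E <= mu A + e%:E)%E].
Proof.
move=> e0; have [_ [V [oV AV] <-] h] := lb_ereal_inf_adherent e0 (mu_fin A).
by exists V; split => //; exact: ltW.
Qed.

Let mu_sigma_subadditive : sigma_subadditive mu.
Proof.
move=> F; apply/lee_addgt0Pr => e e0.
have h k : exists V, [/\ open V, F k `<=` V &
    ((lam V)%:E <= mu (F k) + (e / (2 ^ k.+1)%:R)%:E)%E].
  by apply: mu_adherent; rewrite divr_gt0// ltr0n expn_gt0.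
have [V hV] := choice h.
apply: (@le_trans _ _ (lam (\bigcup_k V k))%:E).
  apply: mu_le; first by apply: bigcup_open => k _; have [] := hV k.
  by move=> x [k _ Fx]; exists k => //; have [_ + _] := hV k; apply.
apply: le_trans; first by apply: lam_sigma_subadditive => k; have [] := hV k.
apply: le_trans (epsilon_trick xpredT _ (ltW e0)) => //.
apply: lee_nneseries => k _; first by rewrite lee_fin.
by have [] := hV k.
Qed.

HB.instance Definition _ := isOuterMeasure.Build R _ mu
  mu0 mu_ge0 mu_mono mu_sigma_subadditive.

Let mu_open_caratheodory V : open V -> caratheodory_measurable mu V.
Proof.
move=> oV; apply: le_caratheodory_measurable => A.
(* One quarter is spent on the choice of [W], the other three in [lam_split]. *)
apply/lee_addgt0Pr => e e0; have e40 : 0 < e / 4 by rewrite divr_gt0.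
have [W [oW AW lW]] := mu_adherent A e40.
have [W' [oW' VW' lW']] := lam_split oV oW e40.
apply: (@le_trans _ _ ((lam (W `&` V))%:E + (lam W')%:E)%E).
  apply: leeD; apply: mu_le => //; first exact: openI.
    by move=> x [/AW Wx Vx].
  by move=> x [/AW Wx nVx]; apply: VW'.
rewrite -EFinD (@le_trans _ _ (lam W + 3 * (e / 4))%:E) ?lee_fin//.
rewrite EFinD (le_trans (leeD2r _ lW))// -addeA -EFinD leeD2l// lee_fin; lra.
Qed.

Let measurable_caratheodory (A : set (borel_rV R N)) :
  measurable A -> caratheodory_measurable mu A.
Proof.
move=> mA.
have : <<s [set B | caratheodory_measurable mu B] >> A.
  by apply: (sub_sigma_algebra2 _ mA) => V oV; exact: mu_open_caratheodory.
rewrite sigma_algebra_id//.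
by have := sigma_algebra_measurable (caratheodory_type mu).
Qed.

Let mu_semi_sigma_additive : semi_sigma_additive mu.
Proof.
move=> F mF tF mUF.
apply: (@caratheodory_measure_sigma_additive _ _ mu F) => //.
  by move=> k; exact: measurable_caratheodory.
exact: measurable_caratheodory.
Qed.

HB.instance Definition _ := isMeasure.Build _ _ _ mu
  mu0 mu_ge0 mu_semi_sigma_additive.

Let mX : measurable (X : set (borel_rV R N)).
Proof. exact: measurable_closed_rV. Qed.

Lemma riesz_measure_setC : mu (~` X) = 0%E.
Proof.
rewrite mu_open; last exact: closed_openC.
congr EFin; apply/eqP; rewrite eq_le lam_ge0 andbT; apply: lam_le => f [cf hf].
by rewrite -L0; apply: le_L => // x Xx; rewrite (hf x Xx).2// => /(_ Xx).
Qed.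

Let lam_cover V : open V -> X `<=` V -> lam V = 1.
Proof.
move=> oV XV; apply/eqP; rewrite eq_le; apply/andP; split.
  apply: lam_le => f [cf hf]; rewrite -L1; apply: le_L => // x Xx.
  by have [/andP[]] := hf x Xx.
rewrite -L1; apply: L_le_lam; split => // x Xx; rewrite ler01 lexx.
by split => // /(_ (XV _ Xx)).
Qed.

Lemma riesz_measureX : mu X = 1%E.
Proof.
apply/eqP; rewrite eq_le; apply/andP; split.
  by rewrite -(@lam_cover setT)//; [apply: mu_le => //|]; exact: openT.
by apply: le_mu => V oV XV; rewrite lee_fin lam_cover.
Qed.

Lemma riesz_measure_outer (A : set (borel_rV R N)) :
  mu A = ereal_inf [set mu V | V in [set V : set 'rV[R]_N | open V /\ A `<=` V]].
Proof.
congr ereal_inf; apply/seteqP; split => _ [V [oV AV] <-]; exists V => //.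
  exact: mu_open.
exact/esym/mu_open.
Qed.

(** The total mass being finite, inner regularity of [A] is outer regularity of its complement: if
    an open [V] nearly optimally covers the complement, the part of [X] outside [V] is compact and
    fills [A] up to [e]. *)
Lemma riesz_measure_inner (A : set (borel_rV R N)) : measurable A ->
  mu A = ereal_sup [set mu K | K in [set K : set 'rV[R]_N | compact K /\ K `<=` A]].
Proof.
move=> mA; apply/eqP; rewrite eq_le; apply/andP; split; last first.
  by apply: ge_ereal_sup => _ [K [_ KA] <-]; exact: mu_mono.
apply/lee_addgt0Pr => e e0.
have [V [oV AV lV]] := mu_adherent (~` A) e0.
have mV := measurable_open_rV oV.
pose K := X `&` ~` V.
have cK : compact K.
  by apply: (subclosed_compact _ cX) => [|x []//]; apply: closedI => //; exact: open_closedC.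
have KA : K `<=` A.
  by move=> x [_ nVx]; apply: contrapT => /AV.
have muK : (mu K <= ereal_sup [set mu K | K in [set K : set 'rV[R]_N | compact K /\ K `<=` A]])%E.
  by apply: ereal_sup_ubound; exists K.
apply: le_trans (leeD2r _ muK).
have h1 : (mu setT = mu A + mu (~` A))%E.
  by have := measurable_caratheodory mA setT; rewrite !setTI.
have h2 : (mu X <= mu K + mu V)%E.
  apply: (le_trans _ (outer_measureU2 mu K V)); apply: mu_mono => x Xx.
  by have [Vx|nVx] := pselect (V x); [right|left].
have muT : mu setT = 1%E.
  by rewrite mu_open ?lam_cover//; exact: openT.
move: h1 h2 lV; rewrite muT riesz_measureX (mu_open oV).
rewrite -(fineK (mu_fin A)) -(fineK (mu_fin (~` A))) -(fineK (mu_fin K)).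
by rewrite -!EFinD !lee_fin => -[->]; lra.
Qed.

Let count_lt (n : nat) (y : R) : 0 <= y ->
  \sum_(i < n) (i%:R < y)%R%:R <= y + 1.
Proof.
move=> y0; elim: n => [|n ih]; first by rewrite big_ord0 addr_ge0.
rewrite big_ord_recr/=; case: ltP => [ny|_]; last by rewrite addr0.
apply: (@le_trans _ _ (n%:R + 1)); last by rewrite lerD2r ltW.
rewrite lerD2r -[leRHS]mulr1 -[n in leRHS]card_ord mulr_natl -sumr_const.
by apply: ler_sum => i _; case: (_ < _).
Qed.

(** Cut [f] into [n.+1] horizontal slices. The rescaled slice [g i] is below the open set [V i]
    where [f > c i], so [L (g i)] is at most the measure of [V i], while the mean of the indicators
    of the [V i] exceeds [f] by at most [1 / n.+1], by [count_lt]. *)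
Let L_le_integral01 f : C f -> (forall x, X x -> 0 <= f x <= 1) ->
  L f <= \int[mu]_(x in X) f x.
Proof.
move=> cf f01; have muX1 := riesz_measureX.
have muXoo : (mu X < +oo)%E by rewrite muX1 ltry.
apply/ler_addgt0Pr => e e0.
have [n ne] : exists n : nat, n.+1%:R^-1 < e.
  by have [n _ /(_ n (leqnn n))] := near_infty_natSinv_lt (PosNum e0); exists n.
have n0 : 0 < n.+1%:R :> R by [].
pose c (i : nat) : R := i%:R / n.+1%:R.
pose g (i : nat) x := n.+1%:R * (Num.min (f x) (c i.+1) - Num.min (f x) (c i)).
have cg i : C (g i).
  apply: CZ; apply: within_continuousB; exact: within_continuous_min cf (@Cc _).
have /choice[V hV] : forall i : nat, exists V, open V /\ forall x, X x -> V x <-> c i < f x.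
  by move=> i; have [V oV VE] := within_continuous_gt (c i) cf; exists V.
have cS i : c i <= c i.+1 by rewrite ler_pM2r ?invr_gt0// ler_nat.
have Vg i : below (V i) (g i).
  split=> // x Xx; split; last first.
    move=> /(contra_not ((hV i).2 x Xx).2)/negP; rewrite -leNgt => fc.
    by rewrite /g !min_l ?subrr ?mulr0//; exact: le_trans fc (cS i).
  rewrite /g; apply/andP; split.
    by rewrite mulr_ge0// subr_ge0 le_min ge_min lexx/= ge_min cS orbT.
  rewrite -ler_pdivlMl// mulr1 lerBlDr ge_min; apply/orP.
  have [fc|fc] := leP (f x) (c i); [left|right].
    by rewrite lerDr invr_ge0 ltW.
  by rewrite /c -natr1 mulrDl mul1r addrC.
have [cSg LSg] := Csum n.+1 cg.
have fE : L f = n.+1%:R^-1 * \sum_(i < n.+1) L (g i).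
  rewrite -LSg -LZ//; apply/eqP; rewrite eq_le; apply/andP.
  suff fgE x : X x -> f x = n.+1%:R^-1 * \sum_(i < n.+1) g i x.
    by split; apply: le_L => //; [exact: CZ|move=> x /fgE ->|exact: CZ|move=> x /fgE ->].
  move=> Xx; rewrite -mulr_sumr mulrA mulVf ?gt_eqF// mul1r.
  rewrite -(big_mkord xpredT (fun i => Num.min (f x) (c i.+1) - Num.min (f x) (c i))).
  rewrite telescope_sumr//.
  have /andP[fx0 fx1] := f01 x Xx.
  have -> : c 0 = 0 by rewrite /c mul0r.
  have -> : c n.+1 = 1 by rewrite /c divff// gt_eqF.
  by rewrite min_l// min_r// subr0.
rewrite fE.
have h1 : \sum_(i < n.+1) L (g i) <= \sum_(i < n.+1) fine (mu (V i)).
  apply: ler_sum => i _; rewrite mu_open; last exact: (hV i).1.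
  exact: L_le_lam.
apply: (@le_trans _ _ (n.+1%:R^-1 * \sum_(i < n.+1) fine (mu (V i)))).
  by rewrite ler_pM2l ?invr_gt0.
have mV i : measurable (V i : set (borel_rV R N)) by apply: measurable_open_rV; have [] := hV i.
pose h x : R := \sum_(i < n.+1) \1_(V i) x.
have [inth hE] : mu.-integrable X (EFin \o h) /\
    \sum_(i < n.+1) fine (mu (V i)) = \int[mu]_(x in X) h x.
  rewrite /h; elim: n.+1 => [|k [ihi ihE]].
    under [fun x => _]eq_fun do rewrite big_ord0.
    rewrite big_ord0 Rintegral_cst// mul0r; split => //.
    exact: integrable_within (@Cc _).
  have intV : mu.-integrable X (EFin \o \1_(V k)).
    apply: measurable_bounded_integrable => //.
    exists 1; split => // M M1 x _ /=; rewrite indicE ger0_norm// (le_trans _ (ltW M1))//.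
    by case: (_ \in _).
  have -> : (fun x => \sum_(i < k.+1) \1_(V i) x : R) =
      (fun x => \sum_(i < k) \1_(V i) x + \1_(V k) x).
    by apply/funext => x; rewrite big_ord_recr.
  split; first exact: (integrableD _ ihi intV).
  rewrite big_ord_recr /= ihE RintegralD//; congr (_ + _).
  rewrite /Rintegral integral_indic//; congr fine.
  apply/eqP; rewrite eq_le; apply/andP; split; last by apply: mu_mono => x [].
  apply: (@le_trans _ _ (mu ((V k `&` X) `|` ~` X))).
    by apply: mu_mono => x Vx; have [Xx|nXx] := pselect (X x); [left|right].
  apply: le_trans (outer_measureU2 mu (V k `&` X) (~` X)) _.
  by rewrite /= riesz_measure_setC adde0.
rewrite hE -RintegralZl//.
have intf : mu.-integrable X (EFin \o f) by exact: integrable_within.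
have intc : mu.-integrable X (EFin \o (fun=> e)) by apply: integrable_within => //; exact: Cc.
have -> : \int[mu]_(x in X) f x + e = \int[mu]_(x in X) (f x + e).
  by rewrite RintegralD// Rintegral_cst//= muX1 mulr1.
apply: le_Rintegral => //.
  exact: (integrableZl _ _ inth).
  exact: (integrableD _ intf intc).
move=> x Xx; rewrite ler_pdivrMl//.
have /andP[fx0 fx1] := f01 x Xx.
have -> : h x = \sum_(i < n.+1) (i%:R < n.+1%:R * f x)%R%:R.
  apply: eq_bigr => i _; rewrite indicE; congr (_%:R : R).
  congr nat_of_bool; rewrite -ltr_pdivrMl//.
  by apply/idP/idP; rewrite inE mulrC => /(hV i).2; apply.
apply: le_trans (count_lt _ (mulr_ge0 (ltW n0) fx0)) _.
by rewrite mulrDr lerD2l -ler_pdivrMl// mulr1 ltW.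
Qed.

(** The inequality for values in [0, 1] extends to all [f] by an affine change of [f], both sides
    being linear and normalized; equality follows by applying it to [f] and to its opposite. *)
Lemma integral_riesz_measure f : C f -> \int[mu]_(x in X) f x = L f.
Proof.
have muX1 := riesz_measureX.
have muXoo : (mu X < +oo)%E by rewrite muX1 ltry.
suff le f' : C f' -> L f' <= \int[mu]_(x in X) f' x.
  move=> cf; apply/eqP; rewrite eq_le le// andbT.
  have := le (fun x => -1 * f x) (@CZ (-1) f cf).
  rewrite LZ// RintegralZl ?lerNl ?mulN1r ?opprK//; last exact: integrable_within.
  by rewrite lerN2.
move: f' => {}f cf; have [M M0 fM] := within_compact_bounded cX cf.
have M20 : 0 < 2 * M by rewrite mulr_gt0.
pose g x := (2 * M)^-1 * (f x + M).
have cfM : C (fun x => f x + M) by exact: within_continuousD cf (@Cc _).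
have cg : C g by exact: CZ.
have : L g <= \int[mu]_(x in X) g x.
  apply: L_le_integral01 => // x /fM; rewrite ler_norml => /andP[? ?].
  rewrite /g mulr_ge0//=; [|by rewrite invr_ge0 ltW|lra].
  by rewrite ler_pdivrMl// mulr1; lra.
rewrite LZ// RintegralZl//; last exact: integrable_within.
rewrite ler_pM2l ?invr_gt0// LD// Lc RintegralD//; first last.
- exact: integrable_within (@Cc _).
- exact: integrable_within.
by rewrite Rintegral_cst//= muX1 mulr1 lerD2r.
Qed.

Lemma riesz_representation : exists nu : {measure set (borel_rV R N) -> \bar R},
  [/\ forall A : set (borel_rV R N), measurable A ->
       nu A = ereal_inf [set nu V | V in [set V : set 'rV[R]_N | open V /\ A `<=` V]] /\
       nu A = ereal_sup [set nu K | K in [set K : set 'rV[R]_N | compact K /\ K `<=` A]],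
      nu X = 1%E, nu (~` X) = 0%E &
      forall f, C f -> \int[nu]_(x in X) f x = L f].
Proof.
exists mu; split.
- move=> A mA; split; [exact: riesz_measure_outer|exact: riesz_measure_inner].
- exact: riesz_measureX.
- exact: riesz_measure_setC.
- exact: integral_riesz_measure.
Qed.

End riesz.

(** * Integrals of Jacobian determinants *)

Section cup_product.
Context (R : realFieldType) (V : zmodType) (n : nat).
Context (e : 'I_n.+1 -> V) (g : 'I_n.+1 -> V -> R).
Implicit Types (s : 'S_n.+1) (k : 'I_n.+1) (z : V).

(** With [b] true, these are the vertices of the monotone path of the cube that takes the edges
    [e (s 0), e (s 1), ...] in turn; the permutations index the simplices of the standard
    triangulation of the cube. *)
Definition corner (b : bool) s k : V :=
  \sum_(j : 'I_n.+1 | (j < k)%N && (b || (j != ord0))) e (s j).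

Definition increment k (v z : V) : R := g k (z + v) - g k z.

(* The increments of the [g k], [k > 0], along a lattice path; the
   first step [e (s ord0)] of the path is skipped in the factors [k < l]. *)
Definition cup (l : nat) s z : R :=
  \prod_(k | k != ord0) increment k (e (s k)) (z + corner (l <= k)%N s k).

(** The two products differ in the factor of index [l] alone, and there by a second difference of
    [g l] along [e (s ord0)] and [e (s l)], which is symmetric. The transposition of [0] and [l]
    preserves the other factors, since the earlier ones see neither of the two steps in their corner
    and the later ones see both, but it reverses the sign: the sum of the differences is its own
    opposite. *)
Lemma cup_step l z : (l < n.+1)%N ->
  \sum_(s : 'S_n.+1) (-1) ^+ s * cup l.+1 s z = \sum_(s : 'S_n.+1) (-1) ^+ s * cup l s z.
Proof.
move=> ln; pose L : 'I_n.+1 := Ordinal ln.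
have [L0|L0] := eqVneq L ord0.
  apply: eq_bigr => s _; congr (_ * _); apply: eq_bigr => k k0.
  have -> : l = 0 by have := congr1 val L0.
  by rewrite leq0n lt0n k0.
apply/eqP; rewrite -subr_eq0 -sumrB; apply/eqP.
set F := fun s : 'S_n.+1 => (-1) ^+ s * cup l.+1 s z - (-1) ^+ s * cup l s z.
rewrite -[LHS]/(\sum_s F s).
pose t : 'S_n.+1 := tperm ord0 L.
have t0 : t ord0 = L by rewrite tpermL.
have tL : t L = ord0 by rewrite tpermR.
have tD k : k != ord0 -> k != L -> t k = k by move=> k0 kL; rewrite tpermD// eq_sym.
pose P s := \prod_(k | (k != ord0) && (k != L))
  increment k (e (s k)) (z + corner (l <= k)%N s k).
have cupE s : cup l s z = increment L (e (s L)) (z + corner true s L) * P s.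
  by rewrite /cup (bigD1 L)//= leqnn.
have cupSE s : cup l.+1 s z = increment L (e (s L)) (z + corner false s L) * P s.
  rewrite /cup (bigD1 L)//= ltnn; congr (_ * _); apply: eq_bigr => k /andP[_ kL].
  by rewrite [(l < k)%N]ltn_neqAle (_ : l != k) // eq_sym.
have cornerT s : corner true s L = e (s ord0) + corner false s L.
  rewrite /corner (bigD1 ord0)/=; last by rewrite andbT lt0n.
  by congr (_ + _); apply: eq_bigl => j; rewrite andbT.
have cornert s : corner false (t * s)%g L = corner false s L.
  apply: eq_bigr => j /andP[jL /= j0]; rewrite permM tD//.
  by apply: contraTneq jL => ->; rewrite ltnn.
have Pt s : P (t * s)%g = P s.
  apply: eq_bigr => k /andP[k0 kL]; rewrite permM tD//; congr (increment _ _ (_ + _)).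
  case: (leqP l k) => [lk|kl]; last first.
    apply: eq_bigr => j /andP[jk /= j0]; rewrite permM tD//.
    by apply: contraTneq jk => ->; rewrite -leqNgt ltnW.
  rewrite /corner [RHS](reindex_inj (@perm_inj _ t)) /=.
  apply: eq_big => [j|j _]; last by rewrite permM.
  rewrite !andbT; have [->|j0] := eqVneq j ord0.
    rewrite t0 lt0n k0; apply/esym.
    by rewrite ltn_neqAle lk andbT eq_sym.
  have [->|jL] := eqVneq j L; last by rewrite tD.
  rewrite tL lt0n k0 ltn_neqAle lk andbT eq_sym. 
  by [].
suff Ft s : F (t * s)%g = - F s.
  have : \sum_s F s = - \sum_s F s.
    rewrite [LHS](reindex_inj (mulgI t)) /= -sumrN.
    by apply: eq_bigr => s _; exact: Ft.
  lra.
rewrite /F !cupE !cupSE Pt !cornerT cornert !permM t0 tL.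
have -> : (-1) ^+ (t * s)%g = - (-1) ^+ s :> R.
  by rewrite odd_mul_tperm eq_sym L0 signrN.
rewrite /increment ![e _ + corner _ _ _]addrC !addrA.
rewrite [z + corner false s L + e (s L) + e (s ord0)]addrAC.
move: (g L _) (g L _) (g L _) (g L _) (P s) ((-1) ^+ s) => a b c d p q; ring.
Qed.

(** This is the finite difference form of the closedness of dg_1 /\ ... /\ dg_n. *)
Lemma cup_closed z :
  \sum_(s : 'S_n.+1) (-1) ^+ s * cup n.+1 s z = \sum_(s : 'S_n.+1) (-1) ^+ s * cup 0 s z.
Proof.
suff h l : (l <= n.+1)%N ->
    \sum_(s : 'S_n.+1) (-1) ^+ s * cup l s z = \sum_(s : 'S_n.+1) (-1) ^+ s * cup 0 s z by exact: h.
by elim: l => // l ih ln; rewrite cup_step// ih// ltnW.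
Qed.

End cup_product.

Lemma Rintegral_lincomb (R : realType) d (T : measurableType d)
    (mu : {measure set T -> \bar R}) (D : set T) (I : Type) (r : seq I) (P : pred I)
    (c : I -> R) (f : I -> T -> R) : measurable D ->
  (forall i, mu.-integrable D (EFin \o f i)) ->
  mu.-integrable D (EFin \o (fun x => \sum_(i <- r | P i) c i * f i x)) /\
  \int[mu]_(x in D) (\sum_(i <- r | P i) c i * f i x) =
    \sum_(i <- r | P i) c i * \int[mu]_(x in D) f i x.
Proof.
move=> mD intf; elim: r => [|i r [ihi ihE]].
  have -> : (fun x => \sum_(i <- [::] | P i) c i * f i x) = (fun=> 0).
    by apply/funext => x; rewrite big_nil.
  by split; [exact: integrable0|rewrite big_nil Rintegral_cst// mul0r].
have intcf : mu.-integrable D (EFin \o (fun x => c i * f i x)).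
  exact: (integrableZl mD (c i) (intf i)).
have [Pi|nPi] := boolP (P i); last first.
  have -> : (fun x => \sum_(i <- i :: r | P i) c i * f i x) =
     (fun x => \sum_(i <- r | P i) c i * f i x).
    by apply/funext => x; rewrite big_cons (negbTE nPi).
  by rewrite big_cons (negbTE nPi).
have -> : (fun x => \sum_(i <- i :: r | P i) c i * f i x) =
   (fun x => c i * f i x + \sum_(i <- r | P i) c i * f i x).
  by apply/funext => x; rewrite big_cons Pi.
split; first exact: (integrableD mD intcf ihi).
by rewrite RintegralD// big_cons Pi ihE RintegralZl.
Qed.

Section measure_preserving.
Context (R : realType) d (T : measurableType d) (mu : {measure set T -> \bar R}).
Context (phi : T -> T) (D : set T) (f : T -> R).
Hypothesis mphi : measurable_fun setT phi.
Hypothesis mu_phi : forall A, measurable A -> mu (phi @^-1` A) = mu A.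
Hypothesis mD : measurable D.
Hypothesis mf : measurable_fun setT f.
Hypothesis intf : mu.-integrable D (EFin \o f).

Let mphiD : measurable (phi @^-1` D).
Proof. by rewrite -[X in measurable X]setTI; exact: mphi. Qed.

Lemma integrable_preserving : mu.-integrable (phi @^-1` D) (EFin \o (f \o phi)).
Proof.
have mg : measurable_fun setT (EFin \o f) by exact/measurable_EFinP.
apply/integrableP; split.
  by apply: (@measurable_funTS _ _ _ _ (phi @^-1` D)); exact: (measurableT_comp mg mphi).
have /integrableP[_] := intf; apply: le_lt_trans; rewrite le_eqVlt; apply/orP; left; apply/eqP.
have mag : measurable_fun D (fun z => `|(f z)%:E|%E).
  by apply: measurable_funTS; exact: measurableT_comp.
transitivity (\int[pushforward mu phi]_(z in D) `|(f z)%:E|)%E.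
  by rewrite ge0_integral_pushforward.
by apply: eq_measure_integral => A mA _; exact: mu_phi.
Qed.

Lemma Rintegral_preserving :
  \int[mu]_(z in phi @^-1` D) f (phi z) = \int[mu]_(z in D) f z.
Proof.
have mg : measurable_fun setT (EFin \o f) by exact/measurable_EFinP.
rewrite /Rintegral; congr fine.
transitivity (\int[pushforward mu phi]_(z in D) (f z)%:E)%E.
  by rewrite (@integral_pushforward _ _ _ _ _ phi mphi mu D (EFin \o f) mg integrable_preserving).
by apply: eq_measure_integral => A mA _; exact: mu_phi.
Qed.

End measure_preserving.

Section integral_shift.
Context (R : realType) (N : nat).
Local Notation mu := (@lebesgue_rV R N).
Implicit Types f : borel_rV R N -> R.

Lemma measurable_shift (c : 'rV[R]_N) :
  measurable_fun setT (fun z : borel_rV R N => z + c : borel_rV R N).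
Proof.
apply: measurable_continuous_rV => z.
by apply: continuousD; [exact: cvg_id|exact: cst_continuous].
Qed.

Let mu_shift (c : 'rV[R]_N) (A : set (borel_rV R N)) : measurable A ->
  mu ((fun z => z + c) @^-1` A) = mu A.
Proof.
move=> mA; rewrite -[RHS](lebesgue_rV_shift c)//; congr (mu _).
by apply/seteqP; split => z /=; rewrite addrC.
Qed.

Lemma integrable_shift (c : 'rV[R]_N) f : mu.-integrable setT (EFin \o f) ->
  mu.-integrable setT (EFin \o (fun z => f (z + c))).
Proof.
move=> intf; have /integrableP[/measurable_EFinP mf _] := intf.
exact: (integrable_preserving (measurable_shift c) (mu_shift c) measurableT mf intf).
Qed.

Lemma Rintegral_shift (c : 'rV[R]_N) f : mu.-integrable setT (EFin \o f) ->
  \int[mu]_z f (z + c) = \int[mu]_z f z.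
Proof.
move=> intf; have /integrableP[/measurable_EFinP mf _] := intf.
exact: (Rintegral_preserving (measurable_shift c) (mu_shift c) measurableT mf intf).
Qed.

End integral_shift.

Section integral_cup.
Context (R : realType) (N n : nat).
Local Notation mu := (@lebesgue_rV R N).
Context (e : 'I_n.+1 -> 'rV[R]_N) (g : 'I_n.+1 -> borel_rV R N -> R) (M : R).
Hypothesis mg : forall k, measurable_fun setT (g k).
Hypothesis gM : forall k z, `|g k z| <= M.
Hypothesis intg : mu.-integrable setT (EFin \o g ord0).

Lemma measurable_increment k v c :
  measurable_fun setT (fun z : borel_rV R N => increment g k v (z + c)).
Proof.
apply: measurable_funB.
  have := measurableT_comp (mg k) (measurable_shift (c + v)).
  by apply: eq_measurable_fun => z _ /=; rewrite addrA.
exact: measurableT_comp (mg k) (measurable_shift c).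
Qed.

Let measurable_cup l s : measurable_fun setT (fun z : borel_rV R N => cup e g l s z).
Proof.
have -> : (fun z => cup e g l s z) = (fun z => \prod_(k <- [seq k <- index_enum 'I_n.+1 | k != ord0])
    increment g k (e (s k)) (z + corner e (l <= k)%N s k)).
  by apply/funext => z; rewrite big_filter.
by apply: measurable_prod => k _; exact: measurable_increment.
Qed.

Let cup_le l s z : `|cup e g l s z| <= (M + M) ^+ #|[pred k : 'I_n.+1 | k != ord0]|.
Proof.
rewrite normr_prod -prodr_const; apply: ler_prod => k _; rewrite normr_ge0/=.
by apply: le_trans (ler_normB _ _) _; apply: lerD.
Qed.

Let int_cup l s : mu.-integrable setT (EFin \o (fun z => g ord0 z * cup e g l s z)).
Proof.
set C := (M + M) ^+ #|[pred k : 'I_n.+1 | k != ord0]|.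
apply: (@le_integrable _ _ _ mu setT measurableT _ (fun z => (C * g ord0 z)%:E)).
- by apply/measurable_EFinP; apply: measurable_funM.
- move=> z _ /=; rewrite lee_fin !normrM mulrC ler_wpM2r//.
  apply: le_trans (cup_le _ _ _) _; exact: ler_norm.
- exact: (integrableZl measurableT C intg).
Qed.

(** A discrete Stokes formula: the integrand is the cup product of the coboundaries of the [g k],
    that is, the coboundary of [g ord0] times the cup product of the others. *)
Lemma integral_cup : \int[mu]_z (\sum_(s : 'S_n.+1) (-1) ^+ s *
  \prod_k increment g k (e (s k)) (z + corner e true s k)) = 0.
Proof.
(* Expand the increment of [g ord0]. Seen from [z + e (s ord0)], the remaining paths skip their
   first step, whence [cup] with [l = n.+1]. Translation invariance then brings both terms to the
   same point, where [cup_closed] applies. *)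
have E (s : 'S_n.+1) z : \prod_k increment g k (e (s k)) (z + corner e true s k) =
    g ord0 (z + e (s ord0)) * cup e g n.+1 s (z + e (s ord0)) -
    g ord0 z * cup e g 0 s z.
  rewrite (bigD1 ord0)//= -/(cup e g 0 s z).
  have -> : corner e true s ord0 = 0 by rewrite /corner big1// => j; rewrite ltn0.
  have -> : cup e g n.+1 s (z + e (s ord0)) = cup e g 0 s z.
    apply: eq_bigr => k k0; congr (increment _ _ _ _).
    rewrite leqNgt ltn_ord /= -addrA; congr (_ + _).
    rewrite /corner [RHS](bigD1 ord0)/=; last by rewrite andbT lt0n.
    by congr (_ + _); apply: eq_bigl => j; rewrite andbT.
  by rewrite /increment addr0 mulrBl.
have intA (s : 'S_n.+1) : mu.-integrable setT
    (EFin \o (fun z => g ord0 (z + e (s ord0)) * cup e g n.+1 s (z + e (s ord0)))).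
  exact: (integrable_shift (e (s ord0)) (int_cup n.+1 s)).
have intAB l (s : 'S_n.+1) : mu.-integrable setT (EFin \o (fun z => g ord0 z * cup e g l s z -
    g ord0 z * cup e g 0 s z)).
  exact: (integrableB measurableT (int_cup l s) (int_cup 0 s)).
under eq_Rintegral do under eq_bigr do rewrite E.
rewrite (Rintegral_lincomb _ _ _ measurableT _).2; last first.
  by move=> s; exact: (integrableB measurableT (intA s) (int_cup 0 s)).
transitivity (\int[mu]_z \sum_(s : 'S_n.+1) (-1) ^+ s * (g ord0 z * cup e g n.+1 s z -
    g ord0 z * cup e g 0 s z)).
  rewrite (Rintegral_lincomb _ _ _ measurableT (intAB n.+1)).2.
  apply: eq_bigr => s _; apply: (congr1 ( *%R _)).
  rewrite [LHS](RintegralB measurableT (intA s) (int_cup 0 s)).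
  rewrite [RHS](RintegralB measurableT (int_cup n.+1 s) (int_cup 0 s)).
  apply: (congr1 (fun x => x - _)).
  exact: (Rintegral_shift (e (s ord0)) (int_cup n.+1 s)).
rewrite (_ : (fun z => _) = cst 0) ?Rintegral_cst ?mul0r//; apply/funext => z /=.
under eq_bigr do rewrite -mulrBr mulrCA.
rewrite -mulr_sumr; under eq_bigr do rewrite mulrBr.
by rewrite sumrB cup_closed subrr mulr0.
Qed.

End integral_cup.

Section directional.
Context (R : realType) (V : normedModType R).
Implicit Types (f : V -> R) (y v : V).

Lemma is_derive_line f y v (t : R) : derivable f (y + t *: v) v ->
  is_derive t 1 (fun s : R => f (y + s *: v)) ('D_v f (y + t *: v)).
Proof.
move=> df.
have E : (fun h : R => h^-1 *: (((fun s : R => f (y + s *: v)) \o shift t) (h *: (1 : R)) -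
     f (y + t *: v))) =
    (fun h : R => h^-1 *: ((f \o shift (y + t *: v)) (h *: v) - f (y + t *: v))).
  apply/funext => h /=; congr (_ *: (f _ - _)).
  by rewrite scalerDl addrCA [h *: 1]mulr1.
by apply: DeriveDef; rewrite /derivable /derive E.
Qed.

Lemma MVT_line f y v (h : R) : 0 <= h ->
  (forall t, 0 <= t <= h -> derivable f (y + t *: v) v) ->
  exists2 t, 0 <= t <= h & f (y + h *: v) - f y = h * 'D_v f (y + t *: v).
Proof.
move=> h0 df.
pose F (s : R) : R := f (y + s *: v); pose dF (s : R) : R := 'D_v f (y + s *: v).
have der t : t \in `[0, h] -> is_derive t 1 F (dF t).
  by rewrite in_itv /= => /df; exact: is_derive_line.
have der' t : t \in `]0, h[ -> is_derive t 1 F (dF t).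
  by rewrite in_itv/= => /andP[t0 th]; apply: der; rewrite in_itv/= !ltW.
have cF : {within `[0, h], continuous F}.
  apply: derivable_within_continuous => t th.
  by have := der t th; case.
have [t] := MVT_segment h0 der' cF.
rewrite in_itv/= subr0 => th E; exists t => //.
by rewrite mulrC -E /F scale0r addr0.
Qed.

End directional.

Lemma cvg_prod_ord (R : realType) T (F : set_system T) {FF : Filter F} (n : nat)
    (f : 'I_n -> T -> R) (a : 'I_n -> R) :
  (forall i, f i x @[x --> F] --> a i) ->
  \prod_i f i x @[x --> F] --> \prod_i a i.
Proof.
move=> fa; apply: cvg_big => //; exact: (@mul_continuous R).
Qed.

Lemma near_norm_le (R : realType) (T : topologicalType) (f : T -> R) x :
  {for x, continuous f} -> \forall y \near x, `|f y| <= `|f x| + 1.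
Proof.
move=> /cvgrPdist_lt/(_ 1 ltr01); apply: filterS => y xy.
by rewrite -lerBlDl (le_trans _ (ltW xy))// distrC lerB_dist.
Qed.

Lemma cvg_bigsum (R : realType) T (F : set_system T) {FF : Filter F} (I : finType)
    (f : I -> T -> R) (a : I -> R) :
  (forall i, f i x @[x --> F] --> a i) ->
  \sum_i f i x @[x --> F] --> \sum_i a i.
Proof.
move=> fa; apply: cvg_big => //; exact: (@add_continuous R).
Qed.

Lemma integrable_indicZ (R : realType) d (T : measurableType d)
    (mu : {measure set T -> \bar R}) (A : set T) (c : R) : measurable A ->
  (mu A < +oo)%E -> mu.-integrable setT (EFin \o (fun x => c * \1_A x)).
Proof.
move=> mA muA.
suff i1 : mu.-integrable setT (EFin \o \1_A) by exact: (integrableZl measurableT c i1).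
apply/integrableP; split; first exact/measurable_EFinP.
under eq_integral => x _ do rewrite /= ger0_norm//.
by rewrite integral_indic// setIT.
Qed.

(** * Jacobian determinants as limits of finite differences *)

Section jacobian.
Context (R : realType) (N n : nat).
Local Notation mu := (@lebesgue_rV R N).
Context (e : 'I_n.+1 -> 'rV[R]_N) (g : 'I_n.+1 -> 'rV[R]_N -> R).
Context (V K : set 'rV[R]_N).
Hypothesis oV : open V.
Hypothesis cK : compact K.
Hypothesis KV : K `<=` V.
Hypothesis g0K : forall z, ~ K z -> g ord0 z = 0.
Hypothesis e1 : forall j, `|e j| <= 1.
Hypothesis cg : forall k z, V z -> {for z, continuous (g k)}.
Hypothesis dg : forall k j z, V z -> derivable (g k) z (e j).
Hypothesis cdg : forall k j z, V z -> {for z, continuous (fun y => 'D_(e j) (g k) y : R)}.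

Definition jacobian (z : 'rV[R]_N) : R :=
  \sum_(s : 'S_n.+1) (-1) ^+ s * \prod_k 'D_(e (s k)) (g k) z.

(** The radius, uniform along [K], leaves room for the lattice paths that start near [K]; the bound
    provides the dominating function. *)
Let jacobian_bounds : exists delta M : R, [/\ 0 < delta, 0 <= M &
  forall x, K x -> forall y, `|y - x| < delta ->
    V y /\ forall k j, `|g k y| <= M /\ `|'D_(e j) (g k) y| <= M].
Proof.
pose P (A : set 'rV[R]_N) := exists delta M : R, [/\ 0 < delta, 0 <= M &
  forall x, A x -> forall y, `|y - x| < delta ->
    V y /\ forall k j, `|g k y| <= M /\ `|'D_(e j) (g k) y| <= M].
apply: (@compact_induction _ K P cK).
- by exists 1, 0; split.
- move=> A B AB [d [M [d0 M0 h]]]; exists d, M; split => // x /AB; exact: h.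
- move=> A B [d [M [d0 M0 h]]] [d' [M' [d'0 M'0 h']]].
  exists (Num.min d d'), (Num.max M M'); split.
  + by rewrite lt_min d0.
  + by rewrite le_max M0.
  + move=> x ABx y; rewrite lt_min => /andP[yd yd'].
    case: ABx => [Ax|Bx].
      have [Vy hy] := h x Ax y yd; split => // k j; have [? ?] := hy k j.
      by rewrite !le_max; split; apply/orP; left.
    have [Vy hy] := h' x Bx y yd'; split => // k j; have [? ?] := hy k j.
    by rewrite !le_max; split; apply/orP; right.
- move=> x Kx; have Vx := KV Kx.
  pose M : R := \sum_k \sum_j (`|g k x| + `|'D_(e j) (g k) x| + 1).
  have Mkj k j : `|g k x| + `|'D_(e j) (g k) x| + 1 <= M.
    rewrite /M (bigD1 k)//= (bigD1 j)//= -[leRHS]addrA lerDl addr_ge0//.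
      by apply: sumr_ge0 => ? _; rewrite !addr_ge0.
    by apply: sumr_ge0 => ? _; apply: sumr_ge0 => ? _; rewrite !addr_ge0.
  have M0 : 0 <= M by apply: sumr_ge0 => ? _; apply: sumr_ge0 => ? _; rewrite !addr_ge0.
  have nb : \forall y \near x, V y /\ forall k j, `|g k y| <= M /\ `|'D_(e j) (g k) y| <= M.
    have h1 : \forall y \near x, V y by exact: open_nbhs_nbhs.
    have h2 : \forall y \near x, forall k j, `|g k y| <= M /\ `|'D_(e j) (g k) y| <= M.
      pose Q k j y := `|g k y| <= M /\ `|'D_(e j) (g k) y| <= M.
      have hkj k j : \forall y \near x, Q k j y.
        have := near_norm_le (@cg k x Vx); have := near_norm_le (@cdg k j x Vx).
        apply: filterS2 => y h3 h4; have := Mkj k j.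
        have := normr_ge0 (g k x); have := normr_ge0 ('D_(e j) (g k) x).
        by move: h3 h4; split; lra.
      have hk k : \forall y \near x, forall j, Q k j y by exact: (filter_forall _ (hkj k)).
      exact: (filter_forall _ hk).
    by apply: filterS2 h1 h2.
  have /nbhs_ballP[r /= r0 hr] := nb.
  exists (ball x (r / 2)); first by apply: nbhsx_ballx; rewrite divr_gt0.
  exists (r / 2), M; split => //; first by rewrite divr_gt0.
  move=> x' [xx' _] y yx'; apply: hr.
  move: xx'; rewrite -!ball_normE/= => xx'.
  rewrite [r]splitr (le_lt_trans (ler_distD x' _ _))// ltrD// distrC//.
Qed.

Lemma jacobian_out z : ~ K z -> jacobian z = 0.
Proof.
move=> nKz; rewrite /jacobian big1// => s _.
rewrite (bigD1 ord0)//=; suff -> : 'D_(e (s ord0)) (g ord0) z = 0 by rewrite mul0r mulr0.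
have oK : open (~` K) by apply: closed_openC; exact: compact_closed cK.
have nz : nbhs z (~` K) by exact: open_nbhs_nbhs.
rewrite (near_eq_derive (g := cst 0)).
  by rewrite derive_cst.
by near=> y; apply: g0K; near: y.
Unshelve. all: by end_near. Qed.

Lemma integral_jacobian :
  mu.-integrable setT (EFin \o jacobian) /\ \int[mu]_z jacobian z = 0.
Proof.
have [d [M [d0 M0 hd]]] := jacobian_bounds.
pose W : set 'rV[R]_N := \bigcup_(x in K) ball x d.
have oW : open W by apply: bigcup_open => x _; exact: ball_open.
have WP y : W y <-> exists2 x, K x & `|y - x| < d.
  by split => -[x Kx] h; exists x => //; move: h; rewrite -ball_normE/= distrC.
have WV y : W y -> V y by move=> /WP[x Kx /(hd x Kx)[]].
have KW x : K x -> W x by move=> Kx; apply/WP; exists x => //; rewrite subrr normr0.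
have mW : measurable (W : set (borel_rV R N)) by exact: measurable_open_rV.
(* Truncation to [W] makes the functions bounded and measurable on the whole space, as
   [integral_cup] demands. It leaves [g ord0] unchanged, and it is invisible on the paths
   considered, which stay in [W]. *)
pose gt k : borel_rV R N -> R := (g k) \_ W.
have gtW k y : W y -> gt k y = g k y by move=> Wy; rewrite /gt patchE mem_set.
have gt0 y : ~ K y -> gt ord0 y = 0.
  by move=> nKy; rewrite /gt patchE g0K//; case: ifP.
have mgt k : measurable_fun setT (gt k).
  apply/(measurable_restrictT _ mW); apply: measurable_fun_within => //.
  apply/continuous_in_subspaceT => y; rewrite inE => Wy.
  exact/cg/WV.
have gtM k y : `|gt k y| <= M.
  rewrite /gt patchE; case: ifPn => [|_]; last by rewrite normr0.
  rewrite inE => /WP[x Kx /(hd x Kx)[_ /(_ k ord0)[]]]; by [].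
have mK : measurable (K : set (borel_rV R N)).
  by apply: measurable_closed_rV; exact: compact_closed cK.
have [B B0 hB] : exists2 B : R, 0 < B & forall x, K x -> `|x| <= B.
  have /ex_strict_bound_gt0[B B0 /= hB] := compact_bounded cK.
  by exists B => // x /hB/ltW.
have muW : (mu W < +oo)%E.
  apply: (@lebesgue_rV_bounded _ _ _ (B + d)) => // y /WP[x Kx yx].
  rewrite -[y](subrK x) (le_trans (ler_normD _ _))// addrC lerD//; first exact: hB.
  exact: ltW.
have int1 c : mu.-integrable setT (EFin \o (fun z => c * \1_W z)).
  exact: integrable_indicZ.
have intg : mu.-integrable setT (EFin \o gt ord0).
  apply: (@le_integrable _ _ _ mu setT measurableT _ (fun z => (M * \1_W z)%:E)).
  - exact/measurable_EFinP.
  - move=> z _; rewrite /= lee_fin normrM (ger0_norm M0) indicE.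
    have [Wz|nWz] := boolP (z \in W).
      by rewrite normr1 mulr1.
    by rewrite /gt patchE (negbTE nWz) normr0 mulr0.
  - exact: int1.
(* A corner costs at most [n.+1] steps, the point of the mean value theorem one more, and passing
   from [z] to [z + h i *: e (s ord0)] another one: all stay within [n.+3] steps, and
   [n.+3%:R * h i < d]. *)
pose h (i : nat) : R := d / (n.+4%:R * i.+1%:R).
have h0 i : 0 < h i by rewrite divr_gt0// mulr_gt0.
have hlt i : n.+3%:R * h i < d * i.+1%:R^-1.
  rewrite /h invfM mulrCA ltr_pM2l// mulrA -[ltRHS]mul1r ltr_pM2r ?invr_gt0// ltr_pdivrMr//.
  by rewrite mul1r ltr_nat.
have hcvg r : 0 < r -> \forall i \near \oo, n.+3%:R * h i < r.
  move=> r0; have rd0 : 0 < r / d by rewrite divr_gt0.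
  have := near_infty_natSinv_lt (PosNum rd0); apply: filterS => i /= ir.
  apply: lt_trans (hlt i) _.
  by rewrite mulrC -ltr_pdivlMr.
have hd' i : n.+3%:R * h i < d.
  apply: lt_le_trans (hlt i) _.
  by rewrite ler_pdivrMr// ler_peMr ?ler1n//; exact: ltW.
pose gh i k z : R := (h i)^-1 * gt k z.
pose F (i : nat) : borel_rV R N -> R := fun z => \sum_(s : 'S_n.+1) (-1) ^+ s * \prod_k
  increment (gh i) k (h i *: e (s k)) (z + corner (fun j => h i *: e j) true s k).
have mgh i k : measurable_fun setT (gh i k).
  by apply: measurable_funM => //; exact: measurable_cst.
have F0 i : \int[mu]_z F i z = 0.
  apply: (@integral_cup _ _ _ (fun j => h i *: e j) (gh i) ((h i)^-1 * M)).
  - exact: mgh.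
  - move=> k z; rewrite normrM gtr0_norm ?invr_gt0// ler_pM2l ?invr_gt0//.
  - exact: (integrableZl measurableT _ intg).
have mF i : measurable_fun setT (F i).
  apply: measurable_sum => s; apply: measurable_funM; first exact: measurable_cst.
  by apply: measurable_prod => k _; exact: measurable_increment.
have corner_le i (s : 'S_n.+1) k : `|corner (fun j => h i *: e j) true s k| <= n.+1%:R * h i.
  apply: le_trans (ler_norm_sum _ _ _) _.
  rewrite mulr_natl -[n.+1 in leRHS]card_ord -sumr_const big_mkcond /=.
  apply: ler_sum => j _; case: ifP => _; last exact: ltW.
  by rewrite normrZ gtr0_norm// ler_piMr// ltW.
have hele i j : `|h i *: e j| <= n.+3%:R * h i.
  by rewrite normrZ gtr0_norm// mulrC ler_pM2r// (le_trans (e1 j))// ler1n.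
(* Dividing each function by the step, as in [gh], turns every increment into an exact derivative at
   a nearby point; only continuity of the derivatives is then needed in the limit. *)
have mvt i (s : 'S_n.+1) k z : K z \/ K (z + h i *: e (s ord0)) ->
  exists2 y, `|y - z| <= n.+3%:R * h i /\ W y &
   increment (gh i) k (h i *: e (s k)) (z + corner (fun j => h i *: e j) true s k) =
   'D_(e (s k)) (g k) y.
  move=> Kz; set c := corner _ _ _ _.
  have cle : `|c| <= n.+1%:R * h i by exact: corner_le.
  have he j : `|h i *: e j| <= h i by rewrite normrZ gtr0_norm// ler_piMr// ltW.
  have near_z t : 0 <= t <= h i -> `|c + t *: e (s k)| <= n.+2%:R * h i.
    move=> /andP[t0 th]; rewrite (le_trans (ler_normD _ _))//.
    rewrite -[n.+2]addn1 natrD mulrDl mul1r lerD// normrZ ger0_norm// (le_trans _ th)//.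
    by rewrite ler_piMr.
  have subz w : z + c + w - z = c + w by rewrite -[z + c + w]addrA [LHS]addrC addKr.
  have inW t : 0 <= t <= h i -> W (z + c + t *: e (s k)).
    move=> th; apply/WP; case: Kz => Kz.
      exists z => //; rewrite subz.
      apply: le_lt_trans (near_z t th) _; apply: le_lt_trans (hd' i).
      by rewrite ler_pM2r// ler_nat.
    exists (z + h i *: e (s ord0)) => //; rewrite opprD addrA subz.
    rewrite (le_lt_trans (ler_normB _ _))//; apply: le_lt_trans (hd' i).
    rewrite -[n.+3]addn1 natrD mulrDl mul1r; exact: lerD (near_z t th) (he _).
  have [|t th E] := @MVT_line _ _ (g k) (z + c) (e (s k)) (h i) (ltW (h0 i)).
    by move=> t th; apply: dg; apply: WV; exact: inW.
  exists (z + c + t *: e (s k)).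
    split; last exact: inW.
    rewrite subz; apply: le_trans (near_z t th) _.
    by rewrite ler_pM2r// ler_nat.
  have W0 : W (z + c).
    by rewrite -[z + c]addr0 -[X in _ + X](scale0r (e (s k))); apply: inW; rewrite lexx ltW.
  have W1 : W (z + c + h i *: e (s k)) by apply: inW; rewrite lexx ltW.
  rewrite /increment /gh !gtW// -mulrBr E mulrA mulVf ?mul1r// gt_eqF//.
(* The factor of index 0 is the difference of [gt ord0] at these two points, so outside this case
   the product vanishes. *)
have incr0 i (s : 'S_n.+1) z : ~ (K z \/ K (z + h i *: e (s ord0))) ->
   \prod_k
     increment (gh i) k (h i *: e (s k)) (z + corner (fun j => h i *: e j) true s k) = 0.
  move=> /not_orP[nK nKh]; rewrite (bigD1 ord0)//= /increment /gh.
  have -> : corner (fun j => h i *: e j) true s ord0 = 0.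
    by rewrite /corner big1// => j; rewrite ltn0.
  by rewrite addr0 !gt0// !mulr0 subrr mul0r.
pose C : R := \sum_(s : 'S_n.+1) M ^+ n.+1.
have FM i z : `|F i z| <= C * \1_W z.
  rewrite /F indicE; have [|nWz] := boolP (z \in W).
    rewrite inE mulr1 => Wz; apply: le_trans (ler_norm_sum _ _ _) _.
    apply: ler_sum => s _; rewrite normrM normrX normrN1 expr1n mul1r.
    have [Kz|nKz] := pselect (K z \/ K (z + h i *: e (s ord0))); last first.
      by rewrite incr0// normr0 exprn_ge0.
    rewrite normr_prod -[n.+1 in leRHS]card_ord -prodr_const; apply: ler_prod => k _.
    rewrite normr_ge0/=; have [y [_ Wy] ->] := mvt i s k z Kz.
    by move/WP : Wy => [x Kx /(hd x Kx)[_ /(_ k (s k))[]]].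
  rewrite mulr0 big1 ?normr0// => s _; rewrite incr0 ?mulr0//.
  move: nWz; rewrite notin_setE => nWz; case=> [/KW//|Kz]; apply: nWz; apply/WP.
  exists (z + h i *: e (s ord0)) => //.
  by rewrite opprD addrA subrr sub0r normrN (le_lt_trans (hele _ _)).
have Fcvg z : F ^~ z @ \oo --> jacobian z.
  have [Kz|nKz] := pselect (K z).
    apply: cvg_bigsum => s; apply: cvgM; first exact: cvg_cst.
    apply: cvg_prod_ord => k; apply/cvgrPdist_lt => r r0.
    have /cvgrPdist_lt/(_ r r0)/nbhs_ballP[t /= t0 ht] := @cdg k (s k) z (KV Kz).
    have := hcvg t t0; apply: filterS => i it.
    have [y [yz _] ->] := mvt i s k z (or_introl Kz).
    apply: ht; rewrite -ball_normE /= distrC; exact: le_lt_trans yz it.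
  rewrite jacobian_out//; apply: cvg_near_cst.
  have oK : open (~` K) by apply: closed_openC; exact: compact_closed cK.
  have /nbhs_ballP[t /= t0 ht] : nbhs z (~` K) by exact: open_nbhs_nbhs.
  have := hcvg t t0; apply: filterS => i it.
  rewrite /F big1// => s _; rewrite incr0 ?mulr0//; case=> //; apply: ht.
  by rewrite -ball_normE/= opprD addrA subrr sub0r normrN (le_lt_trans (hele _ _)).
have mJ : measurable_fun setT (jacobian : borel_rV R N -> R).
  by apply: (measurable_fun_cvg mF) => z _; exact: Fcvg.
have intF i : mu.-integrable setT (EFin \o F i).
  apply: (@le_integrable _ _ _ mu setT measurableT _ (fun z => (C * \1_W z)%:E)).
  - exact/measurable_EFinP.
  - by move=> z _; rewrite /= lee_fin (le_trans (FM i z))// ler_norm.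
  - exact: int1.
have intF0 i : (\int[mu]_z (F i z)%:E = 0)%E.
  rewrite -[LHS]fineK; last exact: (integrable_fin_num measurableT (intF i)).
  by congr EFin; exact: F0.
have [|||||intJ _ cvgJ] := @dominated_convergence _ _ _ mu setT measurableT
  (fun i z => (F i z)%:E) (EFin \o jacobian) (fun z => (C * \1_W z)%:E).
- by move=> i; exact/measurable_EFinP.
- exact/measurable_EFinP.
- by apply: aeW => z _; apply: cvg_EFin; [exact: nearW|exact: Fcvg].
- exact: int1.
- by apply: aeW => z i _; rewrite /= lee_fin FM.
split; first exact: intJ.
rewrite /Rintegral -[RHS]/(fine 0); congr fine.
have := cvg_unique _ cvgJ; apply => //.
by apply: cvg_near_cst; apply: nearW => i; exact: intF0.
Qed.

End jacobian.

(** * Functions of class C^k *)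

Section schwarz.
Context (R : realType) (V : normedModType R).
Implicit Types (f : V -> R) (x c u v : V).

Lemma derive_shift f x c v :
  'D_v (fun y => f (y + c)) x = 'D_v f (x + c) /\
  (derivable f (x + c) v -> derivable (fun y => f (y + c)) x v).
Proof.
have E : (fun h : R => h^-1 *: (((fun y => f (y + c)) \o shift x) (h *: v) - f (x + c))) =
    (fun h : R => h^-1 *: ((f \o shift (x + c)) (h *: v) - f (x + c))).
  by apply/funext => h /=; rewrite addrA.
by rewrite /derive /derivable E.
Qed.

(** Apply the mean value theorem along [u] to the difference of [f] in the direction [v], then along
    [v] to the derivative of [f] in the direction [u]. *)
Lemma mixed_difference f x u v (h r : R) : 0 <= h -> h * (`|u| + `|v|) < r ->
  (forall y, ball x r y -> derivable f y u /\ derivable (fun y => 'D_u f y : R) y v) ->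
  exists2 y, ball x r y &
    f (x + h *: u + h *: v) - f (x + h *: u) - (f (x + h *: v) - f x) =
    h * (h * 'D_v (fun y => 'D_u f y : R) y).
Proof.
move=> h0 hr df.
have inb s t : 0 <= s <= h -> 0 <= t <= h -> ball x r (x + s *: u + t *: v).
  move=> /andP[s0 sh] /andP[t0 th]; rewrite -ball_normE/= distrC.
  have -> : x + s *: u + t *: v - x = s *: u + t *: v.
    by rewrite -[x + _ + _]addrA [LHS]addrC addKr.
  apply: le_lt_trans hr; rewrite (le_trans (ler_normD _ _))// mulrDr !normrZ.
  by rewrite !ger0_norm// lerD// ler_wpM2r.
pose g y : R := f (y + h *: v) - f y.
have h00 : 0 <= (0 : R) <= h by rewrite lexx.
have hh : 0 <= h <= h by rewrite lexx andbT.
have dgu s : 0 <= s <= h -> derivable g (x + s *: u) u /\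
    'D_u g (x + s *: u) = 'D_u f (x + s *: u + h *: v) - 'D_u f (x + s *: u).
  move=> sh; have [d1 _] := df _ (inb s h sh hh).
  have := inb s 0 sh h00; rewrite scale0r addr0 => /df[d2 _].
  have [Ds ds] := derive_shift f (x + s *: u) (h *: v) u.
  split; first exact: (derivableB (ds d1) d2).
  by rewrite -Ds; exact: (deriveB (ds d1) d2).
have [s sh Es] := @MVT_line _ _ g x u h h0 (fun s sh => (dgu s sh).1).
have [t th Et] := @MVT_line _ _ (fun y => 'D_u f y : R) (x + s *: u) v h h0
  (fun t th => (df _ (inb s t sh th)).2).
exists (x + s *: u + t *: v); first exact: inb.
by rewrite -/(g (x + h *: u)) -/(g x) Es (dgu s sh).2 Et.
Qed.

(** The second difference is symmetric in [u] and [v], so the two mixed derivatives take a common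
    value at points arbitrarily close to [x]. This symmetry is what makes the complex Hessian
    Hermitian. *)
Lemma derive_sym f x u v :
  (\forall y \near x, [/\ derivable f y u, derivable f y v,
     derivable (fun y => 'D_u f y : R) y v & derivable (fun y => 'D_v f y : R) y u]) ->
  {for x, continuous (fun y => 'D_v (fun y => 'D_u f y : R) y : R)} ->
  {for x, continuous (fun y => 'D_u (fun y => 'D_v f y : R) y : R)} ->
  'D_v (fun y => 'D_u f y : R) x = 'D_u (fun y => 'D_v f y : R) x.
Proof.
move=> df /cvgrPdist_lt cA /cvgrPdist_lt cB; apply/eqP; rewrite -subr_eq0 -normr_le0.
apply/ler_addgt0Pr => e e0; rewrite add0r.
have e20 : 0 < e / 2 by rewrite divr_gt0.
pose A (y : V) : R := 'D_v (fun y => 'D_u f y : R) y.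
pose B (y : V) : R := 'D_u (fun y => 'D_v f y : R) y.
have /nbhs_ballP[r /= r0 hr] : \forall y \near x,
    [/\ derivable f y u, derivable f y v,
     derivable (fun y => 'D_u f y : R) y v & derivable (fun y => 'D_v f y : R) y u] /\
    (`|A x - A y| < e / 2 /\ `|B x - B y| < e / 2).
  by apply: filterI df _; exact: filterI (cA _ e20) (cB _ e20).
(* The added 1 keeps the denominator positive when [u] and [v] vanish and makes the bound on [h]
   strict. *)
pose h := r / (1 + `|u| + `|v|).
have k0 : 0 < 1 + `|u| + `|v| by rewrite -addrA ltr_pwDl// addr_ge0.
have h0 : 0 < h by rewrite divr_gt0.
have hlt : h * (`|u| + `|v|) < r.
  rewrite /h mulrAC ltr_pdivrMr// ltr_pM2l// -addrA ltrDr ltr01//.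
have [y By Ey] := @mixed_difference f x u v h r (ltW h0) hlt
  (fun y hy => let: conj (And4 a _ b _) _ := hr y hy in conj a b).
have [y' By' Ey'] := @mixed_difference f x v u h r (ltW h0)
  ltac:(by rewrite addrC in hlt *; exact: hlt)
  (fun y hy => let: conj (And4 _ a _ b) _ := hr y hy in conj a b).
have E2 : h * (h * A y) = h * (h * B y').
  rewrite [x + h *: v + h *: u]addrAC in Ey'.
  have swap (a b c d p q : R) : a - b - (c - d) = p -> a - c - (b - d) = q -> p = q.
    by move=> <- <-; ring.
  exact: (swap _ _ _ _ _ _ Ey Ey').
have hn := lt0r_neq0 h0; have E : A y = B y' := mulfI hn (mulfI hn E2).
have [_ [ha _]] := hr y By; have [_ [_ hb]] := hr y' By'.
have close (a a' b b' : R) : a' = b' -> `|a - a'| < e / 2 -> `|b - b'| < e / 2 ->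
    `|a - b| <= e.
  move=> <- /ltW aa /ltW ba; rewrite (_ : a - b = (a - a') - (b - a')); last by ring.
  by apply: le_trans (ler_normB _ _) _; rewrite [e]splitr lerD.
exact: (close _ _ _ _ E ha hb).
Qed.

End schwarz.

Section class_C.
Context (R : realType) (N : nat).
Implicit Types (V : set 'rV[R]_N) (f : 'rV[R]_N -> R).

Lemma partial_sym V f z i j : open V -> class_C 2 V f -> V z ->
  partial i (partial j f) z = partial j (partial i f) z.
Proof.
move=> oV [cf hf] Vz; apply: derive_sym.
- have : \forall y \near z, V y by exact: open_nbhs_nbhs.
  apply: filterS => y Vy; split.
  + by have [+ _] := hf j; apply.
  + by have [+ _] := hf i; apply.
  + by have [_ [_ /(_ i)[+ _]]] := hf j; apply.
  + by have [_ [_ /(_ j)[+ _]]] := hf i; apply.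
- by have [_ [_ /(_ i)[_ [+ _]]]] := hf j; apply.
- by have [_ [_ /(_ j)[_ [+ _]]]] := hf i; apply.
Qed.

Lemma class_C_partial V f k i : class_C k.+1 V f -> class_C k V (partial i f).
Proof. by move=> [_ /(_ i)[]]. Qed.

Lemma class_C_sub V W f k : W `<=` V -> class_C k V f -> class_C k W f.
Proof.
move=> WV; elim: k f => [|k ih] f [cf hf]; split => //.
- by move=> z /WV; exact: cf.
- by move=> z /WV; exact: cf.
- move=> i; have [df hpf] := hf i; split; first by move=> z /WV; exact: df.
  exact: ih.
Qed.

Lemma partial_coord i j z : partial i (fun y : 'rV[R]_N => y 0 j) z = (i == j)%:R /\
  derivable (fun y : 'rV[R]_N => y 0 j) z (delta_mx 0 i).
Proof.
have E : (fun h : R => h^-1 *: (((fun y : 'rV[R]_N => y 0 j) \o shift z) (h *: delta_mx 0 i) - z 0 j)) @ 0^' --> ((i == j)%:R : R).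
  apply: cvg_near_cst; near=> h; have h0 : h != 0 by near: h; exact: nbhs_dnbhs_neq.
  by rewrite /= !mxE addrK eqxx /= eq_sym [_ *: _]mulrA mulVf ?mul1r.
by split; [exact: cvg_lim E|apply: cvgP E].
Unshelve. all: by end_near. Qed.

Lemma coord_continuous_rV j : continuous (fun y : 'rV[R]_N => y 0 j : R).
Proof. exact: coord_continuous. Qed.

Lemma partial_coordM f i j z : derivable f z (delta_mx 0 i) ->
  derivable (fun y : 'rV[R]_N => y 0 j * f y) z (delta_mx 0 i) /\
  partial i (fun y => y 0 j * f y) z = z 0 j * partial i f z + (i == j)%:R * f z.
Proof.
move=> df; have [pj dj] := partial_coord i j z; split; first exact: (derivableM dj df).
rewrite [LHS](deriveM dj df) -/(partial i f z) -/(partial i _ z) pj.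
by congr (_ + _); exact: mulrC.
Qed.

Lemma continuous_near_eq (f g : 'rV[R]_N -> R) z : (\forall y \near z, g y = f y) ->
  {for z, continuous g} -> {for z, continuous f}.
Proof.
move=> gf; rewrite /prop_for /continuous_at -(nbhs_singleton gf).
by move=> cg P /cg; apply: (filterS2 _ _ gf) => y /= ->.
Qed.

Lemma class_C1_coordM V f j : open V -> class_C 1 V f ->
  class_C 1 V (fun y => y 0 j * f y).
Proof.
move=> oV [cf hf]; split.
  by move=> z Vz; exact: (cvgM (@coord_continuous_rV j z) (cf z Vz)).
move=> i; have [df [cdf _]] := hf i; split.
  by move=> z Vz; have [] := partial_coordM j (df z Vz).
split; last by [].
move=> z Vz; apply: (@continuous_near_eq _ (fun y => y 0 j * partial i f y + (i == j)%:R * f y)).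
  have : \forall y \near z, V y by exact: open_nbhs_nbhs.
  by apply: filterS => y Vy; have [_ ->] := partial_coordM j (df y Vy).
exact: (cvgD (cvgM (@coord_continuous_rV j z) (cdf z Vz)) (cvgM (cvg_cst _) (cf z Vz))).
Qed.

Lemma class_C_cst V (c : R) k : class_C k V (cst c).
Proof.
elim: k c => [|k ih] c; split => //; try by move=> z _; exact: cst_continuous.
move=> i; split; first by move=> z _; exact: derivable_cst.
suff -> : partial i (cst c) = cst 0 by exact: ih.
by apply/funext => z; exact: derive_cst.
Qed.

Lemma partial_normsq i z : derivable (@normsq R N) z (delta_mx 0 i) /\
  partial i (@normsq R N) z = z 0 i * 2.
Proof.
pose h (j : 'I_N) : 'rV[R]_N -> R := fun y => y 0 j * y 0 j.
have hE : @normsq R N = \sum_(j < N) h j.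
  by apply/funext => y; rewrite fct_sumE; apply: eq_bigr => j _; rewrite expr2.
have hj j := partial_coordM j (partial_coord i j z).2.
have dh j : derivable (h j) z (delta_mx 0 i) by have [] := hj j.
split; first by rewrite hE; exact: derivable_sum.
rewrite /partial hE derive_sum//.
under eq_bigr => j _ do rewrite -/(partial i (h j) z) (hj j).2 (partial_coord i j z).1.
rewrite (bigD1 i)//= eqxx big1 ?addr0.
  by rewrite mulr1 mul1r; ring.
by move=> j ji; rewrite eq_sym (negbTE ji) mulr0 mul0r addr0.
Qed.

Lemma class_C2_normsq V : open V -> class_C 2 V (@normsq R N).
Proof.
move=> oV; split.
  move=> z _; have cj j : (y 0 j ^+ 2 : R) @[y --> z] --> z 0 j ^+ 2.
    exact: (cvgM (@coord_continuous_rV j z) (@coord_continuous_rV j z)).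
  exact: (cvg_bigsum cj).
move=> i; split; first by move=> z _; exact: (partial_normsq i z).1.
rewrite (_ : partial i _ = fun y => y 0 i * (cst 2 y)).
  by apply: class_C1_coordM => //; exact: class_C_cst.
by apply/funext => z; exact: (partial_normsq i z).2.
Qed.

End class_C.

(** * Wedge products of complex Hessians *)

(** Multilinearity in the columns, used with d/dz_j as a combination of d/dx_j and d/dy_j: a
    determinant of complex derivatives becomes a combination of real Jacobians, one for each choice
    of x_j or y_j in every column. *)
Lemma det_sum_columns (A : comPzRingType) (n : nat) (alpha : bool -> A)
    (D : 'I_n -> bool -> 'I_n -> A) :
  \det (\matrix_(k, j) \sum_b alpha b * D k b j) =
  \sum_(c : {ffun 'I_n -> bool}) (\prod_j alpha (c j)) *
     \det (\matrix_(k, j) D k (c j) j).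
Proof.
transitivity (\sum_(s : 'S_n) \sum_(c : {ffun 'I_n -> bool})
    (\prod_j alpha (c j)) * ((-1) ^+ s * \prod_k D k (c (s k)) (s k))).
  apply: eq_bigr => s _; under eq_bigr do rewrite mxE.
  rewrite (reindex_inj (@perm_inj _ s^-1%g)) /=.
  rewrite bigA_distr_bigA big_distrr /=; apply: eq_bigr => c _.
  rewrite big_split mulrCA /=; congr (_ * (_ * _)).
  rewrite [RHS](reindex_inj (@perm_inj _ s^-1%g)) /=.
  by apply: eq_bigr => j _; rewrite permKV.
rewrite exchange_big; apply: eq_bigr => c _; rewrite -big_distrr; congr (_ * _).
by apply: eq_bigr => s _; congr (_ * _); apply: eq_bigr => k _; rewrite mxE.
Qed.

Section null_functions.
Context (R : realType) (N : nat).
Local Notation mu := (@lebesgue_rV R N).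
Implicit Types (f : 'rV[R]_N -> R[i]).

Definition null_integral f :=
  (mu.-integrable setT (EFin \o (fun z => complex.Re (f z))) /\
   \int[mu]_z complex.Re (f z) = 0) /\
  (mu.-integrable setT (EFin \o (fun z => complex.Im (f z))) /\
   \int[mu]_z complex.Im (f z) = 0).

Lemma null_integral_real (g : 'rV[R]_N -> R) :
  mu.-integrable setT (EFin \o g) -> \int[mu]_z g z = 0 ->
  null_integral (fun z => (g z)%:C%C).
Proof.
move=> intg g0; split => //; split => /=; first exact: integrable0.
by rewrite Rintegral_cst// mul0r.
Qed.

Lemma null_integralZD (c : R[i]) f g : null_integral f -> null_integral g ->
  null_integral (fun z => c * f z + g z).
Proof.
case: c => a b [[iRf Rf] [iIf If]] [[iRg Rg] [iIg Ig]].
have lin (u v w : 'rV[R]_N -> R) (p q : R) : mu.-integrable setT (EFin \o u) ->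
   mu.-integrable setT (EFin \o v) -> mu.-integrable setT (EFin \o w) ->
   \int[mu]_z u z = 0 -> \int[mu]_z v z = 0 -> \int[mu]_z w z = 0 ->
   mu.-integrable setT (EFin \o (fun z => p * u z + q * v z + w z)) /\
   \int[mu]_z (p * u z + q * v z + w z) = 0.
  move=> iu iv iw u0 v0 w0.
  have ipu : mu.-integrable setT (EFin \o (fun z => p * u z)) by exact: (integrableZl measurableT p iu).
  have iqv : mu.-integrable setT (EFin \o (fun z => q * v z)) by exact: (integrableZl measurableT q iv).
  have ipq : mu.-integrable setT (EFin \o (fun z => p * u z + q * v z)) by exact: (integrableD measurableT ipu iqv).
  split; first exact: (integrableD measurableT ipq iw).
  rewrite (RintegralD measurableT ipq iw) (RintegralD measurableT ipu iqv).
  by rewrite !RintegralZl// u0 v0 w0 !mulr0 !addr0.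
split.
  have := lin _ _ _ a (- b) iRf iIf iRg Rf If Rg.
  have -> // : (fun z => a * complex.Re (f z) + - b * complex.Im (f z) + complex.Re (g z)) =
    (fun z => complex.Re (Complex a b * f z + g z)).
  by apply/funext => z; case: (f z) (g z) => [x y] [x' y'] /=; rewrite mulNr.
have := lin _ _ _ a b iIf iRf iIg If Rf Ig.
have -> // : (fun z => a * complex.Im (f z) + b * complex.Re (f z) + complex.Im (g z)) =
  (fun z => complex.Im (Complex a b * f z + g z)).
by apply/funext => z; case: (f z) (g z) => [x y] [x' y'] /=.
Qed.

Lemma null_integral_sum (I : Type) (r : seq I) (P : pred I) (c : I -> R[i])
    (F : I -> 'rV[R]_N -> R[i]) : (forall i, null_integral (F i)) ->
  null_integral (fun z => \sum_(i <- r | P i) c i * F i z).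
Proof.
move=> nF; elim: r => [|i r ih].
  have -> : (fun z => \sum_(i <- [::] | P i) c i * F i z) = (fun z => (0 : R)%:C%C).
    by apply/funext => z; rewrite big_nil.
  apply: null_integral_real; first exact: integrable0.
  by rewrite Rintegral_cst// mul0r.
have [Pi|nPi] := boolP (P i).
  have -> : (fun z => \sum_(i <- i :: r | P i) c i * F i z) =
      (fun z => c i * F i z + \sum_(i <- r | P i) c i * F i z).
    by apply/funext => z; rewrite big_cons Pi.
  exact: null_integralZD.
have -> // : (fun z => \sum_(i <- i :: r | P i) c i * F i z) =
    (fun z => \sum_(i <- r | P i) c i * F i z).
by apply/funext => z; rewrite big_cons (negbTE nPi).
Qed.

End null_functions.

Lemma norm_delta_le (R : realType) (N : nat) (i : 'I_N) :
  `|delta_mx 0 i : 'rV[R]_N| <= 1.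
Proof.
apply: norm_le_rV => // j; rewrite mxE eqxx /=.
by case: (j == i); rewrite ?normr1 ?normr0.
Qed.

Lemma real_complexD (R : rcfType) (x y : R) :
  ((x + y)%:C = x%:C + y%:C)%C.
Proof. exact: rmorphD. Qed.

Lemma real_complexM (R : rcfType) (x y : R) :
  ((x * y)%:C = x%:C * y%:C)%C.
Proof. exact: rmorphM. Qed.

Lemma real_complex_bool (R : rcfType) (b : bool) : ((b%:R : R)%:C)%C = b%:R :> R[i].
Proof. exact: rmorph_nat. Qed.

Section coordinates.
Context (R : realType) (n : nat).
Local Notation Cn := 'rV[R]_(n.+1 + n.+1).
Local Notation mu := (@lebesgue_rV R (n.+1 + n.+1)).
Implicit Types (z : Cn) (b : bool) (j k a : 'I_n.+1) (f : Cn -> R).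

Definition real_dir b j : 'I_(n.+1 + n.+1) :=
  if b then rshift n.+1 j else lshift n.+1 j.

(** As in [real_dir], [true] stands for y and [false] for x: d/dz = (d/dx - i d/dy) / 2, and d/dzbar
    has the conjugate coefficients. *)
Definition dz_coef b : R[i] := if b then Complex 0 (- 2^-1) else Complex 2^-1 0.
Definition dzbar_coef b : R[i] := if b then Complex 0 2^-1 else Complex 2^-1 0.

Definition dz j f z : R[i] :=
  \sum_b dz_coef b * ((partial (real_dir b j) f z)%:C)%C.

Definition zbar a z : R[i] := Complex (z 0 (real_dir false a)) (- z 0 (real_dir true a)).

Lemma dzE j f z : dz j f z =
  dz_coef true * ((partial (rshift n.+1 j) f z)%:C)%C +
  dz_coef false * ((partial (lshift n.+1 j) f z)%:C)%C.
Proof. by rewrite /dz big_bool. Qed.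

Lemma complex_hessianE f z j k : complex_hessian f z j k =
  \sum_b dzbar_coef b * dz j (partial (real_dir b k) f) z.
Proof.
have alg (p q r s : R) : Complex ((p + q) / 4) ((r - s) / 4) =
    Complex 0 2^-1 * (Complex 0 (- 2^-1) * (q%:C)%C + Complex 2^-1 0 * (r%:C)%C) +
    Complex 2^-1 0 * (Complex 0 (- 2^-1) * (s%:C)%C + Complex 2^-1 0 * (p%:C)%C).
  by apply/eqP; rewrite eq_complex /=; apply/andP; split; apply/eqP; field.
by rewrite mxE [LHS]alg big_bool !dzE.
Qed.

Lemma partial_out (K : set Cn) i f z : compact K -> (forall z, ~ K z -> f z = 0) ->
  ~ K z -> derivable f z (delta_mx 0 i) /\ partial i f z = 0.
Proof.
move=> cK f0 nKz.
have oK : open (~` K) by apply: closed_openC; exact: compact_closed cK.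
have : nbhs z (~` K) by exact: open_nbhs_nbhs.
move=> nz; have E : {near z, cst 0 =1 f} by apply: filterS nz => y /f0 ->.
split; first by apply: near_eq_derivable E _; exact: derivable_cst.
by rewrite /partial -(near_eq_derive _ E)//; exact: derive_cst.
Qed.

Section closed_form.
Context (V K : set Cn) (G : 'I_n.+1 -> Cn -> R).
Hypothesis oV : open V.
Hypothesis cK : compact K.
Hypothesis KV : K `<=` V.

Lemma null_integral_det : (forall z, ~ K z -> G ord0 z = 0) ->
  (forall k, class_C 1 V (G k)) ->
  null_integral (fun z => \det (\matrix_(k, j) dz j (G k) z)).
Proof.
move=> G0 CG.
have -> : (fun z => \det (\matrix_(k, j) dz j (G k) z)) =
    (fun z => \sum_(c : {ffun 'I_n.+1 -> bool}) (\prod_j dz_coef (c j)) *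
      ((jacobian (fun j => delta_mx 0 (real_dir (c j) j)) G z)%:C)%C).
  apply/funext => z; rewrite det_sum_columns; apply: eq_bigr => c _; congr (_ * _).
  rewrite -[jacobian _ _ _]/(_ : R) /jacobian rmorph_sum; apply: eq_bigr => s _.
  rewrite rmorphM rmorph_sign rmorph_prod; congr (_ * _).
  by apply: eq_bigr => k _; rewrite mxE.
apply: null_integral_sum => c.
have [intJ J0] := @integral_jacobian R _ n (fun j => delta_mx 0 (real_dir (c j) j)) G V K
  oV cK KV G0 (fun j => norm_delta_le _ _) (fun k z => (CG k).1 z)
  (fun k j z => ((CG k).2 (real_dir (c j) j)).1 z)
  (fun k j z => ((CG k).2 (real_dir (c j) j)).2.1 z).
exact: null_integral_real.
Qed.

End closed_form.

Lemma coef_alg b (t : bool) (x p q g : R[i]) :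
  dz_coef true * (x * p + (b && t)%:R * g) +
  dz_coef false * (x * q + (~~ b && t)%:R * g) =
  x * (dz_coef true * p + dz_coef false * q) + dz_coef b * g * t%:R.
Proof.
by case: b => /=; move: (dz_coef true) (dz_coef false) => u v; case: t => /=; ring.
Qed.

(** The terms in [g * p] cancel because [dz_coef false - i dz_coef true = 0], which says that d/dz
    annihilates x - i y. *)
Lemma zbar_alg (x y : R) (d g p : R[i]) :
  Complex 0 (-1) * ((y%:C)%C * d + dz_coef true * g * p) +
  ((x%:C)%C * d + dz_coef false * g * p) = Complex x (- y) * d.
Proof.
have -> : Complex x (- y) = (x%:C)%C + Complex 0 (-1) * (y%:C)%C.
  by apply/eqP; rewrite eq_complex /=; apply/andP; split; apply/eqP; ring.
have : Complex 0 (-1) * dz_coef true + dz_coef false = 0.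
  by apply/eqP; rewrite eq_complex /=; apply/andP; split; apply/eqP; field.
move: (x%:C)%C (y%:C)%C (Complex 0 (-1)) (dz_coef true) (dz_coef false) => x' y' c u v h.
transitivity (x' * d + c * y' * d + (c * u + v) * g * p); first by ring.
by rewrite h; ring.
Qed.

(** As zbar_a is antiholomorphic, multiplying the first row by it amounts to replacing [G ord0] by
    zbar_a times [G ord0], to which [null_integral_det] applies. *)
Lemma null_integral_zbar_det (V K : set Cn) (G : 'I_n.+1 -> Cn -> R) a :
  open V -> compact K -> K `<=` V -> (forall z, ~ K z -> G ord0 z = 0) ->
  (forall k, class_C 1 V (G k)) ->
  null_integral (fun z => zbar a z * \det (\matrix_(k, j) dz j (G k) z)).
Proof.
move=> oV cK KV G0 CG.
(* The functions are real-valued, so the products with x_a and with y_a are treated separately and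
   recombined with coefficients 1 and -i. *)
pose Gc b k : Cn -> R := if k == ord0 then fun z => z 0 (real_dir b a) * G ord0 z else G k.
have nGc b : null_integral (fun z => \det (\matrix_(k, j) dz j (Gc b k) z)).
  apply: (null_integral_det oV cK KV).
    by move=> z nKz; rewrite /Gc eqxx G0// mulr0.
  by move=> k; rewrite /Gc; case: eqP => // _; exact: class_C1_coordM.
have := null_integralZD (Complex 0 (-1)) (nGc true) (nGc false).
congr null_integral; apply/funext => z.
pose M : 'M[R[i]]_n.+1 := \matrix_(k, j) dz j (G k) z.
(* The product rule splits the first row into a multiple of that of [M] and a multiple of the unit
   row at [a]; the determinant of [P] collects the latter and cancels by [zbar_alg]. *)
pose P : 'M[R[i]]_n.+1 := \matrix_(k, j) if k == ord0 then (j == a)%:R else M k j.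
have dG0 i : derivable (G ord0) z (delta_mx 0 i).
  have [Kz|nKz] := pselect (K z); last by have [] := partial_out i cK G0 nKz.
  by have [+ _] := (CG ord0).2 i; apply; exact: KV.
have detGc b : \det (\matrix_(k, j) dz j (Gc b k) z) =
   ((z 0 (real_dir b a))%:C)%C * \det M + (dz_coef b * ((G ord0 z)%:C)%C) * \det P.
  apply: (@determinant_multilinear _ _ _ _ _ ord0).
  - apply/rowP => j; rewrite !mxE eqxx !dzE /Gc eqxx.
    rewrite (partial_coordM (real_dir b a) (dG0 (rshift n.+1 j))).2.
    rewrite (partial_coordM (real_dir b a) (dG0 (lshift n.+1 j))).2.
    have -> : (rshift n.+1 j == real_dir b a) = b && (j == a).
      by case: b; rewrite /real_dir ?eq_rshift// eq_rlshift.
    have -> : (lshift n.+1 j == real_dir b a) = ~~ b && (j == a).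
      by case: b; rewrite /real_dir ?eq_lshift// eq_lrshift.
    rewrite !real_complexD !real_complexM !real_complex_bool.
    exact: coef_alg.
  - by apply/matrixP => k j; rewrite !mxE /Gc eq_sym (negbTE (neq_lift _ _)).
  - by apply/matrixP => k j; rewrite !mxE /Gc eq_sym (negbTE (neq_lift _ _)).
rewrite (detGc true) (detGc false); exact: zbar_alg.
Qed.

End coordinates.

Lemma prod_factor0 (A : comPzRingType) (I : finType) (F : I -> A) i :
  F i = 0 -> \prod_k F k = 0.
Proof. by move=> Fi0; rewrite (bigD1 i)//= Fi0 mul0r. Qed.

Section wedge.
Context (R : realType) (n : nat).
Local Notation Cn := 'rV[R]_(n.+1 + n.+1).
Local Notation mu := (@lebesgue_rV R (n.+1 + n.+1)).
Implicit Types (z : Cn) (j k a : 'I_n.+1).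

Definition wedge_sum (F : 'I_n.+1 -> Cn -> R) z : R[i] :=
  \sum_(s : 'S_n.+1) \sum_(t : 'S_n.+1) (-1) ^+ s * (-1) ^+ t *
    \prod_(k < n.+1) complex_hessian (F k) z (s k) (t k).

(** For a fixed permutation of the zbar indices, expand each d/dzbar into real derivatives; the
    signed sum over the permutations of the z indices is then a determinant of d/dz derivatives of
    first derivatives of the [F k]. *)
Lemma wedge_sumE (F : 'I_n.+1 -> Cn -> R) z : wedge_sum F z =
  \sum_(p : 'S_n.+1 * {ffun 'I_n.+1 -> bool})
    ((-1) ^+ p.1 * \prod_k dzbar_coef R (p.2 k)) *
    \det (\matrix_(k, j) dz j (partial (real_dir (p.2 k) (p.1 k)) (F k)) z).
Proof.
rewrite /wedge_sum exchange_big /=.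
rewrite -(pair_big xpredT xpredT (fun (t : 'S_n.+1) (c : {ffun 'I_n.+1 -> bool}) =>
  ((-1) ^+ t * \prod_k dzbar_coef R (c k)) *
    \det (\matrix_(k, j) dz j (partial (real_dir (c k) (t k)) (F k)) z))) /=.
apply: eq_bigr => t _.
transitivity (\sum_(s : 'S_n.+1) \sum_(c : {ffun 'I_n.+1 -> bool})
   ((-1) ^+ t * \prod_k dzbar_coef R (c k)) * ((-1) ^+ s *
     \prod_k dz (s k) (partial (real_dir (c k) (t k)) (F k)) z)).
  apply: eq_bigr => s _.
  under eq_bigr => k _ do rewrite complex_hessianE.
  rewrite bigA_distr_bigA big_distrr /=; apply: eq_bigr => c _.
  rewrite big_split /=; set A := \prod_(i < _) _; set B := \prod_(i < _) _.
  move: A B ((-1) ^+ s) ((-1) ^+ t) => A B u v; ring.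
rewrite exchange_big; apply: eq_bigr => c _; rewrite -big_distrr /=; congr (_ * _).
apply: eq_bigr => s _; congr (_ * _); apply: eq_bigr => k _.
by rewrite mxE.
Qed.

Lemma complex_hessian_conj V f z j k : open V -> class_C 2 V f -> V z ->
  conjc (complex_hessian f z j k) = complex_hessian f z k j.
Proof.
move=> oV cf Vz; have sym i1 i2 := @partial_sym R _ V f z i1 i2 oV cf Vz.
rewrite !mxE /dx /dy (sym (lshift _ k)) (sym (rshift _ k)).
rewrite (sym (lshift _ k) (rshift _ j)) (sym (rshift _ k) (lshift _ j)).
by apply/eqP; rewrite eq_complex /= eqxx -mulNr opprB eqxx.
Qed.

Context (V K : set Cn) (F : 'I_n.+1 -> Cn -> R).
Hypothesis oV : open V.
Hypothesis cK : compact K.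
Hypothesis KV : K `<=` V.
Hypothesis F0 : forall z, ~ K z -> F ord0 z = 0.
Hypothesis CF : forall k, class_C 2 V (F k).

Lemma wedge_sum_out z : ~ K z -> wedge_sum F z = 0.
Proof.
move=> nKz; rewrite /wedge_sum big1// => s _; rewrite big1// => t _.
have dF0 i y : ~ K y -> partial i (F ord0) y = 0 by case/(partial_out i cK F0).
have ddF0 i l : partial l (partial i (F ord0)) z = 0.
  by case: (partial_out l cK (dF0 i) nKz).
have H0 : complex_hessian (F ord0) z (s ord0) (t ord0) = 0.
  have alg (p q r w : R) : p = 0 -> q = 0 -> r = 0 -> w = 0 ->
      Complex ((p + q) / 4) ((r - w) / 4) = 0.
    by move=> -> -> -> ->; rewrite addr0 subr0 mul0r.
  by rewrite mxE; apply: alg; exact: ddF0.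
rewrite (@prod_factor0 _ _ (fun k => complex_hessian (F k) z (s k) (t k)) ord0 H0).
exact: mulr0.
Qed.

(** On [K] the Hessians are Hermitian, so conjugation exchanges the two sums over permutations.
    Consequently the real and imaginary parts of [zbar a] times the sum isolate the coordinates x_a
    and y_a. *)
Lemma wedge_sum_real z : complex.Im (wedge_sum F z) = 0.
Proof.
have [Kz|nKz] := pselect (K z); last by rewrite wedge_sum_out.
have : conjc (wedge_sum F z) = wedge_sum F z.
  rewrite /wedge_sum rmorph_sum exchange_big /=; apply: eq_bigr => s _.
  rewrite rmorph_sum; apply: eq_bigr => t _; rewrite !rmorphM !rmorph_sign rmorph_prod.
  rewrite [_ * (-1) ^+ s]mulrC; congr (_ * _); apply: eq_bigr => k _.
  by apply: complex_hessian_conj oV (CF k) _; exact: KV.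
by case: (wedge_sum F z) => x y [] /=; lra.
Qed.

Lemma null_integral_zbar_wedge a : null_integral (fun z => zbar a z * wedge_sum F z).
Proof.
have -> : (fun z => zbar a z * wedge_sum F z) =
  (fun z => \sum_(p : 'S_n.+1 * {ffun 'I_n.+1 -> bool})
    ((-1) ^+ p.1 * \prod_k dzbar_coef R (p.2 k)) * (zbar a z *
    \det (\matrix_(k, j) dz j (partial (real_dir (p.2 k) (p.1 k)) (F k)) z))).
  apply/funext => z; rewrite wedge_sumE big_distrr; apply: eq_bigr => p _.
  by rewrite [LHS]mulrCA.
apply: null_integral_sum => p; apply: (null_integral_zbar_det a oV cK KV).
  by move=> z nKz; case: (partial_out (real_dir (p.2 ord0) (p.1 ord0)) cK F0 nKz).
by move=> k; apply: class_C_partial; exact: CF.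
Qed.

Lemma integral_coord_ddc_wedge i :
  mu.-integrable setT (EFin \o (fun z : Cn => z 0 i * ddc_wedge F z)) /\
  \int[mu]_z (z 0 i * ddc_wedge F z) = 0.
Proof.
have ddcE z : ddc_wedge F z = 4 ^+ n.+1 * complex.Re (wedge_sum F z) by [].
suff [c [g [ig g0 gE]]] : exists (c : R) (g : Cn -> R), [/\ mu.-integrable setT (EFin \o g),
    \int[mu]_z g z = 0 & forall z, z 0 i * ddc_wedge F z = c * g z].
  rewrite (_ : (fun z => _) = fun z => c * g z); last exact/funext.
  split; first exact: (integrableZl measurableT c ig).
  by rewrite RintegralZl// g0 mulr0.
have [a [b ->]] : exists a b, i = real_dir b a.
  by case: (splitP i) => a ia; exists a; [exists false|exists true]; exact: val_inj.
have [[iRe Re0] [iIm Im0]] := null_integral_zbar_wedge a.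
case: b; [exists (- 4 ^+ n.+1), (fun z => complex.Im (zbar a z * wedge_sum F z))
         |exists (4 ^+ n.+1), (fun z => complex.Re (zbar a z * wedge_sum F z))];
  split => // z; rewrite ddcE; have := wedge_sum_real z;
  case: (wedge_sum F z) => x y /= ->; rewrite /zbar /=;
  move: (4 ^+ n.+1) (z 0 _) (z 0 _) => c p q; ring.
Qed.

End wedge.

(** * The coordinates are m-subharmonic *)

Section linear_functions.
Context (R : realType).

Lemma upper_semicontinuous_within (N : nat) (A : set 'rV[R]_N) (u : 'rV[R]_N -> R) :
  {within A, continuous u} -> upper_semicontinuous_on A (EFin \o u).
Proof.
move=> cu; apply/lower_semicontinuousP => a.
have -> : [set x : subspace A | (a%:E < - (EFin \o u) x)%E] = u @^-1` [set y | y < - a].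
  by apply/seteqP; split => x /=; rewrite lte_fin ltrNr.
by move/continuousP : cu; apply; exact: open_lt.
Qed.

Context (N : nat).
Local Notation mu := (@lebesgue_rV R N).
Implicit Types (a z : 'rV[R]_N).

Lemma normsq_coord_le z i : z 0 i ^+ 2 <= normsq z.
Proof. by rewrite /normsq (bigD1 i)//= lerDl; apply: sumr_ge0 => j _; exact: sqr_ge0. Qed.

Lemma normsq_eq0 z : normsq z <= 0 -> z = 0.
Proof.
move=> z0; apply/rowP => i; rewrite mxE; apply/eqP; rewrite -sqrf_eq0 eq_le sqr_ge0 andbT.
exact: le_trans (normsq_coord_le z i) z0.
Qed.

Lemma normsq_continuous : continuous (@normsq R N).
Proof. by move=> z; exact: (class_C2_normsq openT).1. Qed.

Lemma euclidean_ball_compact a r : 0 < r -> compact (euclidean_ball a r).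
Proof.
move=> r0; apply: bounded_closed_compact; last first.
  apply: (@preimage_closed _ _ (fun z => normsq (z - a)) [set y | y <= r ^+ 2]).
    move=> z _; apply: continuous_comp; last exact: normsq_continuous.
    by apply: continuousB => //; exact: cst_continuous.
  exact: closed_le.
exists (`|a| + r); split; first exact: num_real.
move=> M aM z /= zr; apply: le_trans (ltW aM).
rewrite -[z](subrK a) addrC; apply: le_trans (ler_normD _ _) _; rewrite lerD2l.
apply: norm_le_rV => [|i]; first exact: ltW.
by rewrite -ler_sqr ?nnegrE ?(ltW r0)// real_normK ?num_real//;
  exact: le_trans (normsq_coord_le _ i) zr.
Qed.

Lemma normsqN z : normsq (- z) = normsq z.
Proof. by apply: eq_bigr => i _; rewrite mxE sqrrN. Qed.

Lemma coord_mean_value a r (c : R) i : 0 < r ->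
  (mu (euclidean_ball a r) * (c * a 0 i)%:E =
   \int[mu]_(z in euclidean_ball a r) (c * z 0 i)%:E)%E.
Proof.
move=> r0; set B := euclidean_ball a r; set w := fun z : 'rV[R]_N => c * z 0 i.
have cB : compact B by exact: euclidean_ball_compact.
have mB : measurable (B : set (borel_rV R N)).
  by apply: measurable_closed_rV; exact: compact_closed cB.
have muB : (mu B < +oo)%E.
  have /ex_strict_bound_gt0[M M0 /= hM] := compact_bounded cB.
  by apply: (lebesgue_rV_bounded mB (M := M)) => z Bz; exact/ltW/hM.
have cw : continuous w.
  by move=> z; apply: continuousM; [exact: cst_continuous|exact: coord_continuous_rV].
have cwB : {within B, continuous w} by exact: continuous_subspaceT.
have iw := integrable_within cB muB cwB.
(* The ball is invariant under this reflection, and the sum of [w] and its reflection is the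
   constant [2 * w a]. *)
pose phi (z : 'rV[R]_N) : 'rV[R]_N := (a + a) - z.
have mphi : measurable_fun setT (phi : borel_rV R N -> borel_rV R N).
  apply: measurable_continuous_rV; rewrite /phi.
  by move=> z; apply: (@continuousB _ _ _ (fun=> a + a) id); [exact: cst_continuous|exact: cvg_id].
have mw : measurable_fun setT (w : borel_rV R N -> R).
  by apply: measurable_fun_within => //; exact: continuous_subspaceT.
have phiB : phi @^-1` B = B.
  apply/seteqP; split => z; rewrite /B /euclidean_ball /phi /= -[normsq (_ - _ - _)]normsqN.
    by rewrite (_ : - _ = z - a)//; apply/rowP => j; rewrite !mxE; ring.
  by rewrite (_ : - (a + a - z - a) = z - a)//; apply/rowP => j; rewrite !mxE; ring.
have E := Rintegral_preserving mphi (lebesgue_rV_reflect (a + a)) mB mw iw.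
have E2 : \int[mu]_(z in B) w (phi z) = (w a + w a) * fine (mu B) - \int[mu]_(z in B) w z.
  rewrite -[X in X - _](Rintegral_cst mu mB) -RintegralB//; last first.
    by apply: (integrable_within cB muB); exact: within_continuous_cst.
  by apply: eq_Rintegral => z _; rewrite /w /phi !mxE; ring.
rewrite -(EFin_Rintegral_within cB muB cwB).
have -> : mu B = (fine (mu B))%:E by rewrite fineK// ge0_fin_numE// .
rewrite -EFinM; congr EFin.
by move: E E2; rewrite phiB => ->; rewrite -/(w a); lra.
Qed.

End linear_functions.

Section coordinates_msubharmonic.
Context (R : realType).

Lemma ddc_wedge_coord (n m : nat) (V : set 'rV[R]_(n.+1 + n.+1)) v (c : R) i :
  open V -> (forall j, (1 <= j < m)%N -> C2_msubharmonic m V (v j)) ->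
  ddc_wedge_nonneg m V (EFin \o (fun z : 'rV[R]_(n.+1 + n.+1) => c * z 0 i)) v.
Proof.
move=> oV Cv phi [Cphi _ [K [cK KV phi0]]].
set F := wedge_factors m phi v.
have F0 z : ~ K z -> F ord0 z = 0 by move=> /phi0; rewrite /F /wedge_factors eqxx.
have CF k : class_C 2 V (F k).
  rewrite /F /wedge_factors; case: eqP => [_|/eqP k0].
    by apply: (class_C_sub (V := setT)) => //; exact: Cphi.
  case: ifP => km; last exact: class_C2_normsq.
  by case: (Cv k) => //; rewrite lt0n k0.
have [iF F00] := integral_coord_ddc_wedge oV cK KV F0 CF i.
have out z : ~ V z -> ddc_wedge F z = 0.
  move=> nVz; have nKz : ~ K z by move=> /KV.
  have := wedge_sum_out cK F0 nKz; rewrite /ddc_wedge -/(wedge_sum F z) => ->.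
  exact: mulr0.
(* The density vanishes outside [K], hence outside [V], so the integral over [V] is the one over the
   whole space. *)
rewrite integral_mkcond.
pose w (z : 'rV[R]_(n.+1 + n.+1)) : R := c * z 0 i.
have -> : (fun z => (w z)%:E * (ddc_wedge F z)%:E)%E \_ V =
    (fun z : 'rV[R]_(n.+1 + n.+1) => c%:E * (z 0 i * ddc_wedge F z)%:E)%E.
  apply/funext => z; rewrite patchE; case: ifPn => Vz.
    by rewrite /w; move: (z 0 i) (ddc_wedge F z) => p q; rewrite -!EFinM mulrA.
  have -> : ddc_wedge F z = 0 by apply: out; move/negP: Vz; rewrite inE.
  by move: (z 0 i) => p; rewrite mulr0 mule0.
rewrite (integralZl measurableT iF).
move: F00; rewrite /Rintegral => F00.
rewrite -(fineK (integrable_fin_num measurableT iF)) F00 mule0; exact: lexx.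
Qed.

Lemma SHo_coord (n m : nat) (X : set 'rV[R]_(n + n)) (c : R) i :
  SHo m X (fun z => c * z 0 i).
Proof.
have cw : continuous (fun z : 'rV[R]_(n + n) => c * z 0 i).
  by move=> z; apply: continuousM; [exact: cst_continuous|exact: coord_continuous_rV].
exists setT, (fun z => c * z 0 i); split => //; [exact: openT| |by move=> z _; exact: cw].
split.
  split => //.
  - by move=> z _; exact: ltry.
  - by apply: upper_semicontinuous_within; exact: continuous_subspaceT.
  - by move=> z _; exists z => //; exact: connected_component_refl.
  - by move=> a r r0 _; rewrite /= (coord_mean_value a c i r0).
(* In dimension 0 there is no coordinate [i]. *)
move=> V v oV _ Cv; case: n X i {cw} V v oV Cv => [|n] X i V v oV Cv.
  by have := ltn_ord i.
exact: ddc_wedge_coord.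
Qed.

End coordinates_msubharmonic.

(** * Jensen measures and the Choquet boundary *)

Lemma closed_set1_rV (R : realType) (N : nat) (z : 'rV[R]_N) : closed [set z].
Proof. by apply: compact_closed; [exact: norm_hausdorff|exact: compact_set1]. Qed.

Section mean.
Context (R : realType) (N : nat) (X : set 'rV[R]_N).
Context (mu : {measure set (borel_rV R N) -> \bar R}).
Hypothesis cX : compact X.
Hypothesis muX : mu X = 1%E.
Local Notation C f := {within X, continuous f}.
Local Notation M f := (\int[mu]_(x in X) f x).

Let muXoo : (mu X < +oo)%E. Proof. by rewrite muX ltry. Qed.

Let mX : measurable (X : set (borel_rV R N)).
Proof. by apply: measurable_closed_rV; exact: compact_closed cX. Qed.

Lemma mean_cst (c : R) : M (fun=> c) = c.
Proof. by rewrite (Rintegral_cst mu mX c) muX mulr1. Qed.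

Lemma meanZD (a : R) (f g : 'rV[R]_N -> R) : C f -> C g ->
  M (fun x => a * f x + g x) = a * M f + M g.
Proof.
move=> Cf Cg; have iF := integrable_within cX muXoo Cf.
rewrite (RintegralD mX _ (integrable_within cX muXoo Cg)); last exact: (integrableZl mX a iF).
by rewrite (RintegralZl a mX iF).
Qed.

Lemma meanD (f g : 'rV[R]_N -> R) : C f -> C g -> M (fun x => f x + g x) = M f + M g.
Proof.
move=> Cf Cg.
exact: (RintegralD mX (integrable_within cX muXoo Cf) (integrable_within cX muXoo Cg)).
Qed.

Lemma mean_le (f g : 'rV[R]_N -> R) : C f -> C g -> (forall x, X x -> f x <= g x) ->
  M f <= M g.
Proof.
move=> Cf Cg; exact: (le_Rintegral mX (integrable_within cX muXoo Cf)
  (integrable_within cX muXoo Cg)).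
Qed.

Lemma mean_EFin (f : 'rV[R]_N -> R) : C f ->
  (M f)%:E = (\int[mu]_(x in X) (f x)%:E)%E.
Proof. exact: EFin_Rintegral_within. Qed.

(** A nonnegative function with integral at most 0 vanishes almost everywhere, and [normsq (x - z)]
    vanishes at [z] only; all the mass is therefore at [z]. *)
Lemma mean_normsq_eq0 (z : 'rV[R]_N) : mu (~` X) = 0%E -> X z ->
  M (fun x => normsq (x - z)) <= 0 ->
  forall A : set (borel_rV R N), measurable A -> mu A = \d_(z : borel_rV R N) A.
Proof.
move=> muXC Xz M0.
have cq : continuous (fun x : 'rV[R]_N => normsq (x - z)).
  move=> x; apply: continuous_comp; last exact: normsq_continuous.
  by apply: (@continuousB _ _ _ id (fun=> z)); [exact: cvg_id|exact: cst_continuous].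
have Cq : C (fun x => normsq (x - z)) by exact: continuous_subspaceT.
have q0 (x : 'rV[R]_N) : 0 <= normsq (x - z) by apply: sumr_ge0 => i _; exact: sqr_ge0.
have I0 : (\int[mu]_(x in X) `|(normsq (x - z))%:E| = 0)%E.
  transitivity (\int[mu]_(x in X) (normsq (x - z))%:E)%E.
    by apply: eq_integral => x _; rewrite gee0_abs// lee_fin q0.
  rewrite -(mean_EFin Cq); congr EFin; apply/eqP; rewrite eq_le M0 /=.
  by apply: Rintegral_ge0 => x _; exact: q0.
have mq : measurable_fun (X : set (borel_rV R N)) (fun x : borel_rV R N => (normsq (x - z))%:E).
  by apply/measurable_EFinP; exact: measurable_fun_within.
have nX : mu.-negligible (X `\` [set z]).
  have := (ae_eq_integral_abs mu mX mq).1 I0.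
  apply: negligibleS => x [Xx /= xz]; apply: contra_not xz => /(_ Xx) [qx].
  by apply/eqP; rewrite -subr_eq0; apply/eqP/normsq_eq0; rewrite qx.
have m1 : measurable ([set z] : set (borel_rV R N)).
  by apply: measurable_closed_rV; exact: closed_set1_rV.
have nXC : mu.-negligible (~` X) by apply/negligibleP => //; exact: measurableC.
have mu0 (A : set (borel_rV R N)) : measurable A -> (forall x, A x -> x <> z) -> mu A = 0%E.
  move=> mA Az; apply: measure_negligible => //; apply: negligibleS (negligibleU nX nXC).
  by move=> x Ax; have [Xx|] := pselect (X x); [left; split => //; exact: Az|right].
have mu1 (A : set (borel_rV R N)) : measurable A -> A z -> mu A = mu [set z].
  move=> mA Az; have mD : measurable (A `\` [set z]) by exact: measurableD.
  rewrite -[in LHS](setDUK (A := [set z]) (B := A)); last by move=> _ ->.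
  rewrite (measureU mu m1 mD); last by rewrite setDIK.
  have D0 : mu (A `\` [set z]) = 0%E by apply: mu0 => // x [].
  by rewrite [X in (_ + X)%E = _]D0 adde0.
move=> A mA; rewrite diracE; have [/set_mem Az|/negP nAz] := boolP (z \in A).
  by rewrite (mu1 A)// -(mu1 X).
by apply: mu0 => // x Ax xz; apply: nAz; rewrite inE -xz.
Qed.

End mean.

Lemma mean_dirac (R : realType) (N : nat) (X : set 'rV[R]_N)
    (mu : {measure set (borel_rV R N) -> \bar R}) z (f : 'rV[R]_N -> R) :
  compact X -> X z -> {within X, continuous f} ->
  (forall A : set (borel_rV R N), measurable A -> mu A = \d_(z : borel_rV R N) A) ->
  \int[mu]_(x in X) f x = f z.
Proof.
move=> cX Xz Cf muz.
have mX : measurable (X : set (borel_rV R N)).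
  by apply: measurable_closed_rV; exact: compact_closed cX.
rewrite /Rintegral (@eq_measure_integral _ _ _ _ (\d_(z : borel_rV R N)))//; last first.
  by move=> A mA _; exact: muz.
rewrite integral_dirac//; last by apply/measurable_EFinP; exact: measurable_fun_within.
by rewrite diracE mem_set// mul1e.
Qed.

(** * The cone of continuous functions tested by Jensen measures *)

Section choquet.
Context (R : realType) (n m : nat) (X : set 'rV[R]_(n + n)).
Local Notation Cn := 'rV[R]_(n + n).
Hypothesis cX : compact X.
Implicit Types (f g u v : Cn -> R) (z p : Cn) (mu : {measure set (borel_rV R (n + n)) -> \bar R}).
Local Notation C f := {within X, continuous f}.
Local Notation O := (Choquet_boundary m X).
Local Notation borel := (borel_rV R (n + n)).

(** Regularity is part of [Jensen], so it has to be verified before a measure equal to the Dirac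
    mass on Borel sets can count as a Jensen measure. *)
Lemma regular_dirac mu z :
  (forall A : set borel, measurable A -> mu A = \d_(z : borel) A) -> regular_measure mu.
Proof.
move=> muz A mA; split; apply/eqP; rewrite eq_le; apply/andP; split.
- apply: le_ereal_inf_tmp => _ [V [oV AV] <-].
  by apply: le_measure; rewrite ?inE//; exact: measurable_open_rV.
- rewrite (muz A mA) diracE; have [_|/negP nAz] := boolP (z \in A).
    apply: ereal_inf_lbound; exists setT; first by split; [exact: openT|].
    by rewrite muz ?diracT//; exact: measurableT.
  apply: ereal_inf_lbound; exists (~` [set z]).
    split; last by move=> x Ax /= xz; apply: nAz; rewrite inE -xz.
    by apply: closed_openC; exact: closed_set1_rV.
  rewrite muz; last first.
    apply: measurable_open_rV; apply: closed_openC.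
    exact: closed_set1_rV.
  by rewrite diracE memNset//= => /(_ erefl).
- rewrite (muz A mA) diracE; have [/set_mem Az|nAz] := boolP (z \in A).
    apply: ereal_sup_ubound; exists [set z].
      by split; [exact: compact_set1|move=> _ ->].
    rewrite muz; last first.
      by apply: measurable_closed_rV; exact: closed_set1_rV.
    by rewrite diracE mem_set.
  apply: ereal_sup_ubound; exists set0; last by rewrite measure0.
  by split; [exact: compact0|exact: sub0set].
- apply: ge_ereal_sup => _ [K [cK KA] <-].
  apply: le_measure; rewrite ?inE//.
  by apply: measurable_closed_rV; exact: compact_closed cK.
Qed.

Lemma SHo_within f : SHo m X f -> C f.
Proof.
move=> [U [w [_ XU _ cw fw]]].
apply: (@subspace_eq_continuous _ _ _ w); first by move=> x Xx; rewrite /from_subspace fw.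
by apply: continuous_in_subspaceT => x /set_mem/XU; exact: cw.
Qed.

(** The cone S of the overview. Being real-valued, its members are handled with the real integral;
    [SHC_SH] and [SH_SHC] translate to and from [SH]. *)
Definition SHC f := C f /\
  forall z mu, X z -> Jensen m X z mu -> f z <= \int[mu]_(x in X) f x.

Lemma Jensen_muX z mu : Jensen m X z mu -> mu X = 1%E.
Proof. by case. Qed.

Lemma SHC_SH f : SHC f -> SH m X (EFin \o f).
Proof.
move=> [Cf fJ]; split.
- by move=> z _; exact: ltry.
- exact: upper_semicontinuous_within.
- move=> z mu Xz Jmu; rewrite -(mean_EFin cX (Jensen_muX Jmu) Cf) lee_fin.
  exact: fJ.
Qed.

Lemma SH_SHC f : C f -> SH m X (EFin \o f) -> SHC f.
Proof.
move=> Cf [_ _ fJ]; split => // z mu Xz Jmu.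
by have := fJ z mu Xz Jmu; rewrite -(mean_EFin cX (Jensen_muX Jmu) Cf) lee_fin.
Qed.

Lemma SHC_SHo f : SHo m X f -> SHC f.
Proof.
move=> Sf; have Cf := SHo_within Sf; split => // z mu Xz Jmu.
have [_ muX _ /(_ f Sf)] := Jmu.
by rewrite -(mean_EFin cX muX Cf) lee_fin.
Qed.

Lemma SHC_cst (c : R) : SHC (fun=> c).
Proof.
split; first exact: within_continuous_cst.
by move=> z mu _ Jmu; rewrite (mean_cst cX (Jensen_muX Jmu)).
Qed.

Lemma SHC_ZD (a : R) f g : 0 <= a -> SHC f -> SHC g -> SHC (fun x => a * f x + g x).
Proof.
move=> a0 [Cf fJ] [Cg gJ]; split; first exact: within_continuousZD.
move=> z mu Xz Jmu; rewrite (meanZD cX (Jensen_muX Jmu))// lerD//; last exact: gJ.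
by rewrite ler_wpM2l//; exact: fJ.
Qed.

Lemma SHC_max f g : SHC f -> SHC g -> SHC (fun x => Num.max (f x) (g x)).
Proof.
move=> [Cf fJ] [Cg gJ]; have Cm := within_continuous_max Cf Cg; split => //.
move=> z mu Xz Jmu; rewrite ge_max; have muX := Jensen_muX Jmu; apply/andP; split.
  apply: le_trans (fJ z mu Xz Jmu) _; apply: (mean_le cX muX) => // x _.
  by rewrite le_max lexx.
apply: le_trans (gJ z mu Xz Jmu) _; apply: (mean_le cX muX) => // x _.
by rewrite le_max lexx orbT.
Qed.

Lemma within_continuous_uniform f :
  (forall e : R, 0 < e -> exists2 v, C v & forall x, X x -> `|f x - v x| <= e) -> C f.
Proof.
move=> fv; apply/subspace_continuousP => x Xx; apply/cvgrPdist_le => e e0.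
have e30 : 0 < e / 3 by rewrite divr_gt0.
have [v /subspace_continuousP/(_ x Xx)/cvgrPdist_le/(_ _ e30) vx fv'] := fv _ e30.
near=> y; have Xy : X y by near: y; exact: withinT.
have vxy : `|v x - v y| <= e / 3 by near: y.
change (`|f x - f y| <= e).
have := fv' x Xx; have := fv' y Xy; move: vxy.
rewrite !ler_norml => /andP[? ?] /andP[? ?] /andP[? ?].
by apply/andP; split; lra.
Unshelve. all: by end_near. Qed.

Lemma SHC_uniform f :
  (forall e : R, 0 < e -> exists2 v, SHC v & forall x, X x -> `|f x - v x| <= e) -> SHC f.
Proof.
move=> fv; have Cf : C f.
  by apply: within_continuous_uniform => e /fv[v [Cv _] fve]; exists v.
split => // z mu Xz Jmu; have muX := Jensen_muX Jmu.
apply/ler_addgt0Pr => e e0; have e20 : 0 < e / 2 by rewrite divr_gt0.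
have [v [Cv vJ] fve] := fv _ e20.
have vf : \int[mu]_(x in X) v x <= \int[mu]_(x in X) f x + e / 2.
  rewrite -[X in _ + X](mean_cst cX muX) -(meanD cX muX Cf); last exact: within_continuous_cst.
  apply: (mean_le cX muX) => // [|x Xx].
    by apply: within_continuousD => //; exact: within_continuous_cst.
  by have := fve x Xx; rewrite ler_norml => /andP[? ?]; lra.
have := vJ z mu Xz Jmu; have := fve z Xz; rewrite ler_norml => /andP[? ?] ?; lra.
Qed.

Lemma Jensen_dirac mu z : X z ->
  (forall A : set borel, measurable A -> mu A = \d_(z : borel) A) -> Jensen m X z mu.
Proof.
move=> Xz muz.
have mX : measurable (X : set borel).
  by apply: measurable_closed_rV; exact: compact_closed cX.
have muX : mu X = 1%E by rewrite muz// diracE mem_set.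
split => //; first exact: regular_dirac muz.
  rewrite muz; last exact: measurableC.
  by rewrite diracE memNset.
move=> u /SHo_within Cu; rewrite -(mean_EFin cX muX Cu) (mean_dirac cX Xz Cu muz).
exact: lexx.
Qed.

Lemma ChoquetP z : O z <-> X z /\ forall mu, Jensen m X z mu ->
  forall A : set borel, measurable A -> mu A = \d_(z : borel) A.
Proof.
split=> [[Xz Oz]|[Xz Oz]]; split => // mu; first by move/Oz.
by split; [exact: Oz|exact: Jensen_dirac].
Qed.

End choquet.

(** * Extension from the Choquet boundary and the maximum principle *)

Section choquet_boundary.
Context (R : realType) (n m : nat) (X : set 'rV[R]_(n + n)).
Local Notation Cn := 'rV[R]_(n + n).
Hypothesis cX : compact X.
Implicit Types (f g u v : Cn -> R) (z p : Cn) (mu : {measure set (borel_rV R (n + n)) -> \bar R}).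
Local Notation C f := {within X, continuous f}.
Local Notation O := (Choquet_boundary m X).
Local Notation SHC := (SHC m X).

Lemma SHC_minorant g z (c : R) : O z -> C g -> c < g z ->
  exists v, [/\ SHC v, forall x, X x -> v x <= g x & c < v z].
Proof.
move=> Oz Cg cg; have [Xz zP] := (ChoquetP m cX z).1 Oz.
apply: contrapT => nex.
have vc v : SHC v -> (forall x, X x -> v x <= g x) -> v z <= c.
  move=> Sv vg; rewrite leNgt; apply/negP => cv; apply: nex; by exists v.
(* Up to sign, [p (- g)] is the supremum of [v z] over the [v] of the cone below [g]. That supremum
   is superlinear in [g]; the signs make [p] sublinear, and the failure of the lemma reads
   [- c <= p (- g)]. *)
pose E f : set R := [set y | exists2 v, SHC v & (forall x, X x -> f x <= - v x) /\ y = - v z].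
pose p f : R := inf (E f).
have E0 f : C f -> E f !=set0.
  move=> Cf; have [M M0 fM] := within_compact_bounded cX Cf.
  exists (- - M), (fun=> - M); first exact: SHC_cst.
  by split => // x Xx; rewrite opprK (le_trans (ler_norm _))//; exact: fM.
have lbE f : lbound (E f) (f z) by move=> _ [v _ [fv ->]]; exact: fv.
have pE f v : SHC v -> (forall x, X x -> f x <= - v x) -> p f <= - v z.
  by move=> Sv fv; apply: ge_inf; [exists (f z); exact: lbE|exists v].
have pge f y : C f -> lbound (E f) y -> y <= p f.
  by move=> Cf; apply: lb_le_inf; exact: E0.
pose CC : set (Cn -> R^o) := [set f : Cn -> R^o | C (f : Cn -> R)].
have CC0 : CC 0 by exact: within_continuous_cst.
have CCZD (a : R) (f h : Cn -> R^o) : CC f -> CC h -> CC (a *: f + h).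
  exact: within_continuousZD.
have subp : sublinear_on CC p.
  split=> [f h Cf Ch|a f a0 Cf].
    rewrite -lerBlDr; apply: (pge) => // _ [v Sv [fv ->]].
    rewrite lerBlDr -lerBlDl; apply: (pge) => // _ [w Sw [hw ->]].
    rewrite lerBlDl; have -> : - v z + - w z = - (1 * v z + w z) by rewrite mul1r opprD.
    apply: (pE _ (fun x => 1 * v x + w x)); first exact: SHC_ZD.
    by move=> x Xx; rewrite mul1r opprD; apply: lerD; [exact: fv|exact: hw].
  have aE v : SHC v -> (forall x, X x -> f x <= - v x) -> p (a *: f) <= a * - v z.
    move=> Sv fv; have -> : a * - v z = - (a * v z + 0) by rewrite addr0 mulrN.
    apply: (pE _ (fun x => a * v x + 0)); first by apply: SHC_ZD => //; exact: SHC_cst.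
    by move=> x Xx; rewrite addr0 -mulrN; apply: ler_wpM2l => //; exact: fv.
  have [a_eq0|an0] := eqVneq a 0.
    by have [_ [v Sv [fv _]]] := E0 _ Cf; have := aE v Sv fv; rewrite a_eq0 !mul0r.
  have {a0 an0}a0 : 0 < a by rewrite lt_neqAle eq_sym an0.
  rewrite mulrC -ler_pdivrMr//; apply: (pge) => // _ [v Sv [fv ->]].
  by rewrite ler_pdivrMr// mulrC; exact: aE.
have Cg' : CC (fun x => - g x).
  have := within_continuousB (@within_continuous_cst R _ X 0) Cg.
  by rewrite (_ : (fun x => 0 - g x) = (fun x => - g x))//; apply/funext => x; rewrite sub0r.
have [L [LZD Lp Lg]] := hahn_banach CC0 CCZD subp Cg'.
have L0 : L (0 : Cn -> R^o) = 0.
  have := LZD 1 0 0 CC0 CC0; rewrite scaler0 addr0 mul1r; lra.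
have LN f : CC f -> L (- f) = - L f.
  move=> Cf; have := LZD (-1) f 0 Cf CC0.
  by rewrite addr0 scaleN1r L0 mulN1r addr0.
(* Constants of both signs lie in the cone, so [p] is at most 1 at 1 and at most -1 at -1. *)
have Lcst1 : L (fun=> 1) = 1.
  have C1 : CC (fun=> 1) by exact: within_continuous_cst.
  have CN1 : CC (fun=> -1) by exact: within_continuous_cst.
  have : L (fun=> -1) = - L (fun=> 1) by exact: (LN _ C1).
  have := le_trans (Lp _ C1) (pE (fun=> 1) (fun=> -1) (SHC_cst m cX _) _).
  have := le_trans (Lp _ CN1) (pE (fun=> -1) (fun=> 1) (SHC_cst m cX _) _).
  rewrite opprK => /(_ (fun x _ => lexx _)) h1 /(_ (fun x _ => lexx _)) h2 h3; lra.
have Lpos f : C f -> (forall x, X x -> 0 <= f x) -> 0 <= L f.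
  move=> Cf f0; have CNf : CC (- (f : Cn -> R^o)).
    by have := CCZD (-1) f 0 Cf CC0; rewrite scaleN1r addr0.
  have := le_trans (Lp _ CNf) (pE (fun x => - f x) (fun=> 0) (SHC_cst m cX _) _).
  rewrite (LN f Cf) oppr0 oppr_le0; apply => x Xx.
  by rewrite oppr_le0; exact: f0.
have [nu [regnu nuX nuXC nuL]] := riesz_representation cX LZD Lpos Lcst1.
(* For [u] in the cone, [u] itself is admissible in the infimum [p (- u)], whence
   [L (- u) <= - u z]. *)
have Jnu : Jensen m X z nu.
  split => // u Su; have [Cu _] := SHC_SHo cX Su.
  rewrite -(mean_EFin cX nuX Cu) lee_fin (nuL u Cu).
  have CNu : CC (- (u : Cn -> R^o)).
    by have := CCZD (-1) u 0 Cu CC0; rewrite scaleN1r addr0.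
  have := le_trans (Lp _ CNu) (pE (fun x => - u x) u (SHC_SHo cX Su) (fun _ _ => lexx _)).
  by rewrite (LN u Cu) lerN2.
have Lz f : C f -> L f = f z.
  by move=> Cf; rewrite -(nuL f Cf); exact: (mean_dirac cX Xz Cf (zP nu Jnu)).
(* As [nu] is the Dirac mass at [z], the equality [L (- g) = p (- g)] turns this into [g z <= c]. *)
have : - c <= p (fun x => - g x).
  apply: (pge) => // _ [v Sv [gv ->]]; rewrite lerN2; apply: (vc) => // x Xx.
  by have := gv x Xx; rewrite lerN2.
by rewrite -Lg (Lz _ Cg') lerN2 leNgt cg.
Qed.

(** Halving the error on [O] is the gain; the bound [w <= v + e] on all of [X] is what later yields
    uniform convergence on [X]. *)
Lemma approximation_step F v (e : R) : compact O -> C F -> SHC v -> 0 < e ->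
  (forall x, O x -> v x <= F x <= v x + e) ->
  exists w, [/\ SHC w, forall x, X x -> v x <= w x <= v x + e &
    forall x, O x -> w x <= F x <= w x + e / 2].
Proof.
move=> cO CF Sv e0 vF; have OX : O `<=` X by move=> x [].
have Cv : C v by case: Sv.
(* Minorants of [g] respect both bounds at once, and [g] coincides with [F] on [O], so approaching
   [g] there is approaching [F]. *)
pose g x := Num.min (v x + e) (F x).
have Cg : C g.
  apply: within_continuous_min => //; apply: within_continuousD => //.
  exact: within_continuous_cst.
have gO x : O x -> g x = F x by move=> /vF/andP[_ ?]; rewrite /g min_r.
have [w [Sw wg wO]] : exists w, [/\ SHC w, forall x, X x -> w x <= g x &
    forall x, O x -> F x - e / 2 < w x].
  apply: (@compact_induction _ O (fun A => exists w, [/\ SHC w,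
      forall x, X x -> w x <= g x & forall x, A x -> F x - e / 2 < w x]) cO).
  - have [M _ gM] := within_compact_bounded cX Cg.
    exists (fun=> - M); split => //; first exact: SHC_cst.
    by move=> x Xx; have := gM x Xx; rewrite ler_norml => /andP[].
  - by move=> A B AB [w [Sw wg wB]]; exists w; split => // x /AB; exact: wB.
  - move=> A B [u [Su ug uA]] [w [Sw wg wB]].
    exists (fun x => Num.max (u x) (w x)); split; first exact: SHC_max.
      by move=> x Xx; rewrite ge_max ug// wg.
    by move=> x [Ax|Bx]; rewrite lt_max; apply/orP; [left; exact: uA|right; exact: wB].
  - move=> z Oz; have ez : g z - e / 2 < g z by rewrite ltrBlDr ltrDl divr_gt0.
    have [w [Sw wg wz]] := SHC_minorant Oz Cg ez.
    have [Cw _] := Sw.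
    (* The minorant chosen at [z] remains within [e / 2] of [F] on a neighbourhood of [z] in [X];
       finitely many such neighbourhoods cover [O], and maxima combine the minorants. *)
    have [U oU UE] := within_continuous_lt (e / 2) (within_continuousB CF Cw).
    exists U; last first.
      exists w; split => // x [Ux Ox]; have := (UE x (OX x Ox)).1 Ux; lra.
    apply: open_nbhs_nbhs; split => //; apply/(UE z (OX z Oz)).
    by move: wz; rewrite gO//; lra.
exists (fun x => Num.max (v x) (w x)); split; first exact: SHC_max.
  move=> x Xx; rewrite le_max lexx ge_max lerDl (ltW e0) /=.
  by apply: le_trans (wg x Xx) _; rewrite /g ge_min lexx.
move=> x Ox; have /andP[vFx _] := vF x Ox; rewrite ge_max vFx /=.
rewrite -{1}(gO x Ox) (wg x (OX x Ox)) /= -lerBlDr le_max; apply/orP; right.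
exact/ltW/wO.
Qed.

Lemma SHC_extension F : compact O -> C F -> exists2 u, SHC u & forall x, O x -> u x = F x.
Proof.
move=> cO CF; have OX : O `<=` X by move=> x [].
have [M M0 FM] := within_compact_bounded cX CF.
(* The initial error is [2 * M], since the iteration starts at the constant [- M] and [F] is at most
   [M]. *)
pose e k : R := 2 * M / 2 ^+ k.
have e0 k : 0 < e k by rewrite !mulr_gt0// invr_gt0 exprn_gt0.
have eS k : e k.+1 = e k / 2 by rewrite /e exprSr invfM mulrA.
pose P k v := SHC v /\ forall x, O x -> v x <= F x <= v x + e k.
(* The step is stated as an implication so that [choice] gives a total function [next]. *)
have stepP (kv : nat * (Cn -> R)) : exists w, P kv.1 kv.2 ->
    P kv.1.+1 w /\ forall x, X x -> kv.2 x <= w x <= kv.2 x + e kv.1.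
  case: kv => k v /=; have [[Sv vF]|nP] := pselect (P k v); last by exists v.
  have [w [Sw vw wF]] := approximation_step cO CF Sv (e0 k) vF.
  by exists w => _; split => //; split => // x /wF; rewrite eS.
have [next nextP] := choice stepP.
pose vs := fix vs k := if k is k'.+1 then next (k', vs k') else (fun=> - M).
have Pvs k : P k (vs k).
  elim: k => [|k ih]; last by have [] := nextP (k, vs k) ih.
  split; first exact: SHC_cst.
  move=> x /OX/FM; rewrite ler_norml /e expr0 divr1 => /andP[? ?]; apply/andP; split => //=; lra.
have vsS k x : X x -> vs k x <= vs k.+1 x <= vs k x + e k.
  by move=> Xx; have [_ /(_ x Xx)] := nextP (k, vs k) (Pvs k).
have vs_homo x : X x -> {homo (fun k => vs k x) : i j / (i <= j)%N >-> i <= j}.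
  by move=> Xx; apply: homo_leq => [//|? ? ?|k]; [exact: le_trans|have /andP[] := vsS k x Xx].
(* The sum of all increments from stage [k] on is at most [e k + e k.+1 + ... = 2 * e k], so these
   upper bounds decrease. *)
have vse_homo x : X x -> {homo (fun k => vs k x + 2 * e k) : i j / (i <= j)%N >-> j <= i}.
  move=> Xx; apply: homo_leq => [//|b a c ba cb|k]; first exact: le_trans cb ba.
  by have /andP[_] := vsS k x Xx; rewrite eS; lra.
have vs_le x i j : X x -> vs i x <= vs j x + 2 * e j.
  move=> Xx; have [ij|/ltnW ji] := leqP i j.
    by apply: le_trans (vs_homo x Xx _ _ ij) _; rewrite lerDl mulr_ge0// ltW.
  by apply: le_trans (vse_homo x Xx _ _ ji); rewrite lerDl mulr_ge0// ltW.
pose u x := sup (range (fun k => vs k x)).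
have u_ge x k : X x -> vs k x <= u x.
  move=> Xx; apply: ub_le_sup; last by exists k.
  by exists (vs 0%N x + 2 * e 0%N) => _ [i _ <-]; exact: vs_le.
have u_le x k : X x -> u x <= vs k x + 2 * e k.
  move=> Xx; apply: ge_sup; first by exists (vs 0%N x), 0%N.
  by move=> _ [i _ <-]; exact: vs_le.
have e_small (d : R) : 0 < d -> exists k, 2 * e k <= d.
  move=> d0; have d40 : 0 < d / (4 * M) by rewrite divr_gt0// mulr_gt0.
  have [k _ /(_ k (leqnn k)) /= hk] := near_infty_natSinv_expn_lt (PosNum d40).
  exists k; have -> : 2 * e k = (1 / 2 ^+ k) * (4 * M).
    by rewrite /e; move: (_^-1) => b; lra.
  by rewrite -ler_pdivlMr ?mulr_gt0// ltW.
exists u; last first.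
  move=> x Ox; have Xx := OX x Ox; apply/eqP; rewrite -subr_eq0 -normr_le0.
  apply/ler_addgt0Pr => d /e_small[k kd]; rewrite add0r; apply: le_trans kd.
  have [_ /(_ x Ox)/andP[h1 h2]] := Pvs k.
  have h3 := u_ge x k Xx; have h4 := u_le x k Xx; have h5 := e0 k.
  by rewrite ler_norml; apply/andP; split; lra.
apply: (SHC_uniform cX) => d /e_small[k kd]; exists (vs k); first by case: (Pvs k).
move=> x Xx; have h3 := u_ge x k Xx; have h4 := u_le x k Xx.
by rewrite ger0_norm ?subr_ge0// lerBlDl; apply: le_trans h4 _; rewrite lerD2l.
Qed.

Lemma normsq_subr_continuous z : continuous (fun x : Cn => normsq (x - z)).
Proof.
move=> x; apply: continuous_comp; last exact: normsq_continuous.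
by apply: (@continuousB _ _ _ id (fun=> z)); [exact: cvg_id|exact: cst_continuous].
Qed.

Lemma Jensen_coord z mu i : X z -> Jensen m X z mu -> \int[mu]_(x in X) x 0 i = z 0 i.
Proof.
move=> Xz Jmu; have muX := Jensen_muX Jmu.
have Ci : C (fun x => x 0 i) by apply: continuous_subspaceT; exact: coord_continuous_rV.
have C0 : C (fun=> 0 : R) by exact: within_continuous_cst.
have h (c : R) : c * z 0 i <= c * \int[mu]_(x in X) x 0 i.
  have [_ /(_ z mu Xz Jmu)] := SHC_SHo cX (@SHo_coord R n m X c i).
  have := meanZD cX muX c Ci C0; rewrite (mean_cst cX muX) addr0 => <-.
  by under eq_Rintegral do rewrite -[_ * _]addr0.
by have := h 1; have := h (-1); lra.
Qed.

(** The difference [normsq (x - p) - normsq (x - z)] is affine in [x], so a measure with barycenter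
    [z] integrates it to its value at [z]. *)
Lemma Jensen_normsq z mu p : X z -> Jensen m X z mu ->
  \int[mu]_(x in X) normsq (x - p) = normsq (z - p) + \int[mu]_(x in X) normsq (x - z).
Proof.
move=> Xz Jmu; have muX := Jensen_muX Jmu.
have Ci i : C (fun x => x 0 i) by apply: continuous_subspaceT; exact: coord_continuous_rV.
have Cq : C (fun x => normsq (x - z)).
  by apply: continuous_subspaceT; exact: normsq_subr_continuous.
have Ccst (c : R) : C (fun=> c) by exact: within_continuous_cst.
have Clin (r : seq 'I_(n + n)) (c d : 'I_(n + n) -> R) :
   C (fun x => \sum_(i <- r) (c i * x 0 i + d i)) /\
   \int[mu]_(x in X) (\sum_(i <- r) (c i * x 0 i + d i)) = \sum_(i <- r) (c i * z 0 i + d i).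
  elim: r => [|i r [Cr Er]].
    have -> : (fun x : Cn => \sum_(i <- [::]) (c i * x 0 i + d i)) = (fun=> 0).
      by apply/funext => x; rewrite big_nil.
    by rewrite (mean_cst cX muX) big_nil.
  have -> : (fun x : Cn => \sum_(i <- i :: r) (c i * x 0 i + d i)) =
     (fun x : Cn => (c i * x 0 i + d i) + \sum_(i <- r) (c i * x 0 i + d i)).
    by apply/funext => x; rewrite big_cons.
  have C1 := within_continuousZD (a := c i) (Ci i) (Ccst (d i)).
  split; first exact: within_continuousD.
  rewrite (meanD cX muX C1 Cr) Er (meanZD cX muX _ (Ci i) (Ccst _)) (mean_cst cX muX).
  by rewrite (Jensen_coord i Xz Jmu) big_cons.
pose c i := 2 * (z 0 i - p 0 i).
pose d i := (z 0 i - p 0 i) ^+ 2 - 2 * (z 0 i - p 0 i) * z 0 i.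
have [Cl El] := Clin (index_enum _) c d.
have E x : normsq (x - p) = (\sum_i (c i * x 0 i + d i)) + normsq (x - z).
  rewrite /normsq -big_split; apply: eq_bigr => i _; rewrite /c /d !mxE /=.
  by move: (x 0 i) (z 0 i) (p 0 i) => a b t; ring.
have z0 : normsq (z - z) = 0 by rewrite subrr /normsq big1// => i _; rewrite mxE expr0n.
transitivity (\int[mu]_(x in X) (\sum_i (c i * (x : Cn) 0 i + d i) + normsq ((x : Cn) - z))).
  by apply: eq_Rintegral => x _; rewrite E.
by rewrite (meanD cX muX Cl Cq) El (E z) z0 addr0.
Qed.

Lemma Jensen_concentrated z mu : X z -> Jensen m X z mu ->
  \int[mu]_(x in X) normsq (x - z) <= 0 ->
  forall A : set (borel_rV R (n + n)), measurable A -> mu A = \d_(z : borel_rV R (n + n)) A.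
Proof. by move=> Xz [_ muX muXC _]; exact: mean_normsq_eq0. Qed.

Lemma SHC_normsq p : SHC (fun x => normsq (x - p)).
Proof.
split; first by apply: continuous_subspaceT; exact: normsq_subr_continuous.
move=> z mu Xz Jmu; rewrite (Jensen_normsq p Xz Jmu) lerDl; apply: Rintegral_ge0 => x _.
by apply: sumr_ge0 => i _; exact: sqr_ge0.
Qed.

(* For small [e > 0] the maximum of [u + e |z|^2] over [X] is attained at a
   Choquet point, since a Jensen measure has positive variance unless it is a
   Dirac mass. *)
Lemma maximum_principle u : SHC u -> (forall x, O x -> u x <= 0) ->
  forall x, X x -> u x <= 0.
Proof.
move=> Su uO x Xx; rewrite leNgt; apply/negP => ux0.
pose q (y : Cn) := normsq (y - 0).
have q0 y : 0 <= q y by apply: sumr_ge0 => i _; exact: sqr_ge0.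
have [[Cu uJ] [Cq _]] := (Su, SHC_normsq 0).
have [M M0 qM] := within_compact_bounded cX Cq.
(* With this choice the perturbation [e * q] is at most [u x / 2] on [X], too small to let a maximum
   point [p] with [u p <= 0] compete with [x]. *)
pose e := u x / (2 * M).
have e0 : 0 < e by rewrite divr_gt0// mulr_gt0.
have Ch := within_continuousZD (a := e) Cq Cu.
have [p /set_mem Xp pmax] := compact_EVT_max (ex_intro _ x Xx) cX Ch.
have Op : O p.
  apply/(ChoquetP m cX); split => // mu Jmu; apply: Jensen_concentrated => //.
  have muX := Jensen_muX Jmu.
  have h1 := uJ p mu Xp Jmu.
  have h2 := Jensen_normsq 0 Xp Jmu.
  have h3 : \int[mu]_(y in X) (e * q y + u y) <= e * q p + u p.
    rewrite -[leRHS](mean_cst cX muX); apply: (mean_le cX muX) => //.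
      exact: within_continuous_cst.
    by move=> y Xy; apply: pmax; rewrite inE.
  rewrite (meanZD cX muX e Cq Cu) h2 in h3.
  (* The mean of [e * q + u] is at most its maximum [e * q p + u p], and at least that value plus
     [e] times the variance about [p]; the variance is thus at most 0. *)
  rewrite -(pmulr_rle0 _ e0); move: h3 h1; rewrite -/(q p) mulrDr.
  move: (\int[mu]_(y in X) u y) (e * \int[mu]_(y in X) _) (e * q p) => a b t; lra.
have := uO p Op; have := pmax x; rewrite inE => /(_ Xx).
have : e * q p <= u x / 2.
  have qpM : q p <= M by rewrite (le_trans (ler_norm _))// qM.
  have -> : u x / 2 = e * M by rewrite /e; field; rewrite gt_eqF.
  by rewrite ler_pM2l.
have : 0 <= e * q x by rewrite mulr_ge0// ltW.
move: (e * q x) (e * q p) => a b; lra.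
Qed.

End choquet_boundary.

Theorem theorem4p2 (R : realType) (n m : nat) (X : set 'rV[R]_(n + n)) :
  (1 <= m)%N -> (m <= n)%N -> compact X ->
  [<-> O_regular m X;
       (forall f : 'rV[R]_(n + n) -> R,
          {within Choquet_boundary m X, continuous f} ->
          exists u : 'rV[R]_(n + n) -> R,
            [/\ SH m X (EFin \o u), {within X, continuous u} &
                {in Choquet_boundary m X, u =1 f}]);
       (forall f : 'rV[R]_(n + n) -> R,
          {within Silov_boundary m X, continuous f} ->
          exists u : 'rV[R]_(n + n) -> R,
            [/\ SH m X (EFin \o u), {within X, continuous u} &
                {in Silov_boundary m X, u =1 f}])].
Proof.
move=> _ _ cX.
have OX : Choquet_boundary m X `<=` X by move=> x [].
have OB : Choquet_boundary m X `<=` Silov_boundary m X by exact: subset_closure.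
have BX : Silov_boundary m X `<=` X.
  by move=> x /(closureS OX); apply: (compact_closed _ cX); exact: norm_hausdorff.
tfae.
- move=> clO f Cf; have cO := subclosed_compact clO cX OX.
  have [M M0 fM] := within_compact_bounded cO Cf.
  (* Tietze's theorem supplies a continuous function on the whole space, because [SHC_extension]
     works with functions continuous on [X]. *)
  have [F [fF cF _]] := continuous_bounded_extension pseudometric_normal clO M0 Cf fM.
  have [u Su uF] := SHC_extension cX cO (continuous_subspaceT cF).
  exists u; split; [exact: (SHC_SH cX)|by case: Su|].
  by move=> x Ox; rewrite fF// uF//; exact: set_mem.
- move=> ext f Cf; have [u [Su Cu uf]] := ext f (continuous_subspaceW OB Cf).
  exists u; split => // z /set_mem Bz.
  (* If [u - f] were nonzero at a point of the closure, it would keep its sign on a neighbourhood of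
     that point, which meets [O], where [u - f] is 0. *)
  have := within_continuousB (continuous_subspaceW BX Cu) Cf => Cd.
  apply/eqP; rewrite -subr_eq0 eq_le; apply/andP; split; rewrite leNgt; apply/negP => d0.
    have [U oU UE] := within_continuous_gt 0 Cd.
    have [x [Ox Ux]] := Bz U (open_nbhs_nbhs (conj oU ((UE z Bz).2 d0))).
    by have := (UE x (OB x Ox)).1 Ux; rewrite uf ?inE// subrr ltxx.
  have [U oU UE] := within_continuous_lt 0 Cd.
  have [x [Ox Ux]] := Bz U (open_nbhs_nbhs (conj oU ((UE z Bz).2 d0))).
  by have := (UE x (OB x Ox)).1 Ux; rewrite uf ?inE// subrr ltxx.
- move=> ext z Bz; have Xz := BX z Bz.
  have Cq : {within Silov_boundary m X, continuous (fun x => normsq (x - z))}.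
    by apply: continuous_subspaceT; exact: normsq_subr_continuous.
  have [u [Su Cu uq]] := ext _ (within_continuousB (within_continuous_cst (c := 0)) Cq).
  have {}Su := SH_SHC cX Cu Su.
  (* The sum lies in the cone and vanishes on [O], so the maximum principle extends the inequality
     to [X]. *)
  have uqX x : X x -> normsq (x - z) + u x <= 0.
    have Suq := SHC_ZD cX ler01 (SHC_normsq m cX z) Su.
    move=> Xx; have := maximum_principle cX Suq _ Xx; rewrite mul1r; apply.
    by move=> y Oy; rewrite uq ?inE; [lra|exact: OB].
  apply/(ChoquetP m cX); split => // mu Jmu; apply: (Jensen_concentrated cX Xz Jmu).
  have uz : u z = 0.
    rewrite uq ?inE// sub0r subrr /normsq big1 ?oppr0// => i _.
    by rewrite mxE expr0n.
  have [[[Cu' uJ] [Cq' _]] muX] := (Su, SHC_normsq m cX z, Jensen_muX Jmu).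
  (* Together with [0 = u z <= int u dmu], this leaves at most 0 for the variance of [mu] about
     [z]. *)
  have h1 : \int[mu]_(x in X) (normsq (x - z) + u x) <= 0.
    rewrite -[leRHS](mean_cst cX muX); apply: (mean_le cX muX) => //.
      exact: within_continuousD.
    exact: within_continuous_cst.
  have := uJ z mu Xz Jmu; move: h1; rewrite (meanD cX muX Cq' Cu') uz.
  move: (\int[mu]_(x in X) u x) (\int[mu]_(x in X) _) => a b; lra.
Qed.
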